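(* Let $(R,\mathfrak m,k)$ be a $d$-dimensional regular local ring of characteristic $p>0$, and let $I\subset\mathfrak m$ be an ideal. Suppose that $\ell_R\bigl(H^{d-i}_{\mathfrak m}(R/I)\bigr)<\infty$ for some fixed $i\ge 0$. Then $H^i_I(R)$ is a divisible $R$-module. In particular, for any nonzero element $x\in R$, the multiplication map $H^i_I(R)\xrightarrow{\times x}H^i_I(R)$ is surjective.
   Context: All rings are commutative, noetherian, with unity. $H^i_I(-)$ denotes local cohomology with support in $I$, and $\ell_R(-)$ denotes length. An $R$-module $M$ is divisible if for every regular element $r\in R$ and every $m\in M$ there exists $m'\in M$ with $m=rm'$. *)

(* Defs.v *)
From HB Require Import structures.
From mathcomp Require Import all_boot all_order all_algebra.
From mathcomp Require Import boolp.

Set Implicit Arguments.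
Unset Strict Implicit.
Unset Printing Implicit Defensive.

Import GRing.Theory.
Local Open Scope ring_scope.
Local Open Scope quotient_scope.

Section Submodule.
Variables (R : comNzRingType) (V : lmodType R) (N : submodClosed V).

Definition submod : Type := {x : V | x \in N}.

HB.instance Definition _ := SubChoice.on submod.
HB.instance Definition _ := [SubChoice_isSubLmodule of submod by <:].

End Submodule.

(** A copy of [N] that is also canonically closed under opposite, which the
    library's [submodClosed] does not record and [Quotient.quot] requires. *)
Section SubmodPred.
Variables (R : comNzRingType) (V : lmodType R) (N : submodClosed V).

Definition submod_pred : {pred V} := fun x => x \in N.

HB.instance Definition _ :=
  GRing.isSubmodClosed.Build R V submod_pred (submodClosedP N).

End SubmodPred.

Notation "{ 'quot' N }" := (Quotient.quot (submod_pred N)) : type_scope.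

Section QuotientModule.
Variables (R : comNzRingType) (V : lmodType R) (N : submodClosed V).

(** The additive group [{quot N}] is the library's; only scaling is added. *)
Definition qscale (a : R) (x : {quot N}) : {quot N} :=
  \pi_({quot N}) (a *: repr x).

Lemma pi_qscale a (x : V) : qscale a (\pi_({quot N}) x) = \pi_({quot N}) (a *: x).
Proof.
rewrite /qscale; apply/eqP; rewrite -Quotient.idealrBE -scalerBr.
by apply: rpredZ; rewrite Quotient.idealrBE reprK.
Qed.

Lemma qscaleA a b x : qscale a (qscale b x) = qscale (a * b) x.
Proof. by rewrite -[x]reprK (pi_qscale b) !pi_qscale scalerA. Qed.

Lemma qscale1 : left_id 1 qscale.
Proof. by move=> x; rewrite -[x]reprK pi_qscale scale1r. Qed.

Lemma qscaleDr : right_distributive qscale +%R.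
Proof.
move=> a x y; rewrite -[x]reprK -[y]reprK.
by rewrite -raddfD !pi_qscale scalerDr raddfD.
Qed.

Lemma qscaleDl x : {morph qscale^~ x : a b / a + b}.
Proof.
by move=> a b; rewrite -[x]reprK !pi_qscale scalerDl raddfD.
Qed.

HB.instance Definition _ :=
  GRing.Zmodule_isLmodule.Build R {quot N} qscaleA qscale1 qscaleDr qscaleDl.

End QuotientModule.

Definition strict_sub (T : Type) (A B : {pred T}) : Prop :=
  {subset A <= B} /\ exists2 x, x \in B & x \notin A.

(** The length of [M] is the supremum of the [n] for which there is a chain
    [N 0 < N 1 < ... < N n] of submodules. *)
Definition finite_length (R : comNzRingType) (M : lmodType R) : Prop :=
  exists b : nat, forall (n : nat) (N : nat -> submodClosed M),
    (forall k, (k < n)%N -> strict_sub (N k) (N k.+1)) -> (n <= b)%N.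

(** Over a commutative ring, [GRing.lreg r] says that [r] is a
    non-zero-divisor. *)
Definition divisible (R : comNzRingType) (M : lmodType R) : Prop :=
  forall r : R, GRing.lreg r -> forall u : M, exists v : M, u = r *: v.

(** Ideals are the submodules of the regular module, so that the unit ideal is
    allowed (the library's [idealr] is restricted to proper ideals). *)
Notation ideal R := (submodClosed (R : comNzRingType)^o).

Section Ideals.
Variable R : comNzRingType.

Definition generates (s : seq R) (I : ideal R) : Prop :=
  forall x : R, x \in I <->
    exists c : nat -> R, x = \sum_(i < size s) c i * s`_i.

Definition noetherian : Prop := forall I : ideal R, exists s, generates s I.

Definition prime_ideal (P : ideal R) : Prop :=
  1 \notin P /\ prime_idealr_closed (P : {pred R}).

Definition maximal_ideal (m : ideal R) : Prop :=
  1 \notin m /\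
  forall J : ideal R, 1 \notin J -> {subset m <= J} -> {subset J <= m}.

Definition prime_chain (n : nat) (Q : nat -> ideal R) : Prop :=
  (forall k, (k <= n)%N -> prime_ideal (Q k)) /\
  (forall k, (k < n)%N -> strict_sub (Q k) (Q k.+1)).

Definition has_krull_dim (d : nat) : Prop :=
  (exists Q, prime_chain d Q) /\
  (forall n Q, prime_chain n Q -> (n <= d)%N).

Definition local_ring (m : ideal R) : Prop :=
  maximal_ideal m /\ forall n : ideal R, maximal_ideal n -> n =i m.

(** The embedding dimension, i.e. the minimal number of generators of the
    maximal ideal, is equal to the Krull dimension. *)
Definition regular_local_ring (m : ideal R) (d : nat) : Prop :=
  [/\ noetherian, local_ring m, has_krull_dim d,
      exists2 s : seq R, generates s m & size s = d
    & forall s : seq R, generates s m -> (d <= size s)%N].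

(** The coefficients [c j] make [ideal_pow I 0] the unit ideal. *)
Definition ideal_pow (I : ideal R) (n : nat) (a : R) : Prop :=
  exists (r : nat) (c : 'I_r -> R) (f : 'I_r -> 'I_n -> R),
    (forall j k, f j k \in I) /\ a = \sum_j c j * \prod_k f j k.

Lemma ideal_powDl I n l a : ideal_pow I (n + l) a -> ideal_pow I n a.
Proof.
move=> [r [c [f [fI ->]]]].
exists r, (fun j => c j * \prod_k f j (rshift n k)), (fun j k => f j (lshift l k)).
split=> [j k|]; first exact: fI.
by apply: eq_bigr => j _; rewrite big_split_ord /= -mulrA (mulrC (\prod_k _)).
Qed.

End Ideals.

Section Torsion.
Variables (R : comNzRingType) (I : ideal R).

Definition torsion (M : lmodType R) : {pred M} :=
  fun x => `[< exists n, forall a, ideal_pow I n a -> a *: x = 0 >].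

Lemma torsion_submod_closed (M : lmodType R) : submod_closed (@torsion M).
Proof.
split=> [|a x y /asboolP[n xn] /asboolP[l yl]]; apply/asboolP.
  by exists 0%N => a _; rewrite scaler0.
exists (n + l)%N => b bI.
rewrite scalerDr scalerA mulrC -scalerA xn ?yl ?scaler0 ?addr0 //.
  by move: bI; rewrite addnC; apply: ideal_powDl.
exact: ideal_powDl bI.
Qed.

HB.instance Definition _ (M : lmodType R) :=
  GRing.isSubmodClosed.Build R M (@torsion M) (torsion_submod_closed M).

Definition Gamma (M : lmodType R) : lmodType R := submod (@torsion M).

Section GammaMap.
Variables (M M' : lmodType R) (f : {linear M -> M'}).

Lemma torsion_map (x : Gamma M) : f (val x) \in @torsion M'.
Proof.
case: x => x /= /asboolP[n xn]; apply/asboolP; exists n => a aI.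
by rewrite -linearZ xn ?linear0.
Qed.

Definition Gamma_map (x : Gamma M) : Gamma M' := Sub (f (val x)) (torsion_map x).

Lemma Gamma_map_linear : linear Gamma_map.
Proof. by move=> a x y; apply: val_inj; rewrite /= linearP. Qed.

HB.instance Definition _ :=
  GRing.isLinear.Build R (Gamma M) (Gamma M') _ Gamma_map Gamma_map_linear.

End GammaMap.
End Torsion.
Arguments Gamma_map {R} I {M M'} f x.

Record complex (R : comNzRingType) := Complex {
  cobj :> nat -> lmodType R;
  cdiff : forall n, {linear cobj n -> cobj n.+1};
  cdiffK : forall n (x : cobj n), cdiff n.+1 (cdiff n x) = 0
}.

Section Cohomology.
Variables (R : comNzRingType) (C : complex R) (n : nat).

Definition cocycle : {pred C n} := fun x => cdiff C n x == 0.

Lemma cocycle_submod_closed : submod_closed cocycle.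
Proof.
split=> [|a x y /eqP x0 /eqP y0]; apply/eqP; first exact: linear0.
by rewrite linearP x0 y0 scaler0 addr0.
Qed.

HB.instance Definition _ :=
  GRing.isSubmodClosed.Build R (C n) cocycle cocycle_submod_closed.

(** The complex vanishes in negative degrees. *)
Definition is_boundary : forall k, C k -> Prop := fun k =>
  match k return C k -> Prop with
  | 0 => fun x => x = 0
  | k'.+1 => fun x => exists y : C k', x = cdiff C k' y
  end.

Lemma is_boundary0 k : is_boundary (0 : C k).
Proof. by case: k => [|k] //=; exists 0; rewrite linear0. Qed.

Lemma is_boundary_linear k a (x y : C k) :
  is_boundary x -> is_boundary y -> is_boundary (a *: x + y).
Proof.
case: k x y => [|k] x y /=; first by move=> -> ->; rewrite scaler0 addr0.
by move=> [x' ->] [y' ->]; exists (a *: x' + y'); rewrite linearP.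
Qed.

Definition boundary : {pred submod cocycle} := fun z => `[< is_boundary (val z) >].

Lemma boundary_submod_closed : submod_closed boundary.
Proof.
split=> [|a x y /asboolP bx /asboolP by_]; apply/asboolP.
  exact: is_boundary0.
exact: is_boundary_linear.
Qed.

HB.instance Definition _ :=
  GRing.isSubmodClosed.Build R (submod cocycle) boundary boundary_submod_closed.

Definition cohomology : lmodType R := {quot boundary}.

End Cohomology.

Section GammaComplex.
Variables (R : comNzRingType) (I : ideal R) (C : complex R).

Lemma Gamma_diffK n (x : Gamma I (C n)) :
  Gamma_map I (cdiff C n.+1) (Gamma_map I (cdiff C n) x) = 0.
Proof. by apply: val_inj; rewrite /= cdiffK. Qed.

Definition Gamma_complex : complex R :=
  @Complex R (fun n => Gamma I (C n)) (fun n => Gamma_map I (cdiff C n))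
    Gamma_diffK.

End GammaComplex.

Definition injective_module (R : comNzRingType) (E : lmodType R) : Prop :=
  forall (A B : lmodType R) (f : {linear A -> B}) (g : {linear A -> E}),
    injective f -> exists h : {linear B -> E}, forall a, h (f a) = g a.

(** [0 -> M -> E 0 -> E 1 -> ...] *)
Record injective_resolution (R : comNzRingType) (M : lmodType R) := InjRes {
  res_complex :> complex R;
  res_aug : {linear M -> res_complex 0%N};
  res_aug_inj : injective res_aug;
  res_exact0 : forall x : res_complex 0%N,
    cdiff res_complex 0 x = 0 <-> exists u, x = res_aug u;
  res_exactS : forall n (x : res_complex n.+1),
    cdiff res_complex n.+1 x = 0 <-> exists y, x = cdiff res_complex n y;
  res_injective : forall n, injective_module (res_complex n)
}.

(** The right derived functors of [Gamma I], computed on an injective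
    resolution [E] of [M]; the module is independent of [E] up to
    isomorphism. *)
Definition local_cohomology (R : comNzRingType) (I : ideal R) (M : lmodType R)
    (E : injective_resolution M) (i : nat) : lmodType R :=
  cohomology (Gamma_complex I E) i.

(* Main.v *)
(** Let [x_1, ..., x_d] generate [m], let [m^[q]] be the ideal of the powers
    [x_j ^ q], and let [G] be a free resolution of [R/I]. Splicing [G] with an
    injective resolution of [R/I] and comparing with Koszul complexes gives
    local duality in the form: an element killing [H^(d-i)_m(R/I)] kills
    [M = Ext^i(R/I, R)], so that [M] is [m]-torsion. The Frobenius of [R] is
    flat, hence [Ext^i(R/I^[q], R)] is the Frobenius pullback [F^e(M)], and the
    submodule of [F^e(M)] killed by [m^[q]] is [F^e] of the socle of [M], a free
    [R/m^[q]]-module. A class of [H^i_I(R)] comes from some [Ext^i(R/I^[q'], R)]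
    and is killed by a fixed [m^[q_0]]; in [F^e(M)] with [q = p^e] large it is
    therefore a multiple of [(x_1 ... x_d)^(q - q_0)], and this monomial lies in
    [y R + m^[q]], for any given [y <> 0], because [R/m^[q]] is self-injective and [(m^[q] : y)] is
    contained in [m^[q_0]]. *)
Require Import Defs.
From HB Require Import structures.
From mathcomp Require Import all_boot all_order all_algebra.
From mathcomp Require Import fingroup perm boolp zify ring.

Set Implicit Arguments.
Unset Strict Implicit.
Unset Printing Implicit Defensive.

Import GRing.Theory.
Local Open Scope ring_scope.
Local Open Scope quotient_scope.

(** * Submodules as predicates, noetherian modules *)

Section Submodules.
Variable R : comNzRingType.
Implicit Types V W : lmodType R.

(** Regularity enters through dimension theory: every subset of the [x_j] generates a prime ideal,
    so they form a regular sequence in any order and colons by monomials can be computed. Duality is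
    needed only for annihilators, so no dual module is formed. The Koszul comparison controls the
    pairing of a cocycle with test rows modulo each [m^[t]], self-injectivity of [R/m^[t]] turns
    this into a congruence modulo [m^[t]], and Krull's intersection theorem removes the error. The
    delicate point is that [q_0] must not grow with [q]. A class [z] lives at some level [n0], and
    there some [x_k ^ N] makes it a boundary. That boundary stays one at every higher level, since
    an element killed by [I^[p^n0]] is killed by [I^[p^e]]. So [N] is fixed first, then [e1] with
    [y] outside [m^[p^e1]], and only then [q]. Ext is handled through relations between cocycles,
    the staircases of a double complex, so neither quotients nor choices of lifts have to be carried
    along. *)

Definition submodule V (P : V -> Prop) : Prop :=
  P 0 /\ forall a x y, P x -> P y -> P (a *: x + y).

Lemma submodule0 V (P : V -> Prop) : submodule P -> P 0.
Proof. by case. Qed.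

Lemma submoduleD V (P : V -> Prop) x y : submodule P -> P x -> P y -> P (x + y).
Proof. by move=> [_ h] px py; rewrite -[x]scale1r; apply: h. Qed.

Lemma submoduleZ V (P : V -> Prop) a x : submodule P -> P x -> P (a *: x).
Proof. by move=> [p0 h] px; rewrite -[_ *: _]addr0; apply: h. Qed.

Lemma submoduleN V (P : V -> Prop) x : submodule P -> P x -> P (- x).
Proof. by move=> h px; rewrite -scaleN1r; apply: submoduleZ. Qed.

Lemma submoduleB V (P : V -> Prop) x y : submodule P -> P x -> P y -> P (x - y).
Proof. by move=> h px py; apply: submoduleD => //; apply: submoduleN. Qed.

Lemma submodule_sum V (P : V -> Prop) (I : Type) (r : seq I) (S : pred I) F :
  submodule P -> (forall i, S i -> P (F i)) -> P (\sum_(i <- r | S i) F i).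
Proof.
move=> hP hF; elim/big_ind: _ => //; first exact: submodule0.
by move=> x y; apply: submoduleD.
Qed.

Definition spanned V n (g : 'I_n -> V) (u : V) : Prop :=
  exists c : 'I_n -> R, u = \sum_i c i *: g i.

Lemma spanned_gen V n (g : 'I_n -> V) i : spanned g (g i).
Proof.
exists (fun j => (j == i)%:R); rewrite (bigD1 i) //= eqxx scale1r big1 ?addr0 //.
by move=> j /negPf ->; rewrite scale0r.
Qed.

Lemma spanned_min V n (g : 'I_n -> V) P u :
  submodule P -> (forall i, P (g i)) -> spanned g u -> P u.
Proof.
move=> hP hg [c ->]; apply: submodule_sum => // i _.
exact: submoduleZ.
Qed.

Definition noetherian_module V : Prop :=
  forall P : V -> Prop, submodule P ->
    exists n (g : 'I_n -> V), P = spanned g.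

(** Otherwise dependent choice yields a strictly increasing sequence in [F]; its union is finitely
    generated, and the generators already lie in one term. Maximal ideals, associated primes and
    noetherian induction all come from here. *)
Lemma noetherian_maximal V (hV : noetherian_module V) (F : (V -> Prop) -> Prop) P0 :
  (forall P, F P -> submodule P) -> F P0 ->
  exists P, [/\ F P, forall x, P0 x -> P x &
    forall P' : V -> Prop, F P' -> (forall x, P x -> P' x) -> P' = P].
Proof.
move=> hF F0; apply: contrapT => hno.
pose good P := F P /\ (forall x, P0 x -> P x).
have step (P : {P | good P}) : exists P' : {P | good P},
    (forall x, sval P x -> sval P' x) /\ exists x, sval P' x /\ ~ sval P x.
  case: P => P [FP leP] /=; apply: contrapT => hn; apply: hno; exists P; split=> //.
  move=> P' FP' le'; apply: funext => x; apply: propext; split=> [px|/le' //].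
  apply: contrapT => npx; apply: hn.
  have gP' : good P' by split=> // y /leP /le'.
  by exists (exist _ P' gP'); split=> //=; exists x.
have [next hnext] := choice step.
pose S n := iter n next (exist good P0 (conj F0 (fun _ h => h))).
have Sle n k x : sval (S n) x -> sval (S (k + n)%N) x.
  by elim: k => //= k IH h; have [h1 _] := hnext (S (k + n)%N); apply/h1/IH.
have Sle' n k x : (n <= k)%N -> sval (S n) x -> sval (S k) x.
  by move=> /subnK <-; apply: Sle.
pose U x := exists n, sval (S n) x.
have Ssub n : submodule (sval (S n)) by apply: hF; case: (S n) => ? [].
have hU : submodule U.
  split=> [|a x y [n hx] [k hy]]; first by exists 0%N; apply: submodule0.
  by exists (maxn n k); apply: (Ssub _).2; [apply: Sle' hx|apply: Sle' hy];
     rewrite ?leq_maxl ?leq_maxr.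
have [n [g eU]] := hV _ hU.
have hg i : exists k, sval (S k) (g i) by rewrite -/(U (g i)) eU; apply: spanned_gen.
have [k hk] := choice hg.
have [_ [x [xS nx]]] := hnext (S (\max_i k i)%N).
apply: nx; have : U x by exists (\max_i k i).+1.
rewrite eU; apply: spanned_min; first exact: Ssub.
by move=> i; apply: Sle' (hk i); apply: leq_bigmax.
Qed.

Lemma noetherian_ind V (hV : noetherian_module V) (T : (V -> Prop) -> Prop) :
  (forall P, submodule P ->
     (forall P' : V -> Prop, submodule P' -> (forall x, P x -> P' x) ->
        (exists x, P' x /\ ~ P x) -> T P') -> T P) ->
  forall P, submodule P -> T P.
Proof.
move=> hT P0 hP0; apply: contrapT => nT.
have [P [[hP nTP] _ hmax]] := noetherian_maximal hV
  (F := fun P => submodule P /\ ~ T P) (P0 := P0) (fun P h => h.1) (conj hP0 nT).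
apply: nTP; apply: hT => // P' hP' le' [x [px npx]]; apply: contrapT => nTP'.
by apply: npx; rewrite -(hmax P').
Qed.

Lemma noetherian_extension V W (K : lmodType R) (f : {linear V -> W}) (g : {linear K -> V}) :
  (forall v, f v = 0 -> exists k, v = g k) -> (forall k, f (g k) = 0) ->
  noetherian_module W -> noetherian_module K -> noetherian_module V.
Proof.
move=> hfg fg0 hW hK P hP.
have hfP : submodule (fun w => exists v, P v /\ w = f v).
  split=> [|a x y [v [pv ->]] [v' [pv' ->]]].
    by exists 0; rewrite linear0; split=> //; apply: submodule0.
  by exists (a *: v + v'); rewrite linearP; split=> //; apply: hP.2.
have hgP : submodule (fun k => P (g k)).
  split=> [|a x y px py]; first by rewrite linear0; apply: submodule0.
  by rewrite linearP; apply: hP.2.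
have [n [w ew]] := hW _ hfP; have [k [t et]] := hK _ hgP.
have hw i : exists v, P v /\ w i = f v.
  by move: (spanned_gen w i); rewrite -ew.
have [v hv] := choice hw.
have ht i : P (g (t i)) by move: (spanned_gen t i); rewrite -et.
exists (n + k)%N, (fun i => match split i with inl i => v i | inr j => g (t j) end).
apply: funext => u; apply: propext; split=> [pu|].
  have : spanned w (f u) by rewrite -ew; exists u.
  move=> [c ec].
  have pd : P (u - \sum_i c i *: v i).
    apply: submoduleB => //; apply: submodule_sum => // i _.
    by apply: submoduleZ => //; case: (hv i).
  have [|z ez] := hfg (u - \sum_i c i *: v i).
    rewrite linearB linear_sum ec -sumrB big1 // => i _.
    by rewrite linearZ /= -(hv i).2 subrr.
  have : spanned t z by rewrite -et -ez.
  move=> [c' ec'].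
  exists (fun i => match split i with inl i => c i | inr j => c' j end).
  rewrite big_split_ord /=.
  under eq_bigr => i _ do rewrite (unsplitK (inl i)).
  under [X in _ + X]eq_bigr => i _ do rewrite (unsplitK (inr i)).
  move: ez; rewrite ec' (linear_sum g) => /eqP.
  rewrite subr_eq addrC => /eqP ->; congr (_ + _).
  by apply: eq_bigr => i _; rewrite linearZ.
apply: spanned_min => // i; case: (split i) => j //.
by case: (hv j).
Qed.

Lemma noetherian_row n : noetherian_module R^o -> noetherian_module 'rV[R]_n.
Proof.
move=> hR; elim: n => [|n IH].
  move=> P hP; exists 0%N, (fun _ => 0); apply: funext => u; apply: propext.
  rewrite (thinmx0 u).
  by split=> _; [exists (fun _ => 0); rewrite big_ord0 | apply: submodule0].
change (noetherian_module 'rV[R]_(1 + n)).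
pose f (u : 'rV[R]_(1 + n)) : R^o := u 0 (lshift n 0).
have lf : linear f by move=> a x y; rewrite /f !mxE.
pose g (u : 'rV[R]_n) : 'rV[R]_(1 + n) := row_mx 0 u.
have lg : linear g.
  by move=> a x y; rewrite /g scale_row_mx scaler0 add_row_mx addr0.
pose fL := GRing.isLinear.Build R _ _ _ f lf.
pose gL := GRing.isLinear.Build R _ _ _ g lg.
pose f' : {linear _ -> _} := HB.pack f fL.
pose g' : {linear _ -> _} := HB.pack g gL.
apply: (@noetherian_extension _ _ _ f' g') => // [v v0|k].
  exists (rsubmx v); rewrite /g' /= /g -[LHS]hsubmxK.
  by congr row_mx; apply/rowP => i; rewrite !mxE (ord1 i) -[RHS]v0.
by rewrite /f' /g' /= /f /g row_mxEl mxE.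
Qed.

End Submodules.

(** * Ideals, primes and the determinant trick *)

Section DeterminantTrick.
Variable R : comNzRingType.

Definition ideal_pred (T : R -> Prop) : Prop := @submodule R R^o T.

Definition prime_pred (T : R -> Prop) : Prop :=
  [/\ ideal_pred T, ~ T 1 & forall a b, T (a * b) -> T a \/ T b].

Lemma idealM (T : R -> Prop) a x : ideal_pred T -> T x -> T (a * x).
Proof. exact: submoduleZ. Qed.

Lemma idealMr (T : R -> Prop) a x : ideal_pred T -> T x -> T (x * a).
Proof. by rewrite mulrC; apply: idealM. Qed.

Lemma ideal0 (T : R -> Prop) : ideal_pred T -> T 0.
Proof. exact: submodule0. Qed.

Lemma idealD (T : R -> Prop) x y : ideal_pred T -> T x -> T y -> T (x + y).
Proof. exact: submoduleD. Qed.

Lemma idealB (T : R -> Prop) x y : ideal_pred T -> T x -> T y -> T (x - y).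
Proof. exact: submoduleB. Qed.

Lemma idealN (T : R -> Prop) x : ideal_pred T -> T x -> T (- x).
Proof. exact: submoduleN. Qed.

Lemma ideal_sum (T : R -> Prop) (I : Type) (r : seq I) (S : pred I) F :
  ideal_pred T -> (forall i, S i -> T (F i)) -> T (\sum_(i <- r | S i) F i).
Proof. exact: (@submodule_sum R R^o). Qed.

Lemma prime_power (T : R -> Prop) x n : prime_pred T -> T (x ^+ n) -> T x.
Proof.
move=> [hT T1 hp]; elim: n => [/T1 //|n IH]; rewrite exprS => /hp[] //.
Qed.

Lemma prime_prod (T : R -> Prop) (I : Type) (r : seq I) (F : I -> R) :
  prime_pred T -> (forall i, ~ T (F i)) -> ~ T (\prod_(i <- r) F i).
Proof.
move=> [hT T1 Tp] hF; elim/big_ind: _ => // x y nx ny /Tp[].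
  exact: nx.
exact: ny.
Qed.

Lemma det_diagonal_mod (T : R -> Prop) n (A : 'M[R]_n) :
  ideal_pred T -> (forall i j, i != j -> T (A i j)) ->
  T (\det A - \prod_i A i i).
Proof.
move=> hT hA; rewrite /determinant (bigD1 (1%g : 'S_n)) //= odd_perm1 expr0 mul1r.
under eq_bigr => i _ do rewrite perm1.
rewrite addrAC subrr add0r; apply: ideal_sum => // s s1.
have [i hi] : exists i, s i != i.
  apply: contrapT => hn; case/negP: s1; apply/eqP/permP => i.
  by rewrite perm1; apply/eqP/negP => h; apply: hn; exists i; apply/negP.
by rewrite (bigD1 i) //= mulrCA mulrC; apply: idealM => //; apply: hA; rewrite eq_sym.
Qed.

(* Multiply by the adjugate; [\det A] is congruent modulo [T] to the product of
   the diagonal entries. *)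
Lemma determinant_trick (T : R -> Prop) (V : lmodType R) (W : V -> Prop)
    n (g : 'I_n -> V) (A : 'M[R]_n) :
  prime_pred T -> submodule W ->
  (forall i j, i != j -> T (A i j)) -> (forall i, ~ T (A i i)) ->
  (forall i, W (\sum_j A i j *: g j)) ->
  exists s, ~ T s /\ forall j, W (s *: g j).
Proof.
move=> Tpr hW hoff hdiag hg; have [hT _ _] := Tpr.
exists (\det A); split.
  move=> hd; apply: (@prime_prod T _ (index_enum 'I_n) (fun i => A i i) Tpr hdiag).
  have := idealB hT hd (det_diagonal_mod hT hoff).
  by rewrite opprB addrC subrK.
move=> j.
have -> : \det A *: g j = \sum_i (\adj A) j i *: \sum_k A i k *: g k.
  under eq_bigr => i _ do rewrite scaler_sumr.
  rewrite exchange_big /= (bigD1 j) //= [X in _ + X]big1 ?addr0 => [|k kj].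
    under eq_bigr => i _ do rewrite scalerA.
    rewrite -scaler_suml; have /matrixP/(_ j j) := mul_adj_mx A.
    by rewrite !mxE eqxx mulr1n => ->.
  under eq_bigr => i _ do rewrite scalerA.
  rewrite -scaler_suml; have /matrixP/(_ j k) := mul_adj_mx A.
  by rewrite !mxE eq_sym (negPf kj) mulr0n => ->; rewrite scale0r.
by apply: submodule_sum => // i _; apply: submoduleZ.
Qed.

End DeterminantTrick.

(** * Krull's principal ideal theorem *)

Section PrincipalIdealTheorem.
Variable R : comNzRingType.
Hypothesis hR : noetherian_module R^o.
Implicit Types P Q M T B : R -> Prop.

Lemma eq_ideal T B : (forall x, T x <-> B x) -> T = B.
Proof. by move=> h; apply: funext => x; apply: propext. Qed.

Definition adjoin B (z : R) : R -> Prop := fun a => exists b r, B b /\ a = b + r * z.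

Lemma adjoin_ideal B z : ideal_pred B -> ideal_pred (adjoin B z).
Proof.
move=> hB; split=> [|a x y [b [r [hb ->]]] [b' [r' [hb' ->]]]].
  by exists 0, 0; rewrite mul0r addr0; split=> //; apply: ideal0.
by exists (a * b + b'), (a * r + r'); split; [exact: hB.2 | rewrite /GRing.scale /=; ring].
Qed.

Lemma adjoin_sub B z x : B x -> adjoin B z x.
Proof. by move=> hx; exists x, 0; rewrite mul0r addr0. Qed.

Lemma adjoin_gen B z : ideal_pred B -> adjoin B z z.
Proof. by move=> hB; exists 0, 1; rewrite mul1r add0r; split=> //; apply: ideal0. Qed.

Lemma adjoin_min B T z x : ideal_pred T -> (forall x, B x -> T x) -> T z ->
  adjoin B z x -> T x.
Proof. by move=> hT hB hz [b [r [/hB hb ->]]]; apply: idealD => //; apply: idealM. Qed.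

Lemma colon_ideal B z : ideal_pred B -> ideal_pred (fun a => B (a * z)).
Proof.
move=> hB; split=> [|a x y hx hy]; first by rewrite mul0r; apply: ideal0.
by rewrite mulrDl /GRing.scale /= -mulrA; apply: hB.2.
Qed.

(** For [M] prime, the saturated ideals are the contractions of the ideals of the localization at
    [M], and stand in for them. *)
Definition saturated M B := forall s a, ~ M s -> B (s * a) -> B a.

Definition saturation M B : R -> Prop := fun a => exists s, ~ M s /\ B (s * a).

Lemma saturation_ideal M B : prime_pred M -> ideal_pred B -> ideal_pred (saturation M B).
Proof.
move=> [hM M1 Mp] hB; split=> [|a x y [s [ns hs]] [t [nt ht]]].
  by exists 1; rewrite mulr0; split=> //; apply: ideal0.
exists (s * t); split=> [/Mp[]//|].
have -> : s * t * (a *: x + y) = (t * a) * (s * x) + s * (t * y).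
  by rewrite /GRing.scale /=; ring.
by apply: idealD => //; apply: idealM.
Qed.

Lemma saturation_saturated M B : prime_pred M -> saturated M (saturation M B).
Proof.
move=> [hM M1 Mp] s a ns [t [nt h]]; exists (t * s); split; first by case/Mp.
by rewrite -mulrA.
Qed.

Lemma saturation_sub M B x : ~ M 1 -> B x -> saturation M B x.
Proof. by move=> M1 h; exists 1; rewrite mul1r. Qed.

Lemma saturation_min M B T x : saturated M T -> (forall x, B x -> T x) ->
  saturation M B x -> T x.
Proof. by move=> hT hB [s [ns /hB h]]; apply: hT h. Qed.

(** A maximal member among the annihilators of nonzero classes of [R/B] is prime. *)
Lemma associated_prime B : ideal_pred B -> ~ B 1 ->
  exists z, ~ B z /\ prime_pred (fun a => B (a * z)).
Proof.
move=> hB B1.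
have [||W [[z [nz ->]] _ hmax]] := @noetherian_maximal R _ hR
   (fun W => exists z, ~ B z /\ W = fun a => B (a * z)) (fun a => B (a * 1)).
- by move=> W [z [_ ->]]; apply: colon_ideal.
- by exists 1.
exists z; split=> //; split; [exact: colon_ideal | by rewrite mul1r |].
move=> a b hab; case: (EM (B (b * z))) => [|nb]; first by right.
left; rewrite -[B _]/((fun c => B (c * z)) a).
rewrite -(hmax (fun a => B (a * (b * z)))); first by rewrite mulrA.
  by exists (b * z).
by move=> c hc /=; rewrite mulrCA; apply: idealM.
Qed.

(** The third hypothesis leaves [M] as the only prime between [A] and [M], so the localization of
    [R/A] at [M] is artinian. Noetherian induction on the lower bound [B]: a class [z] annihilated
    by [M] spans a simple module there, and the chain either contains [z] throughout or omits it
    from some point on. Both cases compare it with a chain above [B + (z)]. *)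
Lemma saturated_dcc M A : prime_pred M -> ideal_pred A ->
  (forall P, prime_pred P -> (forall x, A x -> P x) -> (forall x, P x -> M x) ->
     forall x, M x -> P x) ->
  forall B, ideal_pred B -> (forall x, A x -> B x) -> saturated M B ->
  forall C : nat -> R -> Prop,
    (forall n, ideal_pred (C n)) -> (forall n, saturated M (C n)) ->
    (forall n x, B x -> C n x) -> (forall n x, C n.+1 x -> C n x) ->
    exists N, forall n, (N <= n)%N -> forall x, C n x -> C n.+1 x.
Proof.
move=> Mpr hA hmin B hB; have [hM M1 Mp] := Mpr.
apply: (noetherian_ind hR (T := fun B : R -> Prop => (forall x, A x -> B x) -> saturated M B ->
  forall C : nat -> R -> Prop,
    (forall n, ideal_pred (C n)) -> (forall n, saturated M (C n)) ->
    (forall n x, B x -> C n x) -> (forall n x, C n.+1 x -> C n x) ->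
    exists N, forall n, (N <= n)%N -> forall x, C n x -> C n.+1 x) _ hB) => {B hB}.
move=> B hB IH AB satB C hC satC BC Cdec.
case: (EM (B 1)) => [B1|B1].
  by exists 0%N => n _ x _; apply: BC; rewrite -[x]mulr1; apply: idealM.
have [z [nz zpr]] := associated_prime hB B1.
(* [(B : z)] is prime, contains [A], and lies in [M] because [B] is saturated; so it is all of
   [M]. *)
have Mz x : M x -> B (x * z).
  apply: (hmin (fun a => B (a * z))) => // {}x.
    by move=> /AB Bx; apply: idealMr.
  by move=> Bx; apply: contrapT => nMx; apply: nz; apply: satB Bx.
pose B' := saturation M (adjoin B z).
have hB' : ideal_pred B' by apply/saturation_ideal/adjoin_ideal.
have BB' x : B x -> B' x by move=> h; apply: saturation_sub => //; apply: adjoin_sub.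
have zB' : B' z by apply: saturation_sub => //; apply: adjoin_gen.
have satB' : saturated M B' by apply: saturation_saturated.
have Cle n k x : C (k + n)%N x -> C n x.
  by elim: k x => //= k IHk x /Cdec/IHk.
case: (EM (forall n, C n z)) => [Cz|].
  apply: (IH B') => // [|x Ax|n x]; first by exists z.
    exact/BB'/AB.
  by apply: (@saturation_min M (adjoin B z)) => // y; apply: adjoin_min => //; apply: BC.
move=> /existsNP[N0 nz0].
pose C' n := saturation M (adjoin (C n) z).
have [|||||N1 hN1] := IH B' hB' BB' (ex_intro _ z (conj zB' nz)) _ satB' C'.
- by move=> x /AB/BB'.
- by move=> n; apply/saturation_ideal/adjoin_ideal.
- by move=> n; apply: saturation_saturated.
- move=> n x [s [ns [b [r [/(BC n) hb e]]]]]; exists s; split=> //; by exists b, r.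
- move=> n x [s [ns [b [r [/(Cdec n) hb e]]]]]; exists s; split=> //; by exists b, r.
exists (maxn N0 N1) => n; rewrite geq_max => /andP[n0 n1] x hx.
have [s [ns [c [r [hc e]]]]] : C' n.+1 x.
  by apply: hN1 => //; apply: saturation_sub => //; apply: adjoin_sub.
apply: (satC n.+1 s) => //; rewrite e; apply: idealD => //.
have hrz : C n (r * z).
  have -> : r * z = s * x - c by rewrite e addrC addKr.
  by apply: idealB => //; [apply: idealM | apply: Cdec].
(* If [r] were outside [M], saturation would put [z] in [C n], hence in [C N0]. So [r] is in [M] and
   [r * z] in [B]. *)
apply: BC; apply: Mz; apply: contrapT => nr; apply: nz0.
by move: n0 => /subnK e0; apply: (Cle _ (n - N0)%N); rewrite e0; apply: satC hrz.
Qed.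

Definition ideal_product P A : R -> Prop := fun x =>
  forall S : R -> Prop, ideal_pred S -> (forall p a, P p -> A a -> S (p * a)) -> S x.

Lemma ideal_product_ideal P A : ideal_pred (ideal_product P A).
Proof.
split=> [S hS _|a x y hx hy S hS h]; first exact: ideal0.
by apply: hS.2; [apply: hx | apply: hy].
Qed.

Fixpoint ideal_power Q n : R -> Prop :=
  if n is n'.+1 then ideal_product Q (ideal_power Q n') else fun=> True.

Lemma ideal_power_ideal Q n : ideal_pred (ideal_power Q n).
Proof. by case: n => [|n] //=; apply: ideal_product_ideal. Qed.

Lemma ideal_power_dec Q n x : ideal_power Q n.+1 x -> ideal_power Q n x.
Proof.
move=> h; apply: h => [|p a _]; first exact: ideal_power_ideal.
by apply: idealM; apply: ideal_power_ideal.
Qed.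

Lemma ideal_power_exp Q n x : Q x -> ideal_power Q n (x ^+ n).
Proof. by move=> qx; elim: n => //= n IH S hS h; rewrite exprS; apply: h. Qed.

Definition sum_pred P A : R -> Prop := fun x => exists p a, [/\ P p, A a & x = p + a].

Lemma sum_pred_ideal P A : ideal_pred P -> ideal_pred A -> ideal_pred (sum_pred P A).
Proof.
move=> hP hA; split=> [|a x y [p [q [hp hq ->]]] [p' [q' [hp' hq' ->]]]].
  by exists 0, 0; rewrite addr0; split=> //; apply: ideal0.
exists (a * p + p'), (a * q + q'); split; [exact: hP.2 | exact: hA.2 |].
by rewrite /GRing.scale /=; ring.
Qed.

(* Krull's symbolic-power argument, with the localization at [M] replaced by
   saturation of ideals. *)
Lemma principal_ideal_theorem P Q M y : prime_pred P -> prime_pred Q -> prime_pred M ->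
  (forall x, P x -> Q x) -> (exists q, Q q /\ ~ P q) -> (forall x, Q x -> M x) ->
  M y -> ~ Q y ->
  exists Q', [/\ prime_pred Q', forall x, P x -> Q' x, Q' y, forall x, Q' x -> M x
    & exists x, M x /\ ~ Q' x].
Proof.
move=> Ppr Qpr Mpr PQ [q [Qq nPq]] QM My nQy; apply: contrapT => hno.
have [hP P1 Pp] := Ppr; have [hQ Q1 Qp] := Qpr; have [hM M1 Mp] := Mpr.
pose A := adjoin P y.
have hA : ideal_pred A by apply: adjoin_ideal.
have hmin T : prime_pred T -> (forall x, A x -> T x) -> (forall x, T x -> M x) ->
    forall x, M x -> T x.
  move=> Tpr AT TM x Mx; apply: contrapT => nTx; apply: hno; exists T; split=> //.
  - by move=> z Pz; apply/AT/adjoin_sub.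
  - exact/AT/adjoin_gen.
  - by exists x.
(* The preimage of the [n]-th symbolic power of [Q/P]. *)
pose S n := saturation Q (sum_pred P (ideal_power Q n)).
have hS n : ideal_pred (S n).
  by apply/saturation_ideal=> //; apply/sum_pred_ideal => //; apply: ideal_power_ideal.
have Sdec n x : S n.+1 x -> S n x.
  move=> [s [ns [p [a [hp ha e]]]]]; exists s; split=> //.
  by exists p, a; split=> //; apply: ideal_power_dec.
have Ssat n : saturated Q (S n) by apply: saturation_saturated.
have PS n x : P x -> S n x.
  move=> Px; apply: saturation_sub => //; exists x, 0; rewrite addr0; split=> //.
  by apply: ideal0; apply: ideal_power_ideal.
pose C n := saturation M (adjoin (S n) y).
have [] := @saturated_dcc M A Mpr hA hmin (saturation M A) _ _ _ C.
- exact: saturation_ideal.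
- by move=> x Ax; apply: saturation_sub.
- exact: saturation_saturated.
- by move=> n; apply/saturation_ideal/adjoin_ideal.
- by move=> n; apply: saturation_saturated.
- move=> n x [s [ns [b [r [/(PS n) hb e]]]]]; exists s; split=> //; by exists b, r.
- move=> n x [s [ns [b [r [/Sdec hb e]]]]]; exists s; split=> //; by exists b, r.
move=> n /(_ n (leqnn n)) hn.
have nMQ s : ~ M s -> ~ Q s by move=> nM /QM.
(* The chain [C] has stabilized, and [y r] in [S n] forces [r] in [S n] because [y] is outside [Q].
   Localized at [M] this reads [S n = S n.+1 + y (S n)], and the determinant trick at [M] plays the
   part of Nakayama's lemma. *)
have Seq x : S n x -> S n.+1 x.
  have [k [g eg]] := hR (hS n).
  have Sg i : S n (g i) by rewrite eg; apply: spanned_gen.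
  have hi i : exists sr : R * ('I_k -> R), ~ M sr.1 /\
      S n.+1 (sr.1 * g i - y * \sum_j sr.2 j * g j).
    have [s [ns [b [r [hb e]]]]] : C n.+1 (g i).
      by apply: hn; apply: saturation_sub => //; apply: adjoin_sub.
    have : S n r.
      apply: (Ssat n y) => //; have -> : y * r = s * g i - b.
        by rewrite e addrC addKr mulrC.
      by apply: idealB => //; [apply: idealM | apply: Sdec].
    rewrite eg => -[c ec]; exists (s, c); split=> //=.
    by move: ec; rewrite /GRing.scale /= => <-; rewrite e mulrC addrK.
  have [sr hsr] := choice hi.
  have [|||s [ns hs]] := @determinant_trick R M R^o (S n.+1) k g
     (\matrix_(i, j) ((i == j)%:R * (sr i).1 - y * (sr i).2 j)) Mpr (hS _).
  - move=> i j /negPf ij; rewrite !mxE ij mul0r sub0r; apply: idealN => //.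
    exact: idealMr.
  - move=> i; rewrite !mxE eqxx mul1r => h; case: (hsr i) => nM _; apply: nM.
    rewrite -[X in M X](subrK (y * (sr i).2 i)); apply: idealD => //; exact: idealMr.
  - move=> i; have [_] := hsr i; congr (S n.+1 _).
    under [RHS]eq_bigr => j _ do rewrite mxE scalerBl.
    rewrite sumrB; congr (_ - _); last first.
      by rewrite mulr_sumr; apply: eq_bigr => j _; rewrite mulrA.
    rewrite (bigD1 i) //= eqxx mul1r big1 ?addr0 // => j ji.
    by rewrite eq_sym (negPf ji) mul0r scale0r.
  rewrite eg; apply: spanned_min => [|i]; first exact: hS.
  by apply: (Ssat _ s); [exact: nMQ | exact: hs].
(* Localized at [Q], the power [Q^n] now lies in [P + Q Q^n]. The determinant trick at [Q] gives [s]
   outside [Q] with [s Q^n] inside [P], which [q ^+ n] contradicts. *)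
have [k [g eg]] := hR (ideal_power_ideal Q n).
have Qg i : ideal_power Q n (g i) by rewrite eg; apply: spanned_gen.
have hi i : exists sr : R * ('I_k -> R), [/\ ~ Q sr.1, forall j, Q (sr.2 j) &
      P (sr.1 * g i - \sum_j sr.2 j * g j)].
  have [|s [ns [p [a [hp ha e]]]]] := Seq (g i).
    apply: saturation_sub => //; exists 0, (g i); rewrite add0r; split=> //.
    exact: ideal0.
  have [c [hc ec]] : exists c : 'I_k -> R, (forall j, Q (c j)) /\ a = \sum_j c j * g j.
    apply: (ha (fun a => exists c : 'I_k -> R, (forall j, Q (c j)) /\ a = \sum_j c j * g j)).
      split=> [|b u v [c [hc ->]] [c' [hc' ->]]].
        exists (fun _ => 0); split=> [_|]; first exact: ideal0.
        by rewrite big1 // => j _; rewrite mul0r.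
      exists (fun j => b * c j + c' j); split=> [j|]; first exact: hQ.2.
      rewrite /GRing.scale /= mulr_sumr -big_split /=; apply: eq_bigr => j _.
      by rewrite mulrDl mulrA.
    move=> u v Qu hv; have : ideal_power Q n v by [].
    rewrite eg => -[c ->]; exists (fun j => u * c j).
    split=> [j|]; first exact: idealMr.
    by rewrite mulr_sumr; apply: eq_bigr => j _; rewrite mulrA.
  by exists (s, c); split=> //=; rewrite e -ec addrK.
have [sr hsr] := choice hi.
have [|||s [ns hs]] := @determinant_trick R Q R^o P k g
   (\matrix_(i, j) ((i == j)%:R * (sr i).1 - (sr i).2 j)) Qpr hP.
- move=> i j /negPf ij; rewrite !mxE ij mul0r sub0r; apply: idealN => //.
  by case: (hsr i).
- move=> i; rewrite !mxE eqxx mul1r => h; case: (hsr i) => nM hc _; apply: nM.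
  by rewrite -[X in Q X](subrK ((sr i).2 i)); apply: idealD.
- move=> i; have [_ _] := hsr i; congr (P _).
  under [RHS]eq_bigr => j _ do rewrite mxE scalerBl.
  rewrite sumrB; congr (_ - _).
  rewrite (bigD1 i) //= eqxx mul1r big1 ?addr0 // => j ji.
  by rewrite eq_sym (negPf ji) mul0r scale0r.
apply: nPq; apply: (@prime_power _ P q n) => //.
have : ideal_power Q n (q ^+ n) by apply: ideal_power_exp.
rewrite eg; apply: spanned_min => [|i]; first exact: hP.
by have /Pp[/PQ//|//] := hs i.
Qed.

End PrincipalIdealTheorem.

(** * Height theorem and systems of parameters *)

Section Dimension.
Variable R : comNzRingType.
Hypothesis hR : noetherian_module R^o.
Implicit Types (P Q M J : R -> Prop) (s : seq R).

Fixpoint chain_to M n P : Prop :=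
  if n is n'.+1 then
    prime_pred P /\ exists Q, [/\ forall x, P x -> Q x, exists x, Q x /\ ~ P x & chain_to M n' Q]
  else P = M.

Lemma chain_to_sub M n P x : chain_to M n P -> P x -> M x.
Proof.
elim: n P x => [P x -> //|n IH] P x [_ [Q [PQ _ hQ]]] /PQ; exact: IH.
Qed.

Lemma chain_to_prime M n P : prime_pred M -> chain_to M n P -> prime_pred P.
Proof. by case: n => [|n] hM; [move=> -> | case]. Qed.

(** Working from the top, the principal ideal theorem exchanges each member of the chain that omits
    [y] for a prime containing it; only one step is lost. *)
Lemma chain_to_adjoin M n P y : prime_pred M -> M y -> chain_to M n.+1 P ->
  exists P', [/\ forall x, P x -> P' x, P' y & chain_to M n P'].
Proof.
move=> hM My; elim: n P => [|n IH] P [hP [Q [PQ sPQ hQ]]].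
  by exists Q; split=> //; rewrite hQ.
case: (EM (Q y)) => [Qy|nQy]; first by exists Q.
have [Q2 [QQ2 Q2y hQ2]] := IH Q hQ.
have Qpr : prime_pred Q by case: hQ.
have [Q' [h1 h2 h3 h4 h5]] := principal_ideal_theorem hR hP Qpr
  (chain_to_prime hM hQ2) PQ sPQ QQ2 Q2y nQy.
by exists Q'; split=> //; split=> //; exists Q2.
Qed.

(** Krull's height theorem: each generator costs one step by [chain_to_adjoin], and when none is
    left a prime of the chain over [J] contains [M]. [J] is a mere set, so that generators can be
    moved into it one at a time. *)
Lemma chain_to_bound M J s n P : prime_pred M ->
  (forall y, y \in s -> M y) ->
  (forall T, prime_pred T -> (forall x, J x -> T x) -> (forall y, y \in s -> T y) ->
     forall x, M x -> T x) ->
  (forall x, J x -> P x) -> chain_to M n P -> (n <= size s)%N.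
Proof.
move=> hM; elim: s J n P => [|y s IH] J [|n] P sM hJ JP hP //.
  case: hP => hP [Q [_ [x [Qx nPx]] hQ]]; case: nPx; apply: hJ => //.
  exact: chain_to_sub hQ Qx.
have [|P' [PP' P'y hP']] := chain_to_adjoin hM (y := y) _ hP.
  by apply: sM; rewrite mem_head.
apply: (IH (fun x => J x \/ x = y) n P') => //.
- by move=> z zs; apply: sM; rewrite inE zs orbT.
- move=> T hT JT sT; apply: hJ => // [x Jx|z]; first by apply: JT; left.
  by rewrite inE => /orP[/eqP ->|/sT //]; apply: JT; right.
by move=> x [/JP/PP' | ->].
Qed.

Lemma chain_to_seq M s n P : prime_pred M -> (forall y, y \in s -> M y) ->
  chain_to M (size s + n) P ->
  exists P', [/\ forall x, P x -> P' x, forall y, y \in s -> P' y & chain_to M n P'].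
Proof.
move=> hM; elim: s P => [|y s IH] P sM hP; first by exists P.
have [|P1 [PP1 P1y hP1]] := chain_to_adjoin hM (y := y) _ hP.
  by apply: sM; rewrite mem_head.
have [|P2 [P12 P2s hP2]] := IH P1 _ hP1.
  by move=> z zs; apply: sM; rewrite inE zs orbT.
exists P2; split=> [x /PP1/P12 //|z|//].
by rewrite inE => /orP[/eqP ->|/P2s //]; apply: P12.
Qed.

Definition seq_ideal s : R -> Prop := foldr (fun y B => adjoin B y) (fun x => x = 0) s.

Lemma seq_ideal_ideal s : ideal_pred (seq_ideal s).
Proof.
elim: s => [|y s IH] /=; last exact: adjoin_ideal.
by split=> // a x y -> ->; rewrite scaler0 addr0.
Qed.

Lemma seq_ideal_gen s y : y \in s -> seq_ideal s y.
Proof.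
elim: s => //= z s IH; rewrite inE => /orP[/eqP ->|/IH]; last exact: adjoin_sub.
by apply: adjoin_gen; apply: seq_ideal_ideal.
Qed.

Lemma seq_ideal_min T s x : ideal_pred T -> (forall y, y \in s -> T y) ->
  seq_ideal s x -> T x.
Proof.
move=> hT; elim: s x => [|y s IH] x hs /=; first by move=> ->; apply: ideal0.
apply: adjoin_min => //; last by apply: hs; rewrite mem_head.
by move=> z; apply: IH => t ts; apply: hs; rewrite inE ts orbT.
Qed.

Lemma seq_ideal_sub s1 s2 x : {subset s1 <= s2} -> seq_ideal s1 x -> seq_ideal s2 x.
Proof.
move=> h; apply: seq_ideal_min => [|y /h]; [exact: seq_ideal_ideal | exact: seq_ideal_gen].
Qed.

(** The element [y] ranges over [M P], described as the least submodule containing the products. The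
    determinant trick gives a scalar outside [M], which the second hypothesis makes a unit. *)
Lemma nakayama M (V : lmodType R) (W P : V -> Prop) : prime_pred M ->
  (forall a, ~ M a -> exists b, a * b = 1) ->
  submodule W -> (exists n (g : 'I_n -> V), P = spanned g) ->
  (forall u, P u -> exists w y, [/\ W w, u = w + y &
     forall S : V -> Prop, submodule S -> (forall a v, M a -> P v -> S (a *: v)) -> S y]) ->
  forall u, P u -> W u.
Proof.
move=> hM hloc hW [n [g eP]] hP u; have [iM M1 Mp] := hM.
have hi i : exists c : 'I_n -> R, (forall j, M (c j)) /\ W (g i - \sum_j c j *: g j).
  have [|w [y [hw e hy]]] := hP (g i); first by rewrite eP; apply: spanned_gen.
  have [] := hy (fun y => exists c : 'I_n -> R, (forall j, M (c j)) /\ y = \sum_j c j *: g j).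
  - split=> [|a x z [c [hc ->]] [c' [hc' ->]]].
      exists (fun _ => 0); split=> [_|]; first exact: ideal0.
      by rewrite big1 // => j _; rewrite scale0r.
    exists (fun j => a * c j + c' j); split=> [j|]; first exact: iM.2.
    rewrite scaler_sumr -big_split /=; apply: eq_bigr => j _.
    by rewrite scalerDl scalerA.
  - move=> a v Ma; rewrite eP => -[c ->]; exists (fun j => a * c j).
    split=> [j|]; first exact: idealMr.
    by rewrite scaler_sumr; apply: eq_bigr => j _; rewrite scalerA.
  by move=> c [hc ec]; exists c; split=> //; rewrite e -ec addrK.
have [c hc] := choice hi.
have [|||s [ns hs]] := @determinant_trick R M V W n g
   (\matrix_(i, j) ((i == j)%:R - c i j)) hM hW.
- move=> i j /negPf ij; rewrite !mxE ij sub0r; apply: idealN => //.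
  by case: (hc i).
- move=> i; rewrite !mxE eqxx => h; case: (hc i) => Mc _; apply: M1.
  by rewrite -(subrK (c i i) 1); apply: idealD.
- move=> i; have [_] := hc i; congr (W _).
  under [RHS]eq_bigr => j _ do rewrite mxE scalerBl.
  rewrite sumrB; congr (_ - _).
  rewrite (bigD1 i) //= eqxx scale1r big1 ?addr0 // => j ji.
  by rewrite eq_sym (negPf ji) scale0r.
rewrite eP; apply: spanned_min => // i.
have [b eb] := hloc s ns.
by rewrite -[g i]scale1r -eb mulrC -scalerA; apply: submoduleZ.
Qed.

(** Induction on the elements left out of the prefix, with [x] the next one and [(s1, x)] already
    prime. Some prime [P0] over [s1] starts a chain too long for [P0] to contain [x], and a length
    count puts [P0] inside [(s1, x)]. Hence [P0 = (s1) + x P0], and Nakayama's lemma gives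
    [P0 = (s1)]. *)
Lemma regular_prefix_prime M s1 s2 P :
  prime_pred M -> (forall a, ~ M a -> exists b, a * b = 1) ->
  seq_ideal (s1 ++ s2) = M -> chain_to M (size s1 + size s2) P ->
  prime_pred (seq_ideal s1).
Proof.
move=> hM hloc; elim: s2 s1 => [|x s2 IH] s1 eM hP; first by rewrite cats0 in eM; rewrite eM.
have sM y : y \in s1 ++ x :: s2 -> M y by move=> h; rewrite -eM; apply: seq_ideal_gen.
have hM' T : prime_pred T -> (forall y, y \in s1 ++ x :: s2 -> T y) -> forall y, M y -> T y.
  by move=> [hT _ _] h y; rewrite -eM; apply: seq_ideal_min.
have Jpr : prime_pred (seq_ideal (rcons s1 x)).
  by apply: IH; rewrite ?cat_rcons // size_rcons addSnnS.
have [|P0 [_ P0s hP0]] := chain_to_seq hM _ hP.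
  by move=> y ys; apply: sM; rewrite mem_cat ys.
have bound n T : (forall y, y \in rcons s1 x -> T y) -> chain_to M n T -> (n <= size s2)%N.
  move=> Ts hT; apply: (chain_to_bound (J := fun y => y \in rcons s1 x) hM _ _ Ts hT).
    by move=> y ys; apply: sM; rewrite mem_cat inE ys !orbT.
  move=> T' hT' h1 h2 y; apply: hM' => // z; rewrite -cat_rcons mem_cat => /orP[/h1|/h2] //.
have nP0x : ~ P0 x.
  move=> hx; have := bound _ P0 _ hP0; rewrite ltnn => h.
  by suff /h : forall y, y \in rcons s1 x -> P0 y by []; move=> y; rewrite mem_rcons inE => /orP[/eqP ->|/P0s].
have [|P' [P0P' P'x hP']] := chain_to_adjoin hM (y := x) _ hP0.
  by apply: sM; rewrite mem_cat mem_head orbT.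
have P's y : y \in rcons s1 x -> P' y.
  by rewrite mem_rcons inE => /orP[/eqP ->|/P0s/P0P'].
(* [P'] contains the prime [(s1, x)]; were it larger, putting that prime below the chain from [P']
   would exceed [bound]. *)
have P'J y : P' y -> seq_ideal (rcons s1 x) y.
  move=> P'y; apply: contrapT => nJy.
  suff : ((size s2).+1 <= size s2)%N by rewrite ltnn.
  apply: (bound _ (seq_ideal (rcons s1 x))); first exact: seq_ideal_gen.
  split=> //; exists P'; split=> //; last by exists y.
  by move=> z; apply: seq_ideal_min => //; case: (chain_to_prime hM hP').
have P0pr : prime_pred P0 by case: hP0.
have [iP0 _ P0p] := P0pr.
suff -> : seq_ideal s1 = P0 by [].
apply: eq_ideal => y; split; first exact: seq_ideal_min.
apply: (@nakayama M R^o (seq_ideal s1) P0 hM hloc); first exact: seq_ideal_ideal.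
  exact: hR.
move=> u Pu; have [b [r [hb e]]] : adjoin (seq_ideal s1) x u.
  have := P'J u (P0P' u Pu); apply: seq_ideal_min; first exact/adjoin_ideal/seq_ideal_ideal.
  move=> z; rewrite mem_rcons inE => /orP[/eqP ->|zs].
    exact/adjoin_gen/seq_ideal_ideal.
  by apply/adjoin_sub/seq_ideal_gen.
exists b, (x * r); split=> //; first by rewrite mulrC.
move=> S _ hS; apply: hS; first by apply: sM; rewrite mem_cat mem_head orbT.
have : P0 (r * x).
  have -> : r * x = u - b by rewrite e addrC addKr.
  by apply: idealB => //; apply: seq_ideal_min hb.
by case/P0p.
Qed.

(** Otherwise the other generators, one fewer than the length of the chain, would still generate
    [M], against the height theorem. *)
Lemma regular_prefix_notin M s1 x s2 P : prime_pred M ->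
  seq_ideal (s1 ++ x :: s2) = M -> chain_to M (size s1 + (size s2).+1) P ->
  ~ seq_ideal s1 x.
Proof.
move=> hM eM hP hx.
have sM y : y \in s1 ++ x :: s2 -> M y by move=> h; rewrite -eM; apply: seq_ideal_gen.
have iP : ideal_pred P by case: (chain_to_prime hM hP).
suff : (size s1 + (size s2).+1 <= size (s1 ++ s2))%N by rewrite size_cat addnS ltnn.
apply: (chain_to_bound (J := fun x => x = 0) hM _ _ _ hP).
- by move=> y; rewrite mem_cat => h; apply: sM; rewrite mem_cat inE orbCA h orbT.
- move=> T [hT _ _] _ Ts y; rewrite -eM; apply: seq_ideal_min => // z.
  rewrite mem_cat inE => /or3P[zs|/eqP ->|zs]; try by apply: Ts; rewrite mem_cat zs ?orbT.
  by apply: (seq_ideal_min hT _ hx) => t ts; apply: Ts; rewrite mem_cat ts.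
by move=> _ ->; apply: ideal0.
Qed.

End Dimension.

(** * Regular local rings in terms of predicates *)

Section FromDefs.
Variable R : comNzRingType.

Definition mk_sub_pred (V : lmodType R) (P : V -> Prop) : {pred V} := fun x => `[< P x >].

Lemma mk_sub_closed (V : lmodType R) (P : V -> Prop) : submodule P -> submod_closed (mk_sub_pred P).
Proof.
move=> hP; split=> [|a x y /asboolP px /asboolP py]; apply/asboolP; first exact: submodule0.
exact: hP.2.
Qed.

Definition mk_sub (V : lmodType R) (P : V -> Prop) (hP : submodule P) : submodClosed V :=
  HB.pack (mk_sub_pred P) (GRing.isSubmodClosed.Build R V (mk_sub_pred P) (mk_sub_closed hP)).

Lemma mk_subE (V : lmodType R) (P : V -> Prop) (hP : submodule P) x : (x \in mk_sub hP) <-> P x.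
Proof. by split=> [/asboolP|h] //; apply/asboolP. Qed.

Lemma submodClosed_submodule (V : lmodType R) (N : submodClosed V) :
  submodule (fun x => x \in N).
Proof.
by split=> [|a x y hx hy]; [apply: rpred0 | apply: rpredD => //; apply: rpredZ].
Qed.

Lemma noetherian_noetherian_module : @noetherian R -> noetherian_module R^o.
Proof.
move=> hR P hP; have [s hs] := hR (mk_sub hP).
exists (size s), (fun i => s`_i); apply: funext => x; apply: propext.
rewrite -(mk_subE hP) (hs x); split=> [[c ->]|[c ->]]; first by exists (fun i => c i).
exists (fun k => if insub k is Some i then c i else 0).
by apply: eq_bigr => i _; rewrite valK.
Qed.

Lemma generates_seq_ideal (s : seq R) (I : ideal R) :
  generates s I -> seq_ideal s = (fun x => x \in I).
Proof.
move=> hs; apply: eq_ideal => x; split.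
  apply: (@seq_ideal_min _ (fun x => x \in I)) => [|y ys].
    exact: submodClosed_submodule.
  apply/hs; exists (fun i => (i == index y s)%:R).
  have hi : (index y s < size s)%N by rewrite index_mem.
  rewrite (bigD1 (Ordinal hi)) //= eqxx mul1r nth_index // big1 ?addr0 //.
  by move=> j; rewrite -val_eqE /= => /negPf ->; rewrite mul0r.
move=> /hs[c ->]; apply: ideal_sum => [|i _]; first exact: seq_ideal_ideal.
by apply: idealM; [apply: seq_ideal_ideal | apply: seq_ideal_gen; apply: mem_nth].
Qed.

Section Local.
Variables (m : ideal R) (d : nat).
Hypothesis hreg : regular_local_ring m d.

Let mm : R -> Prop := fun x => x \in m.

Lemma regular_noetherian : noetherian_module R^o.
Proof. by case: hreg => h _ _ _ _; apply: noetherian_noetherian_module. Qed.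

(** Noetherianity replaces Zorn's lemma in producing a maximal ideal over [J], which must be [m]. *)
Lemma maximal_contains (J : R -> Prop) : ideal_pred J -> ~ J 1 -> forall x, J x -> mm x.
Proof.
move=> hJ J1; have [_ [_ hloc] _ _ _] := hreg.
have [P [[hP P1] JP hmax]] := noetherian_maximal regular_noetherian
  (F := fun P => ideal_pred P /\ ~ P 1) (P0 := J) (fun P h => h.1) (conj hJ J1).
move=> x /JP; rewrite -(mk_subE hP) (hloc (mk_sub hP)) //.
split; first by apply/negP => /(mk_subE hP).
move=> K K1 PK y yK; apply/(mk_subE hP).
have <- // := hmax (fun x => x \in K).
  by split; [apply: submodClosed_submodule | apply/negP].
by move=> z /(mk_subE hP)/PK.
Qed.

Lemma regular_unit a : ~ mm a -> exists b, a * b = 1.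
Proof.
move=> na; apply: contrapT => hn; apply: na.
apply: (@maximal_contains (fun x => exists b, x = a * b)); last by exists 1; rewrite mulr1.
  split=> [|c x y [b ->] [b' ->]]; first by exists 0; rewrite mulr0.
  by exists (c * b + b'); rewrite /GRing.scale /=; ring.
by move=> [b e]; apply: hn; exists b.
Qed.

Lemma maximal_prime : prime_pred mm.
Proof.
have [_ [[m1 _] _] _ _ _] := hreg.
have hm : ideal_pred mm by apply: submodClosed_submodule.
split=> //; first by apply/negP.
move=> a b hab; apply: contrapT => /not_orP[/regular_unit[a' ea] /regular_unit[b' eb]].
move/negP: m1; apply; rewrite -/(mm 1).
have -> : 1 = (a' * b') * (a * b) :> R.
  by rewrite mulrACA (mulrC a') (mulrC b') ea eb mulr1.
exact: idealM.
Qed.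

Lemma prime_chain_to n (Q : nat -> ideal R) : prime_chain n Q -> Q n =i m ->
  chain_to mm n (fun x => x \in Q 0%N).
Proof.
elim: n Q => [|n IH] Q [hQ sQ] hn /=.
  by apply: eq_ideal => x; rewrite hn.
split.
  have [Q1 Qp] := hQ 0%N isT; split=> [|| a b]; [exact: submodClosed_submodule | exact/negP |].
  by move=> /Qp/orP.
exists (fun x => x \in Q 1%N); have [sub [x x1 x0]] := sQ 0%N isT; split=> //.
  by exists x; split=> //; apply/negP.
by apply: (IH (fun k => Q k.+1)) => //; split=> k hk; [apply: hQ | apply: sQ].
Qed.

Lemma regular_chain : exists P, chain_to mm d P.
Proof.
have [_ [[m1 _] _] [[Q [hQ sQ]] hdim] _ _] := hreg.
exists (fun x => x \in Q 0%N); apply: prime_chain_to => // x.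
have Qm : {subset Q d <= m}.
  move=> z; apply: (@maximal_contains (fun z => z \in Q d)).
    exact: submodClosed_submodule.
  by have [/negP] := hQ d (leqnn d).
apply/idP/idP => [/Qm //|xm]; apply: contrapT => /negP nx.
suff : (d.+1 <= d)%N by rewrite ltnn.
(* A chain of length [d] that stopped short of [m] could be prolonged by [m]. *)
apply: (hdim _ (fun k => if (k <= d)%N then Q k else m)); split=> k hk.
  case: leqP => [/hQ //|_]; split=> // a b.
  by have [_ _ Mp] := maximal_prime => /Mp/orP.
have kd : (k <= d)%N by rewrite -ltnS.
rewrite kd; case: ltnP => [kd'|dk]; first exact: sQ.
have -> : k = d by apply/eqP; rewrite eqn_leq kd.
by split=> //; exists x.
Qed.

End Local.
End FromDefs.

(** * Ideals of powers of the parameters and their colons *)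

Section Monomials.
Variables (R : comNzRingType) (d : nat) (x : 'I_d -> R).
Implicit Types (S : {set 'I_d}) (a n : 'I_d -> nat).

Definition power_ideal S a : R -> Prop := fun y =>
  exists c : 'I_d -> R, y = \sum_(i in S) c i * x i ^+ a i.

Lemma power_ideal_ideal S a : ideal_pred (power_ideal S a).
Proof.
split=> [|b y z [c ->] [c' ->]].
  by exists (fun _ => 0); rewrite big1 // => i _; rewrite mul0r.
exists (fun i => b * c i + c' i); rewrite /GRing.scale /= mulr_sumr -big_split /=.
by apply: eq_bigr => i _; rewrite mulrDl mulrA.
Qed.

Lemma power_ideal_gen S a i : i \in S -> power_ideal S a (x i ^+ a i).
Proof.
move=> iS; exists (fun j => (j == i)%:R).
rewrite (bigD1 i) //= eqxx mul1r big1 ?addr0 // => j /andP[_ /negPf ->].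
by rewrite mul0r.
Qed.

Lemma power_ideal_min S a (T : R -> Prop) y : ideal_pred T ->
  (forall i, i \in S -> T (x i ^+ a i)) -> power_ideal S a y -> T y.
Proof.
move=> hT h [c ->]; apply: ideal_sum => // i iS; apply: idealM => //; exact: h.
Qed.

Lemma power_ideal_le S a b y : (forall i, i \in S -> b i <= a i)%N ->
  power_ideal S a y -> power_ideal S b y.
Proof.
move=> h; apply: power_ideal_min => [|i iS]; first exact: power_ideal_ideal.
rewrite -(subnK (h i iS)) exprD; apply: idealM; first exact: power_ideal_ideal.
exact: power_ideal_gen.
Qed.

Lemma power_idealD1 S a j y : j \in S ->
  power_ideal S a y <-> exists c, power_ideal (S :\ j) a (y - c * x j ^+ a j).
Proof.
move=> jS; split=> [[c ->]|[b [c e]]].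
  exists (c j), c; rewrite (bigD1 j) //= addrAC subrr add0r.
  by apply: eq_bigl => i; rewrite !inE andbC.
exists (fun i => if i == j then b else c i).
rewrite (bigD1 j) //= eqxx; move/eqP: e; rewrite subr_eq addrC => /eqP ->.
congr (_ + _); apply: eq_big => i; first by rewrite !inE andbC.
by rewrite !inE => /andP[/negPf ->].
Qed.

Lemma eq_power_ideal S a b y : (forall i, i \in S -> a i = b i) ->
  power_ideal S a y -> power_ideal S b y.
Proof. by move=> h; apply: power_ideal_le => i /h ->. Qed.

Definition upd a j k : 'I_d -> nat := fun i => if i == j then k else a i.

Hypothesis x_prime : forall S, prime_pred (power_ideal S (fun=> 1%N)).
Hypothesis x_notin : forall S j, j \notin S -> ~ power_ideal S (fun=> 1%N) (x j).

(** Induction on the total exponent; with all exponents 1 it is primality. If [a i >= 2], lowering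
    the exponent at [i] gives [y = y' x_i^(a i - 1)] modulo the other powers. That power of [x_i]
    can be cancelled by induction, which puts [x_j y'] in the ideal with exponent 1 at [i], and
    induction applies to [y']. *)
Lemma power_ideal_regular S a j y : j \notin S ->
  power_ideal S a (x j * y) -> power_ideal S a y.
Proof.
move: {2}(\sum_(i in S) a i)%N (leqnn (\sum_(i in S) a i)%N) => N.
elim: N S a j y => [|N IH] S a j y hN jS hy.
  case: (EM (exists i, i \in S)) => [[i iS]|nS].
    suff : power_ideal S a 1 by move=> h; rewrite -[y]mulr1; apply: idealM => //; apply: power_ideal_ideal.
    move: (power_ideal_gen a iS); rewrite (_ : a i = 0%N) ?expr0 //.
    by apply/eqP; rewrite -leqn0 (leq_trans _ hN) // (bigD1 i) //= leq_addr.
  have [_ _ hp] := x_prime S.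
  have hy1 : power_ideal S (fun=> 1%N) (x j * y).
    by apply: eq_power_ideal hy => i iS; case: nS; exists i.
  have /x_notin := jS; case/hp: hy1 => // h _.
  by apply: eq_power_ideal h => i iS; case: nS; exists i.
case: (EM (exists2 i, i \in S & (1 < a i)%N)) => [[i iS ai]|nS].
  have ij : i != j by apply: contraNneq jS => <-.
  have [k ek] : exists k, a i = k.+2 by case: (a i) ai => [|[|k]] // _; exists k.
  have lt b k' : (k' < k.+2)%N -> (forall i', i' \in S :\ i -> b i' = a i') -> b i = k' ->
      (\sum_(i' in S) b i' <= N)%N.
    move=> hk hb hbi; rewrite -ltnS; apply: leq_trans hN.
    rewrite (bigD1 i) //= [X in (_ < X)%N](bigD1 i) //= hbi ek.
    rewrite (eq_bigr a) ?ltn_add2r // => i' /andP[h1 h2]; apply: hb.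
    by rewrite !inE h2.
  have lt' b : (forall i', i' \in S :\ i -> b i' = a i') -> (\sum_(i' in S :\ i) b i' <= N)%N.
    move=> hb; rewrite -ltnS; apply: leq_trans hN.
    rewrite [X in (_ < X)%N](bigD1 i) //= ek.
    rewrite (eq_bigl (fun i' => (i' \in S) && (i' != i))); last by move=> i'; rewrite !inE andbC.
    have -> : (\sum_(i' in S | i' != i) b i' = \sum_(i' in S | i' != i) a i')%N.
      by apply: eq_bigr => i' /andP[h1 h2]; apply: hb; rewrite !inE h2.
    by rewrite !addSn ltnS (leq_trans (leq_addl k _)).
  have updE c : forall i', i' \in S :\ i -> upd a i c i' = a i'.
    by move=> i'; rewrite !inE /upd => /andP[/negPf ->].
  have updi c : upd a i c i = c by rewrite /upd eqxx.
  have jSi : j \notin S :\ i by rewrite !inE negb_and jS orbT.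
  have iSi : i \notin S :\ i by rewrite !inE eqxx.
  have : power_ideal S (upd a i k.+1) y.
    apply: (IH _ _ j) => //; first exact: (lt _ k.+1 _ (updE _) (updi _)).
    apply: power_ideal_le hy => i' i'S; rewrite /upd; case: eqP => // ->.
    by rewrite ek.
  case/(power_idealD1 _ _ iS) => y' hy'.
  have hO : power_ideal (S :\ i) a (y - y' * x i ^+ k.+1).
    by move: hy'; rewrite updi; apply: eq_power_ideal => i' /updE.
  have [c hc] := (power_idealD1 _ _ iS).1 hy.
  have h1 : power_ideal (S :\ i) a (x i ^+ k.+1 * (x j * y' - c * x i)).
    have -> : x i ^+ k.+1 * (x j * y' - c * x i) =
       (x j * y - c * x i ^+ a i) - x j * (y - y' * x i ^+ k.+1) by rewrite ek !exprS; ring.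
    by apply: idealB; [exact: power_ideal_ideal | | apply: idealM => //; exact: power_ideal_ideal].
  have h2 : power_ideal (S :\ i) a (x j * y' - c * x i).
    elim: {ek hc hO lt hy'}k.+1 h1 => [|k1 IHk]; first by rewrite expr0 mul1r.
    by rewrite exprS -mulrA => /(IH _ _ i) h; apply/IHk/h => //; apply: lt'.
  have h3 : power_ideal S (upd a i 1%N) y'.
    apply: (IH _ _ j) => //; first exact: (lt _ 1%N _ (updE _) (updi _)).
    apply/(power_idealD1 _ _ iS); exists c; rewrite updi expr1.
    by apply: eq_power_ideal h2 => i' /updE.
  have [c2] := (power_idealD1 _ _ iS).1 h3; rewrite updi expr1 => h4.
  apply/(power_idealD1 _ _ iS); exists c2; rewrite ek.
  have -> : y - c2 * x i ^+ k.+2 = (y - y' * x i ^+ k.+1) + x i ^+ k.+1 * (y' - c2 * x i).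
    by rewrite exprS; ring.
  apply: idealD => //; first exact: power_ideal_ideal.
  apply: idealM; first exact: power_ideal_ideal.
  by apply: eq_power_ideal h4 => i' /updE.
case: (EM (exists2 i, i \in S & a i = 0%N)) => [[i iS ai]|nS0].
  suff : power_ideal S a 1 by move=> h; rewrite -[y]mulr1; apply: idealM => //; apply: power_ideal_ideal.
  by move: (power_ideal_gen a iS); rewrite ai expr0.
have e1 i : i \in S -> a i = 1%N.
  move=> iS; case ea: (a i) => [|[|k]] //.
    by case: nS0; exists i.
  by case: nS; exists i => //; rewrite ea.
have [_ _ hp] := x_prime S.
have hy1 : power_ideal S (fun=> 1%N) (x j * y) by apply: eq_power_ideal hy.
have /x_notin := jS; case/hp: hy1 => // h _.
by apply: eq_power_ideal h => i /e1.
Qed.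

Lemma power_ideal_regular_pow S a j k y : j \notin S ->
  power_ideal S a (x j ^+ k * y) -> power_ideal S a y.
Proof.
move=> jS; elim: k => [|k IH]; first by rewrite expr0 mul1r.
by rewrite exprS -mulrA => /(power_ideal_regular jS)/IH.
Qed.

Lemma power_ideal_colon S a j k y : j \in S -> (k <= a j)%N ->
  power_ideal S a (x j ^+ k * y) -> power_ideal S (upd a j (a j - k)%N) y.
Proof.
move=> jS kj /(power_idealD1 _ _ jS)[c hc]; apply/(power_idealD1 _ _ jS); exists c.
have jSj : j \notin S :\ j by rewrite !inE eqxx.
have hb i : i \in S :\ j -> a i = upd a j (a j - k)%N i.
  by rewrite !inE /upd => /andP[/negPf ->].
apply: eq_power_ideal hb _; apply: (@power_ideal_regular_pow _ _ j k) => //.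
rewrite /upd eqxx mulrBr; move: hc; rewrite -{1}(subnK kj) exprD.
by congr (power_ideal _ _ (_ - _)); ring.
Qed.

Lemma power_ideal_colon_seq (r : seq 'I_d) a n y : uniq r -> (forall j, j \in r -> n j <= a j)%N ->
  power_ideal setT a (\prod_(j <- r) x j ^+ n j * y) ->
  power_ideal setT (fun j => if j \in r then a j - n j else a j)%N y.
Proof.
elim: r a y => [|j r IH] a y /=.
  by move=> _ _; rewrite big_nil mul1r.
move=> /andP[jr ur] hn; rewrite big_cons -mulrA => h.
have h1 := power_ideal_colon (in_setT j) (hn j (mem_head _ _)) h.
have nej i : i \in r -> i != j by apply: contraTneq => ->.
have hn' i : i \in r -> (n i <= upd a j (a j - n j) i)%N.
  by move=> ir; rewrite /upd (negPf (nej i ir)) hn // inE ir orbT.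
have := IH _ _ ur hn' h1.
apply: eq_power_ideal => i _; rewrite inE /upd; case: eqP => [->|_] /=; last by [].
by rewrite (negPf jr).
Qed.

Definition param_ideal t : R -> Prop := power_ideal setT (fun=> t).

Definition monomial t : R := \prod_j x j ^+ t.

Lemma param_ideal_ideal t : ideal_pred (param_ideal t).
Proof. exact: power_ideal_ideal. Qed.

Lemma param_ideal_gen t j : param_ideal t (x j ^+ t).
Proof. exact: (power_ideal_gen (fun=> t) (in_setT j)). Qed.

Lemma param_ideal_min t (T : R -> Prop) y : ideal_pred T ->
  (forall i, T (x i ^+ t)) -> param_ideal t y -> T y.
Proof. by move=> hT h; apply: power_ideal_min => // i _; apply: h. Qed.

Lemma param_ideal_le s t y : (s <= t)%N -> param_ideal t y -> param_ideal s y.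
Proof. by move=> st; apply: power_ideal_le. Qed.

Lemma param_ideal_monomial s t y :
  param_ideal (s + t) (monomial s * y) -> param_ideal t y.
Proof.
move=> h; have := @power_ideal_colon_seq (index_enum 'I_d) (fun=> s + t)%N (fun=> s) y.
move=> /(_ (index_enum_uniq _) (fun j _ => leq_addr t s) h).
by apply: eq_power_ideal => i _; rewrite mem_index_enum addKn.
Qed.

(* The colon ideal is read off one variable at a time: dividing by
   [x_k ^+ a k] leaves the multiples of [x_k ^+ (t - a k)]. *)
Lemma param_ideal_colon t a y : (forall j, a j <= t)%N ->
  (forall j, param_ideal t (x j ^+ a j * y)) ->
  exists c, param_ideal t (y - c * \prod_j x j ^+ (t - a j)).
Proof.
move=> at_ hy.
suff h (r : seq 'I_d) : uniq r ->
    exists c, param_ideal t (y - c * \prod_(j <- r) x j ^+ (t - a j)).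
  exact: (h _ (index_enum_uniq _)).
elim: r => [_|k r IH].
  by exists y; rewrite big_nil mulr1 subrr; apply: ideal0; apply: param_ideal_ideal.
move=> /= /andP[kr ur]; have [c hc] := IH ur.
set p := \prod_(j <- r) _ in hc.
pose b j := (if j \in r then t - (t - a j) else t)%N.
have h1 : param_ideal t (p * (x k ^+ a k * c)).
  have -> : p * (x k ^+ a k * c) = x k ^+ a k * y - x k ^+ a k * (y - c * p) by ring.
  by apply: idealB => //; [exact: param_ideal_ideal | apply: idealM => //; exact: param_ideal_ideal].
have h2 : power_ideal setT b (x k ^+ a k * c).
  by apply: power_ideal_colon_seq h1 => // j _; apply: leq_subr.
have bk : b k = t by rewrite /b (negPf kr).
have ab : (a k <= b k)%N by rewrite bk.
have h3 := power_ideal_colon (in_setT k) ab h2.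
have [c2 hc2] := (power_idealD1 _ _ (in_setT k)).1 h3.
exists c2; rewrite big_cons -/p.
have h4 : param_ideal t (p * (c - c2 * x k ^+ (t - a k))).
  move: hc2; rewrite {2}/upd eqxx bk.
  apply: (@power_ideal_min _ _ (fun z => param_ideal t (p * z))).
    split=> [|u v w hv hw]; first by rewrite mulr0; apply: ideal0; apply: param_ideal_ideal.
    rewrite mulrDr /GRing.scale /= mulrCA.
    by apply: (param_ideal_ideal t).2.
  move=> i; rewrite !inE andbT /upd => /negPf ->; rewrite /b; case: ifP => [ir|_].
    rewrite /p (big_rem i ir) /= mulrAC -exprD (subnKC (leq_subr _ _)).
    by rewrite mulrC; apply: idealM; [exact: param_ideal_ideal | exact: param_ideal_gen].
  by apply: idealM; [exact: param_ideal_ideal | exact: param_ideal_gen].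
have -> : y - c2 * (x k ^+ (t - a k) * p) = (y - c * p) + p * (c - c2 * x k ^+ (t - a k)) by ring.
by apply: idealD => //; exact: param_ideal_ideal.
Qed.

End Monomials.

(** * Krull intersection and self-injectivity of the quotients by [m^[t]] *)

Section RegularSystem.
Variables (R : comNzRingType) (d : nat) (x : 'I_d -> R).

(** What is used of a regular local ring from here on. As [S] is an arbitrary subset, the [x j] form
    a regular sequence in every order. *)
Definition regular_system : Prop :=
  [/\ noetherian_module R^o,
      forall S, prime_pred (power_ideal x S (fun=> 1%N)),
      forall (S : {set 'I_d}) j, j \notin S -> ~ power_ideal x S (fun=> 1%N) (x j)
    & forall a, ~ param_ideal x 1 a -> exists b, a * b = 1].

Hypothesis hx : regular_system.
Let M := param_ideal x 1.

Lemma param_prime : prime_pred M.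
Proof. by case: hx => _ h _ _; apply: h. Qed.

Lemma param_gen j : M (x j).
Proof. by have := param_ideal_gen x 1 j; rewrite expr1. Qed.

Lemma unit_subr1 a : M a -> exists b, (1 - a) * b = 1.
Proof.
move=> Ma; case: hx => _ _ _; apply=> h; have [hM M1 _] := param_prime.
by apply: M1; rewrite -(subrK a 1); apply: idealD.
Qed.

Definition param_module (V : lmodType R) t : V -> Prop := fun w =>
  exists v : 'I_d -> V, w = \sum_j x j ^+ t *: v j.

(* Choose a submodule [K] maximal such that [K] meets [R u] in [M u] modulo [B];
   maximality puts a power of each [x j] times [V] inside [K]. *)
Lemma krull_intersection (V : lmodType R) (B : V -> Prop) u :
  noetherian_module V -> submodule B ->
  (forall t, exists b w, [/\ B b, param_module t w & u = b + w]) -> B u.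
Proof.
move=> hV hB hu; have [hM M1 Mp] := param_prime.
pose K0 w := exists a, M a /\ B (w - a *: u).
have hK0 : submodule K0.
  split=> [|c y z [a [Ma Ba]] [a' [Ma' Ba']]].
    by exists 0; rewrite scale0r subrr; split; [apply: ideal0 | apply: submodule0].
  exists (c * a + a'); split; first exact: hM.2.
  have -> : c *: y + z - (c * a + a') *: u = c *: (y - a *: u) + (z - a' *: u).
    by rewrite scalerBr scalerDl -scalerA addrACA opprD.
  exact: hB.2.
have [K [[hK Ku] K0K hmax]] := noetherian_maximal hV
  (F := fun K => submodule K /\ forall r, K (r *: u) -> K0 (r *: u))
  (P0 := K0) (fun P h => h.1) (conj hK0 (fun r h => h)).
have BK y : B y -> K y.
  by move=> By; apply: K0K; exists 0; rewrite scale0r subr0; split=> //; apply: ideal0.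
have MuK a : M a -> K (a *: u).
  by move=> Ma; apply: K0K; exists a; rewrite subrr; split=> //; apply: submodule0.
have hj j : exists n, forall v, K (x j ^+ n *: v).
  pose C n v := K (x j ^+ n *: v).
  have hC n : submodule (C n).
    split=> [|a v w hv hw]; rewrite /C; first by rewrite scaler0; apply: submodule0.
    by rewrite scalerDr scalerA mulrC -scalerA; apply: hK.2.
  have [Cn [[n ->] _ hn]] := noetherian_maximal hV (F := fun P => exists n, P = C n)
    (P0 := C 0%N) (fun P h => let: ex_intro n e := h in eq_ind_r _ (hC n) e)
    (ex_intro _ 0%N erefl).
  have stab v : K (x j ^+ n.+1 *: v) -> K (x j ^+ n *: v).
    have eC : C n.+1 = C n.
      apply: hn; first by exists n.+1.
      by move=> w; rewrite /C exprS -scalerA; apply: submoduleZ.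
    by rewrite -/(C n.+1 v) -/(C n v) eC.
  exists n => v.
  (* If [r u = k + x_j^n v'], multiplying by [x_j] puts [x_j^(n+1) v'] in [K], as [x_j r] is in [M];
     by stability [x_j^n v'] is in [K] too. So [K'] meets the condition imposed on [K] and
     maximality gives equality. *)
  pose K' w := exists k v, K k /\ w = k + x j ^+ n *: v.
  have eK : K' = K.
    apply: hmax; last by move=> w Kw; exists w, 0; rewrite scaler0 addr0.
    split=> [|r [k [v' [Kk e]]]].
      split=> [|c y z [k [w [Kk ->]]] [k' [w' [Kk' ->]]]].
        by exists 0, 0; rewrite scaler0 addr0; split=> //; apply: submodule0.
      exists (c *: k + k'), (c *: w + w'); split; first exact: hK.2.
      by rewrite !scalerDr !scalerA addrACA (mulrC c).
    apply: Ku; rewrite e; apply: submoduleD => //; apply: stab.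
    have -> : x j ^+ n.+1 *: v' = (x j * r) *: u - x j *: k.
      by rewrite -scalerA e scalerDr addrC addKr scalerA exprS.
    apply: submoduleB => //; last exact: submoduleZ.
    by apply: MuK; apply: idealMr => //; apply: param_gen.
  by rewrite -eK; exists 0, v; rewrite add0r; split=> //; apply: submodule0.
have [n hn] := choice hj.
have [b [w [Bb [v ->] e]]] := hu (\max_j n j)%N.
have : K (1 *: u).
  rewrite scale1r e; apply: submoduleD => //; first exact: BK.
  apply: submodule_sum => // j _.
  have h : (n j <= \max_j n j)%N by apply: leq_bigmax.
  by rewrite -(subnK h) exprD -scalerA; apply: submoduleZ.
(* Now [u] itself lies in [K], so [(1 - a) u] is in [B] for some [a] in [M], and [1 - a] is a
   unit. *)
move=> /Ku[a [/unit_subr1[c ec]]]; rewrite -scalerBl => /(submoduleZ c hB).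
by rewrite scalerA mulrC ec scale1r.
Qed.

Section SelfInjective.
Variables (t s : nat).
Hypothesis t_gt0 : (0 < t)%N.

Let J := param_ideal x t.

Let inJ (u : 'rV[R]_s) : Prop := forall k, J (u 0 k).

(* A linear map to [R / J] defined on a submodule of [(R / J)^s], given by its
   graph. *)
Record partial_map (G : 'rV[R]_s -> R -> Prop) : Prop := {
  partial_map_linear : forall a u y u' y', G u y -> G u' y' -> G (a *: u + u') (a * y + y');
  partial_map_functional : forall u y, G u y -> inJ u -> J y;
  partial_map_inJ : forall u, inJ u -> G u 0
}.

Lemma inJ0 : inJ 0.
Proof. by move=> k; rewrite mxE; apply: ideal0; apply: param_ideal_ideal. Qed.

Lemma partial_map0 G : partial_map G -> G 0 0.
Proof. by move=> hG; apply: partial_map_inJ => //; apply: inJ0. Qed.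

Lemma partial_mapZ G a u y : partial_map G -> G u y -> G (a *: u) (a * y).
Proof.
by move=> hG h; rewrite -[a *: u]addr0 -[a * y]addr0; apply: partial_map_linear => //; apply: partial_map0.
Qed.

Lemma partial_mapD G u y u' y' : partial_map G -> G u y -> G u' y' -> G (u + u') (y + y').
Proof.
by move=> hG h h'; rewrite -[u]scale1r -[y]mul1r; apply: partial_map_linear.
Qed.

Lemma partial_map_sum G (I : finType) (u : I -> 'rV[R]_s) y : partial_map G ->
  (forall i, G (u i) (y i)) -> G (\sum_i u i) (\sum_i y i).
Proof.
move=> hG h; elim/big_ind2: _ => //; first exact: partial_map0.
by move=> *; apply: partial_mapD.
Qed.

(* The compatibility conditions are those satisfied by [b j = x j * b]. *)
Lemma solve_products (b : 'I_d -> R) :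
  (forall j k, J (x k * b j - x j * b k)) -> (forall j, J (x j ^+ t.-1 * b j)) ->
  exists c, forall j, J (x j * c - b j).
Proof.
have [_ hp hn _] := hx; have hJ : ideal_pred J by apply: param_ideal_ideal.
move=> hcomp hkill.
suff h (r : seq 'I_d) : uniq r -> exists c, forall j, j \in r -> J (x j * c - b j).
  have [c hc] := h _ (index_enum_uniq _); exists c => j; apply: hc.
  by rewrite mem_index_enum.
elim: r => [_|k r IH] /=; first by exists 0.
move=> /andP[kr ur]; have [c hc] := IH ur.
(* The error [b k - x k * c] is annihilated modulo [J] by [x_k^(t-1)] and by the [x_j] with [j] in
   [r]; exponent [t] makes the condition void elsewhere. So the error is a multiple of [x_k] times
   the [x_j^(t-1)], and correcting [c] accordingly does not disturb the equations for [r]. *)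
pose a j := (if j == k then t.-1 else if j \in r then 1 else t)%N.
have [||e he] := @param_ideal_colon R d x hp hn t a (b k - x k * c).
- by move=> j; rewrite /a; case: eqP => _; [apply: leq_pred | case: ifP].
- move=> j; rewrite /a; case: eqP => [->|_].
    have -> : x k ^+ t.-1 * (b k - x k * c) = x k ^+ t.-1 * b k - c * x k ^+ t.
      by rewrite -{3}(prednK t_gt0) exprS; ring.
    apply: idealB => //; first exact: hkill.
    by apply: idealM => //; apply: param_ideal_gen.
  case: ifP => jr; last first.
    by rewrite mulrC; apply: idealM => //; apply: param_ideal_gen.
  rewrite expr1.
  have -> : x j * (b k - x k * c) = - (x k * b j - x j * b k) - x k * (x j * c - b j) by ring.
  apply: idealB => //; first by apply: idealN; [exact: hJ | exact: hcomp].
  by apply: idealM => //; apply: hc.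
move: he; rewrite (bigD1 k) //= {1}/a eqxx; set p := \prod_(_ | _) _.
have -> : (t - t.-1 = 1)%N by lia.
rewrite expr1 => he.
exists (c + e * p) => j; rewrite inE => /orP[/eqP ->|jr].
  have -> : x k * (c + e * p) - b k = - (b k - x k * c - e * (x k * p)) by ring.
  exact: idealN.
have -> : x j * (c + e * p) - b j = (x j * c - b j) + e * (x j * p) by ring.
apply: idealD => //; first exact: hc.
apply: idealM => //.
have jk : j != k by apply: contraTneq jr => ->.
rewrite /p (bigD1 j) //= {1}/a (negPf jk) jr mulrA -exprS.
have -> : (t - 1).+1 = t by lia.
by rewrite mulrC; apply: idealM => //; apply: param_ideal_gen.
Qed.

(** The value at [v] is taken from [solve_products]. It is consistent because, for [v] outside the
    domain, any [r] with [r *: v] in the domain is a nonunit, hence a combination of the [x j]. *)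
Lemma partial_map_extend1 G v : partial_map G -> (forall j, exists b, G (x j *: v) b) ->
  exists G', [/\ partial_map G', forall u y, G u y -> G' u y & exists b, G' v b].
Proof.
move=> hG hv; have hJ : ideal_pred J by apply: param_ideal_ideal.
case: (EM (exists b, G v b)) => [hGv|nGv]; first by exists G.
have [b hb] := choice hv.
have [||c hc] := @solve_products b.
- move=> j k; apply: (partial_map_functional hG _ inJ0).
  have -> : (0 : 'rV_s) = x k *: (x j *: v) + (- x j) *: (x k *: v).
    by rewrite !scalerA -scalerDl mulNr mulrC subrr scale0r.
  rewrite -mulNr; apply: partial_map_linear => //.
  exact: partial_mapZ.
- move=> j; apply: (partial_map_functional hG (partial_mapZ (x j ^+ t.-1) hG (hb j))).
  move=> k; rewrite scalerA -exprSr (prednK t_gt0) mxE mulrC.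
  by apply: idealM => //; apply: param_ideal_gen.
exists (fun u y => exists r u0 y0, [/\ G u0 y0, u = u0 + r *: v & y = y0 + r * c]).
split; last 1 first.
- by exists c, 1, 0, 0; rewrite !add0r scale1r mul1r; split=> //; apply: partial_map0.
- split.
  + move=> a u y u' y' [r [u0 [y0 [h0 -> ->]]]] [r' [u0' [y0' [h0' -> ->]]]].
    exists (a * r + r'), (a *: u0 + u0'), (a * y0 + y0'); split.
    * exact: partial_map_linear.
    * by rewrite scalerDr scalerDl scalerA addrACA.
    * ring.
  + move=> u y [r [u0 [y0 [h0 -> ->]]]] hu.
    have hr : M r.
      apply: contrapT; case: hx => _ _ _ hunit /hunit[r' er].
      apply: nGv; exists (r' * - y0).
      have -> : v = r' *: (u0 + r *: v + (-1) *: u0).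
        by rewrite scaleN1r addrAC subrr add0r scalerA mulrC er scale1r.
      apply: partial_mapZ => //; rewrite -[- y0]add0r.
      apply: partial_mapD => //; first exact: partial_map_inJ.
      by rewrite -[- y0]mulN1r; apply: partial_mapZ.
    have [r' er] : exists r', r = \sum_j r' j * x j.
      case: hr => r' er; exists r'; rewrite er.
      by apply: eq_big => [j|j _]; rewrite ?inE ?expr1.
    have h1 : G (r *: v) (\sum_j r' j * b j).
      rewrite er scaler_suml; apply: partial_map_sum => // j.
      by rewrite -scalerA; apply: partial_mapZ.
    have h2 := partial_map_functional hG (partial_mapD hG h0 h1) hu.
    have -> : y0 + r * c = (y0 + \sum_j r' j * b j) + \sum_j r' j * (x j * c - b j).
      rewrite er -addrA -big_split /= mulr_suml.
      by congr (_ + _); apply: eq_bigr => j _; ring.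
    by apply: idealD => //; apply: ideal_sum => // j _; apply: idealM.
  + move=> u hu; exists 0, u, 0; rewrite scale0r mul0r !addr0; split=> //.
    exact: partial_map_inJ.
- by move=> u y h; exists 0, u, y; rewrite scale0r mul0r !addr0.
Qed.

(** Each [x k *: v] has a smaller exponent sum, so induction first brings all of them into the
    domain. Modulo [J] the constant exponent [t] always qualifies, so every vector can be
    reached. *)
Lemma partial_map_extend N G v (n : 'I_d -> nat) : partial_map G -> (\sum_j n j <= N)%N ->
  (forall j, exists b, G (x j ^+ n j *: v) b) ->
  exists G', [/\ partial_map G', forall u y, G u y -> G' u y & exists b, G' v b].
Proof.
elim: N G v n => [|N IH] G v n hG hN hv;
  (case: (EM (exists j, n j = 0%N)) => [[j nj]|nn];
    first by exists G; split=> //; have := hv j; rewrite nj expr0 scale1r).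
  apply: partial_map_extend1 => // j; case: nn; exists j; apply/eqP.
  by rewrite -leqn0 (leq_trans _ hN) // (bigD1 j) //= leq_addr.
suff h (r : seq 'I_d) : exists G', [/\ partial_map G', forall u y, G u y -> G' u y &
    forall j, j \in r -> exists b, G' (x j *: v) b].
  have [G1 [hG1 GG1 hr]] := h (index_enum 'I_d).
  have [|G2 [hG2 G12 hv2]] := @partial_map_extend1 G1 v hG1.
    by move=> j; apply: hr; rewrite mem_index_enum.
  by exists G2; split=> // u y /GG1/G12.
elim: r => [|k r [G1 [hG1 GG1 hr]]]; first by exists G.
have nk : (0 < n k)%N by rewrite lt0n; apply/eqP => e; apply: nn; exists k.
have [||G2 [hG2 G12 hv2]] := IH G1 (x k *: v) (fun j => if j == k then (n j).-1 else n j) hG1.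
- rewrite -ltnS (leq_trans _ hN) // (bigD1 k) //= [X in (_ < X)%N](bigD1 k) //= eqxx.
  rewrite -addSn prednK // leq_add2l; apply: leq_sum => j /negPf -> //.
- move=> j; have [b hb] := hv j; case: eqP => [ejk|_].
    by rewrite scalerA ejk -exprSr prednK // -ejk; exists b; apply: GG1.
  by rewrite scalerA mulrC -scalerA; exists (x k * b); apply: partial_mapZ => //; apply: GG1.
exists G2; split=> // [u y /GG1/G12 //|j]; rewrite inE => /orP[/eqP -> //|/hr[b hb]].
by exists b; apply: G12.
Qed.

(** By hypothesis [g D -> g f] is well defined modulo [J] on the row space of [D]. It extends to all
    rows, and [w] collects its values on the basis. *)
Lemma self_injective r (D : 'M[R]_(r, s)) (f : 'cV[R]_r) :
  (forall g : 'rV_r, (forall k, param_ideal x t ((g *m D) 0 k)) ->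
     param_ideal x t ((g *m f) 0 0)) ->
  exists w : 'cV_s, forall k, param_ideal x t ((f - D *m w) k 0).
Proof.
move=> hf; have hJ : ideal_pred J by apply: param_ideal_ideal.
pose G0 u y := exists g : 'rV_r, inJ (u - g *m D) /\ J (y - (g *m f) 0 0).
have hG0 : partial_map G0.
  split.
  - move=> a u y u' y' [g [hu hy]] [g' [hu' hy']]; exists (a *: g + g').
    split=> [k|].
      have -> : (a *: u + u' - (a *: g + g') *m D) 0 k =
         a * (u - g *m D) 0 k + (u' - g' *m D) 0 k.
        by rewrite mulmxDl -scalemxAl !mxE; ring.
      by apply: idealD => //; apply: idealM.
    have -> : a * y + y' - ((a *: g + g') *m f) 0 0 =
        a * (y - (g *m f) 0 0) + (y' - (g' *m f) 0 0).
      by rewrite mulmxDl -scalemxAl !mxE; ring.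
    by apply: idealD => //; apply: idealM.
  - move=> u y [g [hu hy]] Ju; rewrite -(subrK ((g *m f) 0 0) y); apply: idealD => //.
    apply: hf => k.
    have -> : (g *m D) 0 k = u 0 k - (u - g *m D) 0 k by rewrite !mxE; ring.
    by apply: (idealB hJ); [apply: Ju | apply: hu].
  - move=> u Ju; exists 0; rewrite !mul0mx subr0 mxE subr0; split=> //.
    exact: ideal0.
have [G1 [hG1 G01 hw]] : exists G', [/\ partial_map G', forall u y, G0 u y -> G' u y &
    forall l, l \in index_enum 'I_s -> exists b, G' (delta_mx 0 l) b].
  elim: (index_enum 'I_s) => [|l q [G1 [hG1 G01 hq]]]; first by exists G0.
  have [|G2 [hG2 G12 hl]] := @partial_map_extend _ G1 (delta_mx 0 l) (fun=> t) hG1 (leqnn _).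
    move=> j; exists 0; apply: partial_map_inJ => // k; rewrite mxE mulrC.
    by apply: idealM => //; apply: param_ideal_gen.
  exists G2; split=> // [u y /G01/G12 //|l']; rewrite inE => /orP[/eqP -> //|/hq[b hb]].
  by exists b; apply: G12.
have [w hw'] := choice (fun l => hw l (mem_index_enum l)).
exists (\col_l w l) => k.
apply: (partial_map_functional hG1 _ inJ0).
have -> : (0 : 'rV_s) = row k D + (-1) *: \sum_l D k l *: delta_mx 0 l.
  by rewrite [X in X + _]row_sum_delta scaleN1r; under eq_bigr => l _ do rewrite mxE; rewrite subrr.
have -> : (f - D *m \col_l w l) k 0 = f k 0 + (-1) * \sum_l D k l * w l.
  rewrite !mxE mulN1r; congr (_ - _); apply: eq_bigr => l _; by rewrite mxE.
apply: partial_mapD => //.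
  apply: G01; exists (delta_mx 0 k); split.
    by rewrite -rowE subrr; apply: inJ0.
  by rewrite -rowE mxE subrr; apply: ideal0.
by apply: partial_mapZ => //; apply: partial_map_sum => // l; apply: partial_mapZ.
Qed.

End SelfInjective.
End RegularSystem.

(** * The regular system of a regular local ring *)

Section FromRegularLocal.
Variables (R : comNzRingType) (m : ideal R) (d : nat).
Hypothesis hreg : regular_local_ring m d.

Lemma seq_ideal_power_ideal (x : 'I_d -> R) (S : {set 'I_d}) :
  seq_ideal [seq x i | i <- enum S] = power_ideal x S (fun=> 1%N).
Proof.
apply: eq_ideal => y; split.
  apply: seq_ideal_min => [|z /mapP[i iS ->]]; first exact: power_ideal_ideal.
  by rewrite -[x i]expr1; apply: (power_ideal_gen x (fun=> 1%N)); rewrite -mem_enum.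
apply: power_ideal_min => [|i iS]; first exact: seq_ideal_ideal.
by rewrite expr1; apply: seq_ideal_gen; apply: map_f; rewrite mem_enum.
Qed.

(** Any subset of the generators can be listed first, so the statements on prefixes give those on
    all subsets. *)
Lemma regular_local_system : exists x : 'I_d -> R,
  regular_system x /\ forall y, y \in m <-> param_ideal x 1 y.
Proof.
have hN := regular_noetherian hreg.
have [P hP] := regular_chain hreg.
have hM := maximal_prime hreg.
have [_ _ _ [s hs ss] _] := hreg.
pose x (i : 'I_d) := s`_i.
have eM (r1 r2 : seq 'I_d) : (forall i, i \in r1 ++ r2) ->
    seq_ideal ([seq x i | i <- r1] ++ [seq x i | i <- r2]) = (fun y => y \in m).
  move=> hr; rewrite -(generates_seq_ideal hs) -map_cat; apply: eq_ideal => y; split.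
    apply: seq_ideal_sub => z /mapP[i _ ->]; apply: mem_nth; rewrite ss; exact: ltn_ord.
  apply: seq_ideal_sub => z /(nthP 0)[k]; rewrite ss => kd <-.
  by apply/mapP; exists (Ordinal kd).
have em : param_ideal x 1 = (fun y => y \in m).
  have hT (i : 'I_d) : i \in enum [set: 'I_d] ++ [::] by rewrite cats0 mem_enum inE.
  by rewrite /param_ideal -seq_ideal_power_ideal -(eM _ _ hT) /= cats0.
exists x; split; last by rewrite em.
split=> //.
- move=> S; rewrite -seq_ideal_power_ideal.
  apply: (regular_prefix_prime hN hM (regular_unit hreg)
     (s2 := [seq x i | i <- enum (~: S)]) (eM _ _ _)).
    by move=> i; rewrite mem_cat !mem_enum inE orbN.
  by rewrite !size_map -!cardE cardsC card_ord; exact: hP.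
- move=> S j jS; rewrite -seq_ideal_power_ideal.
  apply: (regular_prefix_notin hN (x := x j) (s2 := [seq x i | i <- enum (~: (j |: S))]) hM).
    apply: (eM (enum S) (j :: _)) => i.
    by rewrite mem_cat in_cons !mem_enum !inE; case: (i \in S); case: (i == j).
  rewrite !size_map -!cardE.
  suff -> : (#|S| + #|~: (j |: S)|.+1 = d)%N by exact: hP.
  have := cardsC (j |: S); rewrite cardsU1 jS card_ord; lia.
- by move=> a; rewrite em; apply: (regular_unit hreg).
Qed.

End FromRegularLocal.

(** * Flatness of Frobenius *)

Section Flatness.
Variables (R : comNzRingType) (d : nat) (x : 'I_d -> R).
Hypothesis hx : regular_system x.
Variables (phi : {rmorphism R -> R}) (q : nat).
Hypothesis q_gt0 : (0 < q)%N.
Hypothesis phiE : forall i, phi (x i) = x i ^+ q.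

Local Notation "A ^phi" := (map_mx phi A) (at level 2, format "A ^phi").

(** For one column generating [J] this is the vanishing of Tor_1 of [R/J] with [R] viewed as a
    module through [phi]; for all matrices it is the equational criterion of flatness. *)
Definition flat_at n k (A : 'M[R]_(n, k)) : Prop :=
  forall v : 'rV_n, v *m A^phi = 0 ->
    exists l (W : 'M[R]_(l, n)) (c : 'rV_l), W *m A = 0 /\ v = c *m W^phi.

Lemma flat_at_change n1 n2 (f : 'cV[R]_n1) (g : 'cV[R]_n2) A B :
  g = A *m f -> f = B *m g -> flat_at f -> flat_at g.
Proof.
move=> eg ef hf v; rewrite eg map_mxM mulmxA => /hf[l [W [c [Wf ec]]]].
(* The rows of [1 - A B] are relations on [g], because [g = A B g]; they account for the part of [v]
   lost by passing to [f] and back. *)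
exists (n2 + l)%N, (col_mx (1%:M - A *m B) (W *m B)), (row_mx v c); split.
  by rewrite mul_col_mx mulmxBl mul1mx -!mulmxA -eg -ef -eg subrr Wf col_mx0.
rewrite map_col_mx mul_row_col map_mxB !map_mxM map_mx1 mulmxBr mulmx1.
by rewrite !mulmxA -ec subrK.
Qed.

Definition entry_ideal n (f : 'cV[R]_n) : R -> Prop := fun y => exists c : 'rV_n, y = (c *m f) 0 0.

Lemma entry_ideal_matrix n1 n2 (f : 'cV[R]_n1) (g : 'cV[R]_n2) :
  (forall i, entry_ideal f (g i 0)) -> exists A, g = A *m f.
Proof.
move=> h; have [c hc] := choice h; exists (\matrix_i c i).
by apply/colP => i; rewrite hc !mxE; apply: eq_bigr => j _; rewrite !mxE.
Qed.

Lemma entry_ideal_ideal n (f : 'cV[R]_n) : ideal_pred (entry_ideal f).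
Proof.
split=> [|a y z [c ->] [c' ->]]; first by exists 0; rewrite mul0mx mxE.
by exists (a *: c + c'); rewrite mulmxDl -scalemxAl !mxE.
Qed.

Lemma entry_ideal_gen n (f : 'cV[R]_n) i : entry_ideal f (f i 0).
Proof. by exists (delta_mx 0 i); rewrite -rowE mxE. Qed.

Definition flat_ideal (J : R -> Prop) : Prop :=
  exists n (f : 'cV[R]_n), entry_ideal f = J /\ flat_at f.

Lemma flat_ideal_at J n (f : 'cV[R]_n) : flat_ideal J -> entry_ideal f = J -> flat_at f.
Proof.
move=> [k [g [eg hg]]] ef.
have [A eA] : exists A, f = A *m g.
  by apply: entry_ideal_matrix => i; rewrite eg -ef; apply: entry_ideal_gen.
have [B eB] : exists B, g = B *m f.
  by apply: entry_ideal_matrix => i; rewrite ef -eg; apply: entry_ideal_gen.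
exact: flat_at_change eA eB hg.
Qed.

Lemma ideal_entry J : ideal_pred J -> exists n (f : 'cV[R]_n), entry_ideal f = J.
Proof.
case: hx => hN _ _ _ hJ; have [n [g ->]] := hN _ hJ.
exists n, (\col_i g i); apply: eq_ideal => y; split=> [[c ->]|[c ->]].
  by exists (fun i => c 0 i); rewrite !mxE; apply: eq_bigr => i _; rewrite !mxE.
by exists (\row_i c i); rewrite !mxE; apply: eq_bigr => i _; rewrite !mxE.
Qed.

Lemma flat_ideal1 J : ideal_pred J -> J 1 -> flat_ideal J.
Proof.
move=> hJ J1; exists 1%N, 1%:M; split.
  apply: eq_ideal => y; split=> _; first by rewrite -[y]mulr1; apply: idealM.
  by exists y%:M; rewrite mulmx1 mxE.
move=> v; rewrite map_mx1 mulmx1 => ->.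
by exists 0%N, 0, 0; rewrite !mul0mx.
Qed.

(* The relations on [x j ^+ q] are the Koszul ones. *)
Lemma flat_ideal_max : flat_ideal (param_ideal x 1).
Proof.
have [hN hp hn _] := hx.
exists d, (\col_i x i); split.
  apply: eq_ideal => y; split=> [[c ->]|].
    rewrite !mxE; apply: ideal_sum => [|i _]; first exact: param_ideal_ideal.
    rewrite mxE; apply: idealM; first exact: param_ideal_ideal.
    exact: (param_gen x).
  apply: param_ideal_min => [|i]; first exact: entry_ideal_ideal.
  by rewrite expr1; have := entry_ideal_gen (\col_i x i) i; rewrite mxE.
pose rel (v : 'rV[R]_d) := exists l (W : 'M[R]_(l, d)) (c : 'rV_l),
  W *m \col_i x i = 0 /\ v = c *m W^phi.
have relD u v : rel u -> rel v -> rel (u + v).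
  move=> [l [W [c [hW ->]]]] [l' [W' [c' [hW' ->]]]].
  exists (l + l')%N, (col_mx W W'), (row_mx c c').
  by rewrite mul_col_mx hW hW' col_mx0 map_col_mx mul_row_col.
have relK i j a : rel (a *: (x j ^+ q *: delta_mx 0 i - x i ^+ q *: delta_mx 0 j)).
  exists 1%N, (x j *: delta_mx 0 i - x i *: delta_mx 0 j), a%:M; split.
    apply/matrixP => r s; rewrite (ord1 r) (ord1 s) mulmxBl -!scalemxAl -!rowE !mxE.
    by rewrite mulrC subrr.
  by rewrite mul_scalar_mx map_mxB !map_mxZ !map_delta_mx !phiE.
suff h (S : {set 'I_d}) (v : 'rV[R]_d) : (forall i, i \notin S -> v 0 i = 0) ->
    v *m (\col_i x i)^phi = 0 -> rel v.
  by move=> v; apply: (h setT) => i; rewrite inE.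
move: {2}#|S| (leqnn #|S|) => N; elim: N S v => [|N IH] S v hS hv hv0.
  have -> : v = 0.
    apply/rowP => i; rewrite mxE hv //; move: hS; rewrite leqn0 cards_eq0 => /eqP ->.
    by rewrite inE.
  by exists 0%N, 0, 0; rewrite !mul0mx.
case: (set_0Vmem S) => [S0|[j jS]]; first by apply: (IH S) => //; rewrite S0 cards0.
have : power_ideal x (S :\ j) (fun=> q) (x j ^+ q * v 0 j).
  have : (v *m (\col_i x i)^phi) 0 0 = 0 by rewrite hv0 mxE.
  rewrite !mxE (bigD1 j) //= !mxE phiE mulrC => /eqP; rewrite addr_eq0 => /eqP ->.
  apply: idealN; first exact: power_ideal_ideal.
  exists (fun i => v 0 i); rewrite [RHS]big_mkcond [LHS]big_mkcond; apply: eq_bigr => i _.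
  rewrite !inE !mxE phiE; case: eqP => //= _; case: ifP => // /negbT/hv ->.
  by rewrite mul0r.
have jSj : j \notin S :\ j by rewrite !inE eqxx.
move=> /(power_ideal_regular_pow hp hn jSj)[c ec].
(* Since [x_j^q] is regular modulo the other powers, [v 0 j] is a combination of them; the matching
   Koszul relations cancel the [j]-th coordinate and shrink the support. *)
pose u := \sum_(i in S :\ j) c i *: (x i ^+ q *: delta_mx 0 j - x j ^+ q *: delta_mx 0 i) : 'rV[R]_d.
have relu : rel u.
  rewrite /u; elim/big_ind: _ => [||i _]; [|exact: relD|exact: relK].
  by exists 0%N, 0, 0; rewrite !mul0mx.
have u0 : u *m (\col_i x i)^phi = 0.
  rewrite /u mulmx_suml big1 // => i _; apply/matrixP => r s.
  rewrite (ord1 r) (ord1 s) -scalemxAl mulmxBl -!scalemxAl -!rowE !mxE !phiE.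
  by ring.
rewrite -(subrK u v); apply: relD => //; apply: (IH (S :\ j)).
- by move: hS; rewrite (cardsD1 j) jS.
- move=> i; rewrite !inE negb_and negbK => hi.
  rewrite !mxE /u summxE.
  case: (eqVneq i j) hi => [->|ij] /= hi.
    rewrite ec; apply/eqP; rewrite subr_eq0; apply/eqP; apply: eq_bigr => k.
    rewrite !inE => /andP[kj _]; rewrite !mxE !eqxx (eq_sym j k) (negPf kj) /=; ring.
  rewrite hv // big1 ?subr0 // => k; rewrite !inE => /andP[kj kS].
  rewrite !mxE (negPf ij) /= (_ : i == k = false) ?mulr0 ?subr0 ?mulr0 //.
  by apply/negP => /eqP e; rewrite e kS in hi.
- by rewrite mulmxBl hv0 u0 subr0.
Qed.

Lemma entry_ideal_adjoin n (f : 'cV[R]_n) a :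
  entry_ideal (col_mx f a%:M) = adjoin (entry_ideal f) a.
Proof.
apply: eq_ideal => y; split=> [[c ->]|[b [r [[c ->] ->]]]].
  exists ((lsubmx c *m f) 0 0), (rsubmx c 0 0); split; first by exists (lsubmx c).
  rewrite -{1}(hsubmxK c) mul_row_col !mxE; congr (_ + _).
  by rewrite (bigD1 0) //= big1 ?addr0 => [|i]; rewrite ?mxE ?eqxx ?mulr1n // (ord1 i).
exists (row_mx c r%:M); rewrite mul_row_col !mxE; congr (_ + _).
by rewrite (bigD1 0) //= big1 ?addr0 => [|i]; rewrite ?mxE ?eqxx ?mulr1n // (ord1 i).
Qed.

(* Extend [v] by zero to a relation on [(f, a)]. *)
Lemma flat_adjoin n (f : 'cV[R]_n) a (v : 'rV[R]_n) :
  flat_ideal (adjoin (entry_ideal f) a) -> v *m f^phi = 0 ->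
  exists l (W : 'M[R]_(l, n)) (u : 'cV[R]_l) (c : 'rV[R]_l),
    [/\ W *m f + a *: u = 0, c *m u^phi = 0 & v = c *m W^phi].
Proof.
move=> hfl hv; have hat := flat_ideal_at hfl (entry_ideal_adjoin f a).
have [|l [W [c [hW ec]]]] := hat (row_mx v 0).
  by rewrite map_col_mx mul_row_col hv mul0mx addr0.
exists l, (lsubmx W), (rsubmx W), c.
move: hW ec; rewrite -{1 2}(hsubmxK W) mul_row_col map_row_mx mul_mx_row.
by move=> hW /eq_row_mx[-> <-]; split=> //; rewrite -hW mul_mx_scalar.
Qed.

(** The exact sequence [0 -> R/(J : a) -> R/J -> R/(J + a) -> 0]: the components [u] along [a] lie
    in [(J : a)], and relations on its generators [g] are carried back to [f] by [a g = H f]. *)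
Lemma flat_ideal_nonprime J a : ideal_pred J -> flat_ideal (adjoin J a) ->
  flat_ideal (fun y => J (y * a)) -> flat_ideal J.
Proof.
move=> hJ hadj hcol; have [n [f ef]] := ideal_entry hJ.
exists n, f; split=> // v hv; rewrite -ef in hadj.
have [l [W [u [c [hW hu ->]]]]] := flat_adjoin hadj hv.
have [k [g [eg hg]]] := hcol.
have [K eK] : exists K, u = K *m g.
  apply: entry_ideal_matrix => i; rewrite eg -ef; exists (- row i W).
  move/colP/(_ i)/eqP: hW; rewrite !mxE addrC addr_eq0 mulrC => /eqP ->.
  by rewrite -sumrN; apply: eq_bigr => j _; rewrite !mxE mulNr.
have [H eH] : exists H, a *: g = H *m f.
  apply: entry_ideal_matrix => i; rewrite ef mxE mulrC.
  have : entry_ideal g (g i 0) by apply: entry_ideal_gen.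
  by rewrite eg.
have [|l' [V [c' [hV ec']]]] := hg (c *m K^phi).
  by rewrite -mulmxA -map_mxM -eK.
exists (l + l')%N, (col_mx (W + K *m H) (V *m H)), (row_mx c (- c')); split.
  rewrite mul_col_mx mulmxDl -!mulmxA -eH -!scalemxAr -eK hW hV scaler0.
  exact: col_mx0.
rewrite map_col_mx mul_row_col map_mxD !map_mxM mulmxDr mulNmx !mulmxA -ec'.
by rewrite addrK.
Qed.

Lemma phi_max a : param_ideal x 1 a -> param_ideal x 1 (phi a).
Proof.
apply: (@param_ideal_min _ _ _ _ (fun a => param_ideal x 1 (phi a))).
  split=> [|b y z hy hz]; first by rewrite rmorph0; apply: ideal0; apply: param_ideal_ideal.
  by rewrite rmorphD rmorphM; apply: (param_ideal_ideal x 1).2.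
move=> i; rewrite expr1 phiE -(prednK q_gt0) exprSr.
by apply: idealM; [exact: param_ideal_ideal | exact: param_gen].
Qed.

(** Multiplication by [z] is injective on [R/J] with cokernel [R/(J + z)], so Tor_1 of [R/J] equals
    [phi z] times itself. It is finitely generated and [phi z] lies in the maximal ideal, so
    Nakayama's lemma applies. *)
Lemma flat_ideal_prime J z : prime_pred J -> param_ideal x 1 z -> ~ J z ->
  flat_ideal (adjoin J z) -> flat_ideal J.
Proof.
move=> [hJ J1 Jp] Mz nJz hadj; have [n [f ef]] := ideal_entry hJ.
exists n, f; split=> // v hv; rewrite -ef in hadj.
have [hN hp _ hunit] := hx.
apply: (@nakayama R (param_ideal x 1) 'rV[R]_n (fun v : 'rV_n => exists l (W : 'M[R]_(l, n)) (c : 'rV_l),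
    W *m f = 0 /\ v = c *m W^phi) (fun v : 'rV_n => v *m f^phi = 0)) => //.
- exact: hp.
- split=> [|b y t [l [W [c [hW ->]]]] [l' [W' [c' [hW' ->]]]]].
    by exists 0%N, 0, 0; rewrite !mul0mx.
  exists (l + l')%N, (col_mx W W'), (row_mx (b *: c) c').
  by rewrite mul_col_mx hW hW' col_mx0 map_col_mx mul_row_col -scalemxAl.
- apply: (@noetherian_row R n hN (fun v : 'rV[R]_n => v *m f^phi = 0)); split=> [|b y t hy ht]; first by rewrite mul0mx.
  by rewrite mulmxDl -scalemxAl hy ht scaler0 addr0.
move=> {hv}v hv; have [l [W [u [c [hW hu ->]]]]] := flat_adjoin hadj hv.
have [K eK] : exists K, u = K *m f.
  apply: entry_ideal_matrix => i; rewrite ef.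
  have : J (u i 0 * z).
    rewrite -ef; exists (- row i W).
    move/colP/(_ i)/eqP: hW; rewrite !mxE addrC addr_eq0 mulrC => /eqP ->.
    by rewrite -sumrN; apply: eq_bigr => j _; rewrite !mxE mulNr.
  by case/Jp.
exists (c *m (W + z *: K)^phi), (phi z *: - (c *m K^phi)); split.
- exists l, (W + z *: K), c; split=> //.
  by rewrite mulmxDl -scalemxAl -eK.
- by rewrite map_mxD map_mxZ mulmxDr scalerN -scalemxAr addrK.
- move=> S _ hS; apply: hS; first exact: phi_max.
  by rewrite mulNmx -mulmxA -map_mxM -eK hu oppr0.
Qed.

Lemma flat_ideal_all J : ideal_pred J -> flat_ideal J.
Proof.
have [hN hp _ hunit] := hx.
apply: (noetherian_ind hN (T := flat_ideal)) => {}J hJ IH.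
case: (EM (J 1)) => [|J1]; first exact: flat_ideal1.
have JM y : J y -> param_ideal x 1 y.
  move=> Jy; apply: contrapT => /hunit[b eb]; apply: J1.
  by rewrite -eb; apply: idealMr.
have hadj z : ~ J z -> flat_ideal (adjoin J z).
  move=> nz; apply: IH; first exact: adjoin_ideal.
    by move=> y; apply: adjoin_sub.
  by exists z; split=> //; apply: adjoin_gen.
case: (EM (forall a b, J (a * b) -> J a \/ J b)) => [Jp|].
  case: (EM (exists z, param_ideal x 1 z /\ ~ J z)) => [[z [Mz nz]]|nM].
    by apply: (@flat_ideal_prime J z) => //; apply: hadj.
  have -> : J = param_ideal x 1.
    apply: eq_ideal => y; split; first exact: JM.
    by move=> My; apply: contrapT => nJ; apply: nM; exists y.
  exact: flat_ideal_max.
move=> /existsNP[a /existsNP[b /not_implyP[Jab /not_orP[na nb]]]].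
apply: (@flat_ideal_nonprime J b) => //; first exact: hadj.
apply: IH; first exact: colon_ideal.
  by move=> y; apply: idealMr.
by exists a.
Qed.

(** Ideals suffice: solve the first column, then the remaining columns of the product [W A]. *)
Lemma frobenius_flat n k (A : 'M[R]_(n, k)) : flat_at A.
Proof.
elim: k n A => [|k IH] n A.
  by move=> v hv; exists n, 1%:M, v; rewrite map_mx1 mulmx1; split=> //; exact: thinmx0.
suff h (B : 'M_(n, 1 + k)) : flat_at B by exact: (h A).
move=> {A} v; move: B => A; rewrite -{1}(hsubmxK A) map_row_mx mul_mx_row -[0](@row_mx0 _ 1 1 k).
move=> /eq_row_mx[h1 h2].
have [l [W [c [hW ec]]]] := flat_ideal_at (flat_ideal_all (entry_ideal_ideal (lsubmx A))) erefl h1.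
have [|l' [V [c' [hV ec']]]] := IH l (W *m rsubmx A) c.
  by rewrite map_mxM mulmxA -ec.
exists l', (V *m W), c'; split; last by rewrite map_mxM mulmxA -ec'.
by rewrite -(hsubmxK A) mul_mx_row -!mulmxA hW mulmx0 hV row_mx0.
Qed.

End Flatness.

(** * Double complexes and staircases *)

Section DoubleComplexes.
Variable R : comNzRingType.

Record dcx := Dcx {
  dob :> nat -> nat -> lmodType R;
  hor : forall k l, {linear dob k l -> dob k l.+1};
  ver : forall k l, {linear dob k l -> dob k.+1 l};
  horK : forall k l (z : dob k l), hor k l.+1 (hor k l z) = 0;
  verK : forall k l (z : dob k l), ver k.+1 l (ver k l z) = 0;
  hor_ver : forall k l (z : dob k l), hor k.+1 l (ver k l z) = ver k l.+1 (hor k l z)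
}.

Definition shift (A : dcx) : dcx :=
  @Dcx (fun k l => A k.+1 l) (fun k l => hor A k.+1 l) (fun k l => ver A k.+1 l)
    (fun k l => @horK A k.+1 l) (fun k l => @verK A k.+1 l) (fun k l => @hor_ver A k.+1 l).

(* [z] and [f] are the two ends of a staircase running along the antidiagonal. *)
Fixpoint zigzag l : forall A : dcx, A 0%N l -> A l 0%N -> Prop :=
  match l with
  | 0 => fun A z f => z = f
  | l'.+1 => fun A z f => exists w : A 0%N l', hor A 0 l' w = z /\ @zigzag l' (shift A) (ver A 0 l' w) f
  end.

Definition hor_boundary l : forall A : dcx, A 0%N l -> Prop :=
  match l with
  | 0 => fun A z => z = 0
  | l'.+1 => fun A z => exists y : A 0%N l', ver A 0 l' y = 0 /\ z = hor A 0 l' y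
  end.

Definition ver_boundary l : forall A : dcx, A l 0%N -> Prop :=
  match l with
  | 0 => fun A f => f = 0
  | l'.+1 => fun A f => exists y : A l' 0%N, hor A l' 0 y = 0 /\ f = ver A l' 0 y
  end.

Definition rows_exact (A : dcx) : Prop :=
  forall k l (z : A k l.+1), hor A k l.+1 z = 0 -> exists w, z = hor A k l w.

Definition columns_exact (A : dcx) : Prop :=
  forall k l (z : A k.+1 l), ver A k.+1 l z = 0 -> exists w, z = ver A k l w.

(** Koszul columns may have cohomology at both ends, so exactness is asked only strictly inside one
    antidiagonal; [in_ver_image] covers the end of the staircase. *)
Definition antidiagonal_exact n (A : dcx) : Prop :=
  forall k l, (k.+1 + l.+1)%N = n ->
    forall z : A k.+1 l.+1, ver A k.+1 l.+1 z = 0 -> exists w, z = ver A k l.+1 w.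

Definition in_ver_image l : forall A : dcx, A l 0%N -> Prop :=
  match l with
  | 0 => fun A f => True
  | l'.+1 => fun A f => exists y : A l' 0%N, f = ver A l' 0 y
  end.

Lemma zigzag_linear l (A : dcx) a (z z' : A 0%N l) f f' :
  zigzag z f -> zigzag z' f' -> zigzag (a *: z + z') (a *: f + f').
Proof.
elim: l A z z' f f' => [|l IH] A z z' f f' /=; first by move=> -> ->.
move=> [w [<- h]] [w' [<- h']]; exists (a *: w + w'); rewrite !linearP; split=> //.
exact: (IH (shift A)).
Qed.

Lemma zigzagZ l (A : dcx) a (z : A 0%N l) f : zigzag z f -> zigzag (a *: z) (a *: f).
Proof.
move=> h; have h0 : zigzag (0 : A 0%N l) 0.
  elim: l A {z f h} => //= l IH A; exists 0; rewrite !linear0; split=> //; exact: (IH (shift A)).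
by have := zigzag_linear a h h0; rewrite !addr0.
Qed.

Lemma zigzag_forward l (A : dcx) (z : A 0%N l) : rows_exact A -> hor A 0 l z = 0 -> ver A 0 l z = 0 ->
  exists f, [/\ zigzag z f, hor A l 0 f = 0 & ver A l 0 f = 0].
Proof.
elim: l A z => [|l IH] A z hA hz vz; first by exists z.
have [w ew] := hA _ _ _ hz.
have [|||f [h1 h2 h3]] := IH (shift A) (ver A 0 l w).
- by move=> k l'; apply: hA.
- by rewrite /= hor_ver -ew.
- exact: verK.
by exists f; split=> //; exists w.
Qed.

Lemma zigzag_backward l (A : dcx) (f : A l 0%N) : antidiagonal_exact l A -> in_ver_image f ->
  hor A l 0 f = 0 -> ver A l 0 f = 0 ->
  exists z, [/\ zigzag z f, hor A 0 l z = 0 & ver A 0 l z = 0].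
Proof.
elim: l A f => [|l IH] A f hA imf hf vf; first by exists f.
have [||||z [h1 h2 h3]] := IH (shift A) f.
- by move=> k l' e; apply: hA; rewrite addSn e.
- by move: f imf {hf vf IH hA}; case: l.
- exact: hf.
- exact: vf.
have [w ew] : exists w, z = ver A 0 l w.
  case: l {IH} f imf hf vf z h1 h2 h3 hA => [|l] f imf hf vf z h1 h2 h3 hA.
    by case: imf => w ew; exists w; rewrite h1.
  exact: (hA 0%N l).
exists (hor A 0 l w); split; last 2 first.
- exact: horK.
- by rewrite -hor_ver -ew; apply: h2.
by exists w; split=> //; rewrite -ew.
Qed.

(** Makes the passage from [z] to [f] well defined on cohomology: [w - y] is a horizontal cocycle,
    hence a horizontal image, and the discrepancy moves one row down. *)
Lemma zigzag_hor_boundary l (A : dcx) (z : A 0%N l) f : rows_exact A ->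
  zigzag z f -> hor_boundary z -> ver_boundary f.
Proof.
elim: l A z f => [|l IH] A z f hA /=; first by move=> ->.
move=> [w [ew zw]] [y [vy ez]].
have hwy : hor A 0 l (w - y) = 0 by rewrite linearB ew ez subrr.
case: l IH z f w y ew zw vy ez hwy => [|l] IH z f w y ew zw vy ez hwy.
  by exists (w - y); rewrite (linearB (ver A 0 0)) vy subr0; split=> //; rewrite -zw.
have [v ev] := hA _ _ _ hwy.
apply: (IH (shift A) (ver A 0 l.+1 w)) => //; first by move=> k l'; apply: hA.
exists (ver A 0 l v); split; first exact: verK.
by rewrite /= hor_ver -ev linearB vy subr0.
Qed.

Lemma zigzag_ver_boundary l (A : dcx) (z : A 0%N l) f : columns_exact A ->
  zigzag z f -> ver_boundary f -> hor_boundary z.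
Proof.
elim: l A z f => [|l IH] A z f hA; first by move=> /= ->.
move=> [w [ew zw]] hf.
case: l IH z f w ew zw hf => [|l] IH z f w ew zw [y [hy ef]].
  exists (w - y); rewrite !linearB ew hy subr0; split=> //.
  by rewrite -ef [X in X - _]zw subrr.
have [||y' [vy' ey']] := IH (shift A) (ver A 0 l.+1 w) f _ zw.
- by move=> k l'; apply: hA.
- by exists y.
have [v ev] := hA _ _ _ vy'.
exists (w - hor A 0 l v); rewrite !linearB horK subr0 ew; split=> //.
by rewrite -hor_ver -ev ey' subrr.
Qed.

Lemma zigzag_map (A B : dcx) (tau : forall k l, A k l -> B k l) :
  (forall k l z, tau k l.+1 (hor A k l z) = hor B k l (tau k l z)) ->
  (forall k l z, tau k.+1 l (ver A k l z) = ver B k l (tau k l z)) ->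
  forall l (z : A 0%N l) f, zigzag z f -> zigzag (tau 0%N l z) (tau l 0%N f).
Proof.
move=> hh hv l; elim: l A B tau hh hv => [|l IH] A B tau hh hv z f /=; first by move=> ->.
move=> [w [<- hw]]; exists (tau 0%N l w); rewrite -hh -hv; split=> //.
by apply: (IH (shift A) (shift B) (fun k l => tau k.+1 l)) hw => k l' y; rewrite /= ?hh ?hv.
Qed.

End DoubleComplexes.

(** * Cones of multiplication maps *)

Section Linear.
Variable R : comNzRingType.

Definition linear_of (V W : lmodType R) (f : V -> W) (hf : linear f) : {linear V -> W} :=
  HB.pack f (GRing.isLinear.Build R V W _ f hf).

End Linear.

Section Cone.
Variable R : comNzRingType.

Record complex_map (C D : complex R) := ComplexMap {
  cmap :> forall n, {linear C n -> D n};
  cmap_diff : forall n u, cmap n.+1 (cdiff C n u) = cdiff D n (cmap n u)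
}.

Section ConeDef.
Variables (x : R) (C : complex R).

Definition cone_obj n : lmodType R :=
  if n is n'.+1 then (C n'.+1 * C n')%type else C 0%N.

Definition cone_diff_fun n : cone_obj n -> cone_obj n.+1 :=
  match n return cone_obj n -> cone_obj n.+1 with
  | 0 => fun u => (cdiff C 0 u, x *: u)
  | n'.+1 => fun w => (cdiff C n'.+1 w.1, x *: w.1 - cdiff C n' w.2)
  end.

Lemma cone_diff_linear n : linear (@cone_diff_fun n).
Proof.
case: n => [|n] a u v /=; congr (_, _) => /=; rewrite ?(linearP (cdiff C _)) //.
  by rewrite scalerDr !scalerA (mulrC x).
by rewrite scalerDr !scalerBr opprD addrACA !scalerA (mulrC x).
Qed.

Definition cone_diff n : {linear cone_obj n -> cone_obj n.+1} := linear_of (@cone_diff_linear n).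

Lemma cone_diffK n u : cone_diff n.+1 (cone_diff n u) = 0.
Proof.
case: n u => [|n] u; apply/eqP; rewrite xpair_eqE /= cdiffK eqxx /=.
  by rewrite linearZ subrr.
by rewrite linearB cdiffK subr0 linearZ subrr.
Qed.

Definition cone : complex R := Complex cone_diffK.

Lemma cone_boundary n (u : C n.+1) (v : C n) :
  is_boundary (C := cone) (k := n.+1) (u, v) <->
  exists a : C n, u = cdiff C n a /\ is_boundary (x *: a - v).
Proof.
case: n u v => [|n] u v /=; split.
- by move=> [a [-> ->]]; exists a; rewrite subrr.
- by move=> [a [-> /eqP]]; rewrite subr_eq0 => /eqP <-; exists a.
- move=> [[a b] [-> ->]] /=; exists a; split=> //; exists b.
  by rewrite opprB addrC subrK.
- move=> [a [-> [b eb]]]; exists (a, b); rewrite /= -eb.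
  by congr (_, _); rewrite opprB addrC subrK.
Qed.

Lemma cone_acyclic_below n :
  (forall k (u : C k), (k < n)%N -> cdiff C k u = 0 -> is_boundary u) ->
  (forall u : C n, cdiff C n u = 0 -> is_boundary (x *: u) -> is_boundary u) ->
  forall k (u : cone k), (k < n.+1)%N -> cdiff cone k u = 0 -> is_boundary u.
Proof.
move=> hC hx [|k] u kn /= e.
  have [e1 e2] : cdiff C 0 u = 0 /\ x *: u = 0 by case: e.
  case: n hC hx kn => [|n] hC hx _; last exact: (hC 0%N).
  by apply: (hx u) => //=.
case: u e => u v /= e.
have [e1 e2] : cdiff C k.+1 u = 0 /\ x *: u - cdiff C k v = 0 by case: e.
have exu : x *: u = cdiff C k v by apply/eqP; rewrite -subr_eq0 e2.
have [a ea] : is_boundary u.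
  move: kn; rewrite ltnS leq_eqVlt => /orP[/eqP kn|kn]; last exact: (hC k.+1).
  by subst n; apply: hx => //; exists v.
apply/cone_boundary; exists a; split=> //; apply: hC; first exact: kn.
by rewrite linearB linearZ /= -ea exu subrr.
Qed.

Lemma cone_acyclic_above :
  (forall k (u : C k.+1), cdiff C k.+1 u = 0 -> is_boundary u) ->
  (forall u : C 0%N, cdiff C 0 u = 0 -> exists v, cdiff C 0 v = 0 /\ u = x *: v) ->
  forall k (u : cone k.+1), cdiff cone k.+1 u = 0 -> is_boundary u.
Proof.
move=> hC hx k [u v] /= e.
have [e1 e2] : cdiff C k.+1 u = 0 /\ x *: u - cdiff C k v = 0 by case: e.
have [a ea] := hC k u e1.
have exa : cdiff C k (x *: a - v) = 0 by rewrite linearB linearZ -ea.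
apply/cone_boundary.
case: k u v e e1 e2 a ea exa => [|k] u v e e1 e2 a ea exa.
  have [b [hb eb]] := hx _ exa; exists (a - b).
  by rewrite linearB hb subr0 scalerBr -eb subKr subrr; split.
by exists a; split=> //; apply: hC.
Qed.

End ConeDef.

Section ConeMap.
Variables (x y x' : R) (C D : complex R) (f : complex_map C D).
Hypothesis ex' : x' = x * y.

(** The factor [y] on the second component makes the map compatible with [x] and [x' = x * y];
    iteration relates Koszul complexes of different powers. *)
Definition cone_map_fun n : cone x C n -> cone x' D n :=
  match n return cone x C n -> cone x' D n with
  | 0 => fun u => f 0%N u
  | n'.+1 => fun w => (f n'.+1 w.1, y *: f n' w.2)
  end.

Lemma cone_map_linear n : linear (@cone_map_fun n).
Proof.
by case: n => [|n] a u v /=; rewrite ?linearP.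
Qed.

Definition cone_map_lin n : {linear cone x C n -> cone x' D n} := linear_of (@cone_map_linear n).

Lemma cone_map_diff n u :
  cone_map_lin n.+1 (cdiff (cone x C) n u) = cdiff (cone x' D) n (cone_map_lin n u).
Proof.
case: n u => [|n] u /=; congr (_, _); try exact: cmap_diff.
  by rewrite linearZ /= scalerA ex' mulrC.
by rewrite linearB linearZ_LR scalerBr scalerA cmap_diff (linearZ_LR (cdiff D n)) ex' mulrC.
Qed.

Definition cone_map : complex_map (cone x C) (cone x' D) := ComplexMap cone_map_diff.

End ConeMap.
End Cone.

(** * Koszul complexes as iterated cones *)

Section Koszul.
Variable R : comNzRingType.
Implicit Types (X Y Z : lmodType R) (s : seq R) (ps : seq (R * R)).

Definition single_obj X n : lmodType R := if n is n'.+1 then 'rV[R]_0 else X.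

Lemma single_diff_linear X n : linear (fun _ : single_obj X n => 0 : single_obj X n.+1).
Proof. by move=> a u v; rewrite scaler0 addr0. Qed.

Definition single X : complex R :=
  @Complex R (single_obj X) (fun n => linear_of (@single_diff_linear X n)) (fun _ _ => erefl).

Definition single_map_fun X Y (f : X -> Y) n : single X n -> single Y n :=
  match n return single X n -> single Y n with 0 => f | n'.+1 => fun=> 0 end.

Lemma single_map_linear X Y (f : {linear X -> Y}) n : linear (@single_map_fun X Y f n).
Proof. by case: n => [|n] a u v /=; rewrite ?linearP ?scaler0 ?addr0. Qed.

Lemma single_map_diff X Y (f : {linear X -> Y}) n u :
  linear_of (@single_map_linear X Y f n.+1) (cdiff (single X) n u) =
  cdiff (single Y) n (linear_of (@single_map_linear X Y f n) u).
Proof. by []. Qed.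

Definition single_map X Y (f : {linear X -> Y}) : complex_map (single X) (single Y) :=
  ComplexMap (single_map_diff f).

Definition koszul s X : complex R := foldr (@cone R) (single X) s.

Fixpoint koszul_map s X Y (f : {linear X -> Y}) : complex_map (koszul s X) (koszul s Y) :=
  match s return complex_map (koszul s X) (koszul s Y) with
  | [::] => single_map f
  | x :: s' => cone_map (koszul_map s' f) (esym (mulr1 x))
  end.

Lemma koszul_map_comp0 s X Y Z (f : {linear X -> Y}) (g : {linear Y -> Z}) k u :
  (forall v, g (f v) = 0) -> koszul_map s g k (koszul_map s f k u) = 0.
Proof.
move=> h; elim: s k u => [|x s IH] [|k] u //=; first exact: IH.
by rewrite !scale1r !IH.
Qed.

Lemma koszul_map_exact s X Y Z (f : {linear X -> Y}) (g : {linear Y -> Z}) k u :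
  (forall v, g v = 0 -> exists w, v = f w) ->
  koszul_map s g k u = 0 -> exists w, u = koszul_map s f k w.
Proof.
move=> h; elim: s k u => [|x s IH] [|k] u //=; first exact: h.
- by move=> _; exists 0; apply: thinmx0.
- exact: IH.
case: u => u v /= e.
have [e1 e2] : koszul_map s g k.+1 u = 0 /\ 1 *: koszul_map s g k v = 0 by case: e.
have [a ea] := IH _ _ e1; rewrite scale1r in e2; have [b eb] := IH _ _ e2.
by exists (a, b); rewrite /= scale1r ea eb.
Qed.

Definition prods ps : seq R := [seq p.1 * p.2 | p <- ps].

(** The transition maps of the direct system of Koszul complexes: identity in degree 0, the product
    of all second factors in top degree. *)
Fixpoint koszul_rescale ps X : complex_map (koszul (unzip1 ps) X) (koszul (prods ps) X) :=
  match ps return complex_map (koszul (unzip1 ps) X) (koszul (prods ps) X) with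
  | [::] => single_map (idfun : {linear X -> X})
  | p :: ps' => cone_map (koszul_rescale ps' X) (erefl (p.1 * p.2))
  end.

Lemma koszul_rescale_map ps X Y (f : {linear X -> Y}) k u :
  koszul_rescale ps Y k (koszul_map (unzip1 ps) f k u) =
  koszul_map (prods ps) f k (koszul_rescale ps X k u).
Proof.
elim: ps k u => [|p ps IH] [|k] u //=; first exact: IH.
by rewrite !scale1r !linearZ !IH.
Qed.

Fixpoint koszul_bot s X : X -> koszul s X 0%N :=
  match s return X -> koszul s X 0%N with
  | [::] => id | x :: s' => @koszul_bot s' X end.

(* The junk value [0] outside degree [size s] avoids casts between degrees. *)
Fixpoint koszul_top s X k : X -> koszul s X k :=
  match s return X -> koszul s X k with
  | [::] => match k return X -> koszul [::] X k with 0 => id | _ => fun=> 0 end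
  | x :: s' =>
      match k return X -> koszul (x :: s') X k with
      | 0 => fun=> 0 | k'.+1 => fun u => (0, @koszul_top s' X k' u) end
  end.

Lemma koszul_bot_linear s X : linear (@koszul_bot s X).
Proof. by elim: s => //= x s IH. Qed.

Lemma koszul_top_linear s X k : linear (@koszul_top s X k).
Proof.
elim: s k => [|x s IH] [|k] a u v //=; rewrite ?scaler0 ?addr0 //.
by rewrite IH; congr (_, _) => /=; rewrite scaler0 addr0.
Qed.

Lemma koszul_top0 s X k : koszul_top s k (0 : X) = 0.
Proof. by elim: s k => [|x s IH] [|k] //=; rewrite IH. Qed.

Lemma koszul_topZB s X k a (v w : X) :
  koszul_top s k (a *: v - w) = a *: koszul_top s k v - koszul_top s k w.
Proof.
by rewrite addrC -scaleN1r koszul_top_linear scaleN1r addrC -[a *: v]addr0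
  koszul_top_linear koszul_top0 addr0.
Qed.

Lemma koszul_bot0 s X : koszul_bot s (0 : X) = 0.
Proof. by elim: s. Qed.

Lemma koszul_botZ s X a (v : X) : koszul_bot s (a *: v) = a *: koszul_bot s v.
Proof. by rewrite -[a *: v]addr0 koszul_bot_linear koszul_bot0 addr0. Qed.

Lemma koszul_bot_surj s X (u : koszul s X 0%N) : exists v, u = koszul_bot s v.
Proof. by elim: s u => [|x s IH] u /=; [exists u | apply: IH]. Qed.

Lemma koszul_bot_inj s X : injective (@koszul_bot s X).
Proof. by elim: s. Qed.

Lemma koszul_top_inj s X : injective (@koszul_top s X (size s)).
Proof. by elim: s => // x s IH u v /= [/IH]. Qed.

Lemma koszul_bot_map s X Y (f : {linear X -> Y}) u :
  koszul_map s f 0%N (koszul_bot s u) = koszul_bot s (f u).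
Proof. by elim: s. Qed.

Lemma koszul_top_map s X Y (f : {linear X -> Y}) k u :
  koszul_map s f k (koszul_top s k u) = koszul_top s k (f u).
Proof.
elim: s k => [|x s IH] [|k] //=; first by rewrite linear0.
by rewrite IH linear0 scale1r.
Qed.

Lemma koszul_top_rescale ps X (u : X) k :
  koszul_rescale ps X k (koszul_top _ k u) = koszul_top _ k ((\prod_(p <- ps) p.2) *: u).
Proof.
elim: ps k u => [|p ps IH] [|k] u //=; rewrite ?big_nil ?scale1r ?linear0 //.
by rewrite IH big_cons -scalerA -[p.2 *: _ in RHS]subr0 koszul_topZB koszul_top0 subr0.
Qed.

Lemma koszul_bot_rescale ps X (u : X) :
  koszul_rescale ps X 0%N (koszul_bot _ u) = koszul_bot _ u.
Proof. by elim: ps. Qed.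

Lemma koszul_bot_cocycle s X (u : X) :
  cdiff (koszul s X) 0 (koszul_bot s u) = 0 <-> forall x, x \in s -> x *: u = 0.
Proof.
elim: s => [|x s IH] //=; split.
  move=> e; have [e1 e2] : cdiff (koszul s X) 0 (koszul_bot s u) = 0 /\ x *: koszul_bot s u = 0.
    by case: e.
  move=> y; rewrite inE => /orP[/eqP ->|]; last exact: (IH.1 e1).
  by apply: (@koszul_bot_inj s); rewrite koszul_botZ e2 koszul_bot0.
move=> h; have -> : cdiff (koszul s X) 0 (koszul_bot s u) = 0.
  by apply/IH => y ys; apply: h; rewrite inE ys orbT.
by rewrite -koszul_botZ h ?mem_head // koszul_bot0.
Qed.

Lemma koszul_above s X k (u : koszul s X k) : (size s < k)%N -> u = 0.
Proof.
elim: s k u => [|x s IH] [|k] u //= hk; first by apply: thinmx0.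
case: u => u v; congr (_, _); apply: IH => //.
exact: ltn_trans (ltnSn _).
Qed.

Lemma koszul_top_surj s X (u : koszul s X (size s)) : exists v, u = koszul_top s (size s) v.
Proof.
elim: s u => [|x s IH] u /=; first by exists u.
case: u => u v; have [w ->] := IH v; exists w; congr (_, _).
exact: koszul_above.
Qed.

Fixpoint seq_module s X : X -> Prop :=
  if s is x :: s' then fun v => exists v' w, seq_module s' w /\ v = x *: v' + w
  else fun v => v = 0.

Lemma seq_module_submodule s X : submodule (@seq_module s X).
Proof.
elim: s => [|x s IH] /=; first by split=> // a u v -> ->; rewrite scaler0 addr0.
split=> [|a u v [u' [w [hw ->]]] [v' [w' [hw' ->]]]].
  by exists 0, 0; rewrite scaler0 addr0; split=> //; apply: submodule0.
exists (a *: u' + v'), (a *: w + w'); split; first exact: IH.2.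
by rewrite !scalerDr !scalerA (mulrC x) addrACA.
Qed.

Lemma koszul_top_boundary s X (v : X) :
  is_boundary (koszul_top s (size s) v) <-> seq_module s v.
Proof.
elim: s v => [|x s IH] v //.
split=> [/cone_boundary[a [_]]|].
  have [b ->] := koszul_top_surj a; rewrite -koszul_topZB => /IH hb.
  exists b, (- (x *: b - v)); split; last by rewrite subKr.
  by apply: submoduleN => //; apply: seq_module_submodule.
move=> [v' [w [hw ->]]]; apply/cone_boundary; exists (koszul_top s _ v'); split.
  by apply/esym; apply: koszul_above.
rewrite -koszul_topZB; apply/IH; rewrite opprD addrA subrr add0r.
by apply: submoduleN => //; apply: seq_module_submodule.
Qed.

Fixpoint regular_on s X : Prop :=
  if s is x :: s' then regular_on s' X /\
    forall v : X, seq_module s' (x *: v) -> seq_module s' v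
  else True.

Lemma koszul_regular s X : regular_on s X ->
  forall k (u : koszul s X k), (k < size s)%N -> cdiff (koszul s X) k u = 0 -> is_boundary u.
Proof.
elim: s => // x s IH /= [hs hx]; apply: cone_acyclic_below; first exact: IH.
move=> u _; have [v ->] := koszul_top_surj u.
by rewrite -[_ *: _]subr0 -(koszul_top0 s X (size s)) -koszul_topZB subr0 => /koszul_top_boundary/hx/koszul_top_boundary.
Qed.

(** The dual of [regular_on]: it leaves Koszul cohomology in degree 0 only, where [regular_on]
    leaves it in top degree only. *)
Fixpoint divisible_on s X : Prop :=
  if s is x :: s' then divisible_on s' X /\
    forall v : X, (forall y, y \in s' -> y *: v = 0) ->
      exists w, (forall y, y \in s' -> y *: w = 0) /\ v = x *: w
  else True.

Lemma koszul_divisible s X : divisible_on s X ->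
  forall k (u : koszul s X k.+1), cdiff (koszul s X) k.+1 u = 0 -> is_boundary u.
Proof.
elim: s => [_ k u _|x s IH /= [hs hx]].
  by exists 0; rewrite linear0; apply: thinmx0.
apply: cone_acyclic_above; first exact: IH.
move=> u; have [v ->] := koszul_bot_surj u => /koszul_bot_cocycle/hx[w [hw ->]].
by exists (koszul_bot s w); rewrite koszul_botZ; split=> //; apply/koszul_bot_cocycle.
Qed.

End Koszul.

(** * Injective modules *)

Section Injective.
Variable R : comNzRingType.

Lemma quot_proj_linear (V : lmodType R) (N : submodClosed V) :
  linear (fun u : V => \pi_({quot N}) u : {quot N}).
Proof.
move=> a u v; apply: etrans (raddfD _ _ _) _; congr (_ + _).
exact: (esym (pi_qscale N a u)).
Qed.

Definition quot_proj (V : lmodType R) (N : submodClosed V) : {linear V -> {quot N}} :=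
  linear_of (@quot_proj_linear V N).

Lemma quot_proj_surj (V : lmodType R) (N : submodClosed V) (q : {quot N}) :
  exists u, q = quot_proj N u.
Proof. by exists (generic_quotient.repr q); rewrite /= reprK. Qed.

Lemma quot_proj_eq0 (V : lmodType R) (N : submodClosed V) (u : V) :
  quot_proj N u = 0 <-> u \in N.
Proof.
rewrite -(linear0 (quot_proj N)); split=> [/eqP|uN].
  by rewrite /= -Quotient.idealrBE subr0.
by apply/eqP; rewrite /= -Quotient.idealrBE subr0.
Qed.

Lemma injective_factor (V W X : lmodType R) (f : {linear V -> W}) (h : {linear V -> X}) :
  injective_module X -> (forall v, f v = 0 -> h v = 0) ->
  exists g : {linear W -> X}, forall v, g (f v) = h v.
Proof.
move=> hX hker.
have hN : submodule (fun v => f v = 0).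
  by split=> [|a u v hu hv]; rewrite ?linear0 // linearP hu hv scaler0 addr0.
pose N := mk_sub hN; pose Q : lmodType R := {quot N}.
have lift (U : lmodType R) (k : {linear V -> U}) : (forall v, f v = 0 -> k v = 0) ->
    exists k' : {linear Q -> U}, forall v, k' (quot_proj N v) = k v.
  move=> hk; have [r hr] := choice (@quot_proj_surj V N).
  have e v : k (r (quot_proj N v)) = k v.
    apply/eqP; rewrite -subr_eq0 -linearB; apply/eqP/hk.
    apply: (mk_subE hN _).1; apply: (quot_proj_eq0 N _).1.
    by rewrite linearB -hr subrr.
  have lk : linear (fun q : Q => k (r q)).
    move=> a q1 q2; rewrite {1}(hr q1) {1}(hr q2).
    by rewrite -linearP e linearP.
  by exists (linear_of lk).
have [f' ef] := lift W f (fun v h => h); have [h' eh] := lift X h hker.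
have [|g hg] := hX Q W f' h'.
  move=> q1 q2; have [v1 ->] := quot_proj_surj q1; have [v2 ->] := quot_proj_surj q2.
  rewrite !ef => /eqP; rewrite -subr_eq0 -linearB => /eqP h0; apply/eqP.
  rewrite -subr_eq0 -linearB; apply/eqP/(quot_proj_eq0 N _).2; exact: (mk_subE hN _).2.
by exists g => v; rewrite -eh -hg ef.
Qed.

(** Multiplication by [x] embeds [R/S] into itself; extend the map [1 -> u] along this embedding and
    evaluate at 1. *)
Lemma injective_divide (X : lmodType R) (S : R -> Prop) (x : R) (u : X) :
  injective_module X -> ideal_pred S -> (forall r, S (x * r) -> S r) ->
  (forall y, S y -> y *: u = 0) -> exists w, (forall y, S y -> y *: w = 0) /\ u = x *: w.
Proof.
move=> hX hS hx hu; pose N := mk_sub (hS : @submodule R R^o S).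
have NE y : y \in N <-> S y by apply: mk_subE.
have lf : linear (fun r : R^o => quot_proj N (x * r : R^o)).
  move=> a r r'; rewrite -linearP; congr (quot_proj N _).
  by rewrite mulrDr /GRing.scale /= mulrCA.
have lh : linear (fun r : R^o => (r : R) *: u).
  by move=> a r r'; rewrite scalerDl scalerA.
have [|g hg] := @injective_factor _ _ X (linear_of lf) (linear_of lh) hX.
  by move=> r /quot_proj_eq0/NE/hx; apply: hu.
have gpi (y : R) : y *: g (quot_proj N (1 : R^o)) = g (quot_proj N (y : R^o)).
  by rewrite -!linearZ_LR /= [y *: _](mulr1 y).
exists (g (quot_proj N (1 : R^o))); split=> [y Sy|].
  by rewrite gpi (quot_proj_eq0 N y).2 ?linear0 //; apply/NE.
by rewrite gpi; have := hg 1; rewrite /= mulr1 scale1r.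
Qed.

End Injective.

(** * Koszul double complex of an exact complex *)

Section KoszulDescent.
Variable R : comNzRingType.

Definition complex_exact (T : complex R) : Prop :=
  forall l (z : T l.+1), cdiff T l.+1 z = 0 -> exists w, z = cdiff T l w.

Section KoszulDcx.
Variables (s : seq R) (T : complex R).

Lemma koszul_horK k l (z : koszul s (T l) k) :
  koszul_map s (cdiff T l.+1) k (koszul_map s (cdiff T l) k z) = 0.
Proof. by apply: koszul_map_comp0 => v; apply: cdiffK. Qed.

Lemma koszul_hor_ver k l (z : koszul s (T l) k) :
  koszul_map s (cdiff T l) k.+1 (cdiff (koszul s (T l)) k z) =
  cdiff (koszul s (T l.+1)) k (koszul_map s (cdiff T l) k z).
Proof. exact: cmap_diff. Qed.

Definition koszul_dcx : dcx R :=
  @Dcx R (fun k l => koszul s (T l) k) (fun k l => koszul_map s (cdiff T l) k)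
    (fun k l => cdiff (koszul s (T l)) k) koszul_horK
    (fun k l => @cdiffK R (koszul s (T l)) k) koszul_hor_ver.

Lemma koszul_rows_exact : complex_exact T -> rows_exact koszul_dcx.
Proof. by move=> hT k l z; apply: koszul_map_exact => v; apply: hT. Qed.

End KoszulDcx.

Definition prepend_obj (X : lmodType R) (C : complex R) n : lmodType R :=
  if n is n'.+1 then C n' else X.

Definition prepend_diff (X : lmodType R) (C : complex R) (f : {linear X -> C 0%N}) n :
    {linear prepend_obj X C n -> prepend_obj X C n.+1} :=
  match n with 0 => f | n'.+1 => cdiff C n' end.

Lemma prepend_diffK (X : lmodType R) (C : complex R) (f : {linear X -> C 0%N}) : (forall u, cdiff C 0 (f u) = 0) ->
  forall n u, @prepend_diff X C f n.+1 (@prepend_diff X C f n u) = 0.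
Proof. by move=> hf [|n] u; [apply: hf | apply: cdiffK]. Qed.

Definition prepend (X : lmodType R) (C : complex R) (f : {linear X -> C 0%N}) (hf : forall u, cdiff C 0 (f u) = 0) : complex R :=
  Complex (@prepend_diffK X C f hf).

Lemma prepend_exact (X : lmodType R) (C : complex R) (f : {linear X -> C 0%N}) hf : complex_exact C ->
  (forall z, cdiff C 0 z = 0 -> exists u, z = f u) -> complex_exact (@prepend X C f hf).
Proof. by move=> hC h0 [|l] z /=; [apply: h0 | apply: hC]. Qed.

Definition killed_boundary (s : seq R) (C : complex R) n : C n -> Prop :=
  match n return C n -> Prop with
  | 0 => fun z => z = 0
  | n'.+1 => fun z => exists y : C n', (forall x, x \in s -> x *: y = 0) /\ z = cdiff C n' y
  end.

Variables (X : lmodType R) (L : complex R) (e : {linear X -> L 0%N}) (d : nat).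
Hypothesis de0 : forall u, cdiff L 0 (e u) = 0.
Hypothesis ker0 : forall z, cdiff L 0 z = 0 -> exists u, z = e u.
Hypothesis L_exact : complex_exact L.

(** The staircase leads from the top Koszul degree over [L 0] to the bottom one over [L d], where
    Koszul cocycles are the elements annihilated by [s]. Over [L 0] it is enough that the class of
    [c] itself bounds. *)
Lemma koszul_ascend s c : size s = d -> cdiff L 0 c = 0 ->
  (forall l k (u : koszul s (L l) k), (0 < k < d)%N -> cdiff (koszul s (L l)) k u = 0 ->
     is_boundary u) ->
  ((0 < d)%N -> is_boundary (koszul_top s d c)) ->
  exists z : L d, [/\ cdiff L d z = 0, forall x, x \in s -> x *: z = 0
    & zigzag (A := koszul_dcx s L) (l := d) (koszul_bot s z) (koszul_top s d c)].
Proof.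
move=> es dc hgood htop.
have [||||z [h1 h2 h3]] := @zigzag_backward R d (koszul_dcx s L) (koszul_top s d c).
- move=> k l ek z hz; apply: (hgood l.+1 k.+1) => //.
  by rewrite /= -ek addnS ltnS leq_addr.
- by case: (d) htop => //= d' h; apply: h.
- by rewrite /= koszul_top_map dc koszul_top0.
- by apply: koszul_above; rewrite es.
have [y ey] := koszul_bot_surj z; exists y; rewrite -ey; split=> //.
  apply: (@koszul_bot_inj _ s); rewrite koszul_bot0 -koszul_bot_map -ey; exact: h2.
by apply/koszul_bot_cocycle; rewrite -ey; exact: h3.
Qed.

(** Rescaling fixes the bottom of the staircase and multiplies its top by the second factors. As
    [a z] bounds inside the part annihilated by the products, the top becomes the Koszul boundary of
    a cochain with values in the kernel of [L 0 -> L 1], which comes from [X]. *)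
Lemma koszul_descend s ps c a (z : L d) : unzip1 ps = s -> size ps = d ->
  zigzag (A := koszul_dcx s L) (l := d) (koszul_bot s z) (koszul_top s d c) ->
  killed_boundary (prods ps) (a *: z) ->
  exists v : X, seq_module (prods ps) v /\ (a * \prod_(p <- ps) p.2) *: c = e v.
Proof.
move=> <- {s} sd hz hb.
have sd' : size (prods ps) = d by rewrite size_map.
have h1 := zigzag_map (A := koszul_dcx (unzip1 ps) L) (B := koszul_dcx (prods ps) L)
  (tau := fun k l => koszul_rescale ps (L l) k)
  (fun k l z => koszul_rescale_map (ps := ps) (cdiff L l) z)
  (fun k l z => cmap_diff (koszul_rescale ps (L l)) z) (zigzagZ a hz).
move: h1; rewrite /= !linearZ /= koszul_bot_rescale koszul_top_rescale -koszul_botZ => h1.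
have h2 : hor_boundary (A := koszul_dcx (prods ps) L) (koszul_bot (prods ps) (a *: z)).
  case: (d) z hb {hz h1} => [|d'] z /=; first by move=> ->; apply: koszul_bot0.
  move=> [y [hy ->]]; exists (koszul_bot _ y); rewrite koszul_bot_map; split=> //.
  exact/koszul_bot_cocycle.
have := zigzag_hor_boundary (@koszul_rows_exact (prods ps) L L_exact) h1 h2.
rewrite -[_ *: koszul_top _ _ _]subr0 -(koszul_top0 _ _ d) -koszul_topZB subr0 scalerA.
set c' := (_ * _) *: c; clear - sd' ker0 e de0.
(* [d] is the size of the list only up to a proved equation; stating the facts for every such [k]
   avoids casts. *)
have inj k : size (prods ps) = k -> injective (@koszul_top _ (prods ps) (L 0%N) k).
  by move=> <-; apply: koszul_top_inj.
have surj k : size (prods ps) = k -> forall u : koszul (prods ps) X k,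
    exists v, u = koszul_top (prods ps) k v.
  by move=> <-; apply: koszul_top_surj.
have bnd k : size (prods ps) = k -> forall v : X,
    is_boundary (koszul_top (prods ps) k v) -> seq_module (prods ps) v.
  by move=> <- v /koszul_top_boundary.
case: d sd' => [|d'] sd' h.
  exists 0; rewrite linear0; split.
    by apply: submodule0; apply: seq_module_submodule.
  by apply: (inj _ sd'); rewrite koszul_top0.
case: h => y [hy ey].
have [y' ey'] := koszul_map_exact (f := e) ker0 hy.
have [v ev] := surj _ sd' (cdiff (koszul (prods ps) X) d' y').
exists v; split; first by apply: (bnd _ sd'); exists y'.
by apply: (inj _ sd'); rewrite -koszul_top_map -ev cmap_diff -ey'.
Qed.

End KoszulDescent.

(** * Local duality for annihilators *)

Section Duality.
Variables (R : comNzRingType) (d : nat) (x : 'I_d -> R).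
Hypothesis hx : regular_system x.

Lemma seq_module_gen (X : lmodType R) (s : seq R) y (v : X) : y \in s -> seq_module s (y *: v).
Proof.
elim: s => //= z s IH; rewrite inE => /orP[/eqP ->|/IH h].
  exists v, 0; rewrite addr0; split=> //; apply: submodule0; exact: seq_module_submodule.
by exists 0, (y *: v); rewrite scaler0 add0r.
Qed.

Lemma seq_module_row n (s : seq R) (u : 'rV[R]_n) :
  seq_module s u <-> forall k, seq_module s (u 0 k : R^o).
Proof.
elim: s u => [|y s IH] u /=.
  by split=> [->|h] => [k|]; [rewrite mxE | apply/rowP => k; rewrite h mxE].
split=> [[v [w [/IH hw ->]]] k|h].
  by exists (v 0 k), (w 0 k); rewrite !mxE.
have [v hv] := choice h; have [w hw] := choice hv.
exists (\row_k v k), (\row_k w k); split.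
  by apply/IH => k; rewrite mxE; case: (hw k).
by apply/rowP => k; rewrite !mxE; case: (hw k).
Qed.

Definition powers (r : seq 'I_d) t : seq R := [seq x j ^+ t | j <- r].

Lemma seq_module_powers r t (y : R^o) :
  seq_module (powers r t) y <-> power_ideal x [set j in r] (fun=> t) y.
Proof.
split; last first.
  apply: power_ideal_min => [|i]; first exact: seq_module_submodule.
  rewrite inE => ir; rewrite -[x i ^+ t]mulr1; apply: (@seq_module_gen R^o).
  exact: map_f.
have hI (r' : seq 'I_d) : ideal_pred (power_ideal x [set j in r'] (fun=> t)) by apply: power_ideal_ideal.
elim: r y => [|j r IH] y; first by move=> ->; apply: (ideal0 (hI [::])).
move=> [v [w [/IH hw ->]]]; apply: (idealD (hI (j :: r))).
  apply: (@idealMr _ _ v _ (hI (j :: r))).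
  by apply: (power_ideal_gen x (fun=> t)); rewrite inE mem_head.
apply: power_ideal_min hw => // i; rewrite inE => ir.
by apply: (power_ideal_gen x (fun=> t)); rewrite !inE ir orbT.
Qed.

Lemma regular_on_row r t n : uniq r -> regular_on (powers r t) 'rV[R]_n.
Proof.
have [_ hp hn _] := hx; elim: r => //= j r IH /andP[jr ur]; split; first exact: IH.
move=> v /seq_module_row h; apply/seq_module_row => k.
apply/seq_module_powers; have := h k; rewrite mxE => /seq_module_powers.
by apply: (power_ideal_regular_pow hp hn); rewrite inE.
Qed.

Lemma divisible_on_injective r t (X : lmodType R) : injective_module X -> uniq r ->
  divisible_on (powers r t) X.
Proof.
have [_ hp hn _] := hx; move=> hX; elim: r => //= j r IH /andP[jr ur]; split; first exact: IH.
move=> v hv; pose S := power_ideal x [set j in r] (fun=> t).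
have [|||w [hw ew]] := @injective_divide R X S (x j ^+ t) v hX.
- exact: power_ideal_ideal.
- by move=> y; apply: (power_ideal_regular_pow hp hn); rewrite inE.
- move=> y [c ->]; rewrite scaler_suml big1 // => i; rewrite inE => ir.
  by rewrite -scalerA hv ?scaler0 //; apply: map_f.
exists w; split=> // y /mapP[i ir ->]; apply: hw.
by apply: (power_ideal_gen x (fun=> t)); rewrite inE.
Qed.

Let en := index_enum 'I_d.

Definition koszul_seq t : seq R := powers en t.

Lemma size_en : size en = d.
Proof.
rewrite -[RHS]size_enum_ord; apply: perm_size; apply: uniq_perm.
- exact: index_enum_uniq.
- exact: enum_uniq.
- by move=> j; rewrite mem_index_enum mem_enum.
Qed.

Lemma size_koszul_seq t : size (koszul_seq t) = d.
Proof. by rewrite size_map size_en. Qed.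

Lemma koszul_seqP t (y : R^o) : seq_module (koszul_seq t) y <-> param_ideal x t y.
Proof.
rewrite seq_module_powers; have -> // : [set j in en] = [set: 'I_d].
by apply/setP => j; rewrite !inE mem_index_enum.
Qed.

Definition koszul_pairs t t' := [seq (x j ^+ t, x j ^+ (t' - t)) | j <- en].

Lemma koszul_pairs1 t t' : unzip1 (koszul_pairs t t') = koszul_seq t.
Proof. by rewrite /unzip1 -map_comp. Qed.

Lemma koszul_pairs_prods t t' : (t <= t')%N -> prods (koszul_pairs t t') = koszul_seq t'.
Proof.
move=> tt; rewrite /prods -map_comp; apply: eq_map => j /=.
by rewrite -exprD subnKC.
Qed.

Lemma koszul_pairs_prod t t' : \prod_(p <- koszul_pairs t t') p.2 = monomial x (t' - t).
Proof. by rewrite /koszul_pairs big_map. Qed.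

(** What free and injective modules share: Koszul cohomology of the former sits in top degree, of
    the latter in degree 0. *)
Definition koszul_exact (X : lmodType R) : Prop :=
  forall t k (u : koszul (koszul_seq t) X k), (0 < k < d)%N ->
    cdiff (koszul (koszul_seq t) X) k u = 0 -> is_boundary u.

Lemma koszul_exact_row n : koszul_exact 'rV[R]_n.
Proof.
move=> t k u /andP[_ kd]; apply: koszul_regular; last by rewrite size_koszul_seq.
by apply: regular_on_row; apply: index_enum_uniq.
Qed.

Lemma koszul_exact_injective X : injective_module X -> koszul_exact X.
Proof.
move=> hX t [|k] u // _; apply: koszul_divisible.
by apply: divisible_on_injective => //; apply: index_enum_uniq.
Qed.

(* [a] annihilates the degree [n] cohomology of the torsion subcomplex. *)
Definition kills_torsion a (C : complex R) n : Prop :=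
  forall t (z : C n), cdiff C n z = 0 -> (forall j, x j ^+ t *: z = 0) ->
    exists t', (t <= t')%N /\ killed_boundary (koszul_seq t') (a *: z).

Variables (r : nat -> nat) (D : forall n, 'M[R]_(r n.+1, r n)) (E : complex R).
Hypothesis DD : forall n, D n.+1 *m D n = 0.
Hypothesis D_exact : forall n (u : 'rV_(r n.+1)), u *m D n = 0 -> exists v, u = v *m D n.+1.
Variable aug : {linear 'rV[R]_(r 0%N) -> E 0%N}.
Hypothesis aug_diff : forall u, cdiff E 0 (aug u) = 0.
Hypothesis aug_surj : forall z, cdiff E 0 z = 0 -> exists u, z = aug u.
Hypothesis aug_ker : forall u, aug u = 0 <-> exists v, u = v *m D 0%N.
Hypothesis E_exact : complex_exact E.
Hypothesis E_injective : forall n, injective_module (E n).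

Definition row_condition i t : 'rV[R]_(r i) -> Prop :=
  match i return 'rV[R]_(r i) -> Prop with
  | 0 => fun=> True
  | i'.+1 => fun g => forall k, param_ideal x t ((g *m D i') 0 k)
  end.

(* The complex [R^(r (i-1)) -> ... -> R^(r 0) -> E 0 -> E 1 -> ...] obtained by
   splicing the free resolution with the injective one. *)
Record spliced a i := Spliced {
  sp_complex : complex R;
  sp_map : {linear 'rV[R]_(r i) -> sp_complex 0%N};
  sp_exact : complex_exact sp_complex;
  sp_diff : forall u, cdiff sp_complex 0 (sp_map u) = 0;
  sp_surj : forall z, cdiff sp_complex 0 z = 0 -> exists u, z = sp_map u;
  sp_ker : forall u, sp_map u = 0 <-> exists v, u = v *m D i;
  sp_koszul : forall l, koszul_exact (sp_complex l);
  sp_kills : forall j, kills_torsion a E j -> kills_torsion a sp_complex (i + j);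
  sp_kills0 : (0 < d)%N -> forall l, (l < i)%N -> kills_torsion a sp_complex l;
  sp_top : forall t g, row_condition t g -> (0 < d)%N ->
    is_boundary (koszul_top (koszul_seq t) d (sp_map g))
}.

Lemma row_torsion_free n t (z : 'rV[R]_n) : (0 < d)%N -> (forall j, x j ^+ t *: z = 0) -> z = 0.
Proof.
move=> d0 hz; have [_ hp _ _] := hx; pose j : 'I_d := Ordinal d0.
have hn := (let: And4 _ _ h _ := hx in h).
apply/rowP => k; rewrite mxE.
(* The ideal of the empty set is zero, so regularity modulo it says that [x j] is a
   nonzerodivisor. *)
have : power_ideal x set0 (fun=> 0%N) (x j ^+ t * z 0 k).
  by have /rowP/(_ k) := hz j; rewrite !mxE => ->; apply: ideal0; apply: power_ideal_ideal.
have jn : j \notin set0 by rewrite inE.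
move=> /(power_ideal_regular_pow hp hn jn)[c ->].
by rewrite big1 // => i; rewrite inE.
Qed.

Lemma splice a i : spliced a i.
Proof.
elim: i => [|i [C e C_exact e_diff e_surj e_ker C_koszul C_kills C_kills0 C_top]].
  apply: (@Spliced a 0 E aug) => //.
    by move=> l; apply: koszul_exact_injective.
  move=> t g _ d0; case ed: d d0 => [//|d'] _.
  apply: koszul_divisible; last by apply: koszul_above; rewrite size_koszul_seq ed.
  by apply: divisible_on_injective => //; apply: index_enum_uniq.
have lD : linear (fun u : 'rV[R]_(r i.+1) => u *m D i).
  by move=> b u v; rewrite mulmxDl scalemxAl.
apply: (@Spliced a i.+1 (prepend e_diff) (linear_of lD)).
- exact: prepend_exact.
- by move=> u /=; apply/e_ker; exists u.
- by move=> z /= /e_ker.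
- move=> u /=; split=> [/D_exact //|[v ->]].
  by rewrite -mulmxA DD mulmx0.
- by case=> [|l] /=; [apply: koszul_exact_row | apply: C_koszul].
- move=> j hj; rewrite addSn => t z hz1 hz2; have [t' [tt hb]] := C_kills j hj t z hz1 hz2.
  exists t'; split=> //; case: (i + j)%N z hb {hz1 hz2} => [|n] z //= ->.
  by exists 0; rewrite linear0; split=> // y _; rewrite scaler0.
- move=> d0 [|l] li t z hz1 hz2.
    exists t; split=> //=; rewrite (row_torsion_free d0 hz2); exact: scaler0.
  have [t' [tt hb]] := C_kills0 d0 l li t z hz1 hz2.
  exists t'; split=> //; case: l z hb {hz1 hz2 li} => [|n] z //= ->.
  by exists 0; rewrite linear0; split=> // y _; rewrite scaler0.
- move=> t g hg _; rewrite -(size_koszul_seq t); apply/koszul_top_boundary.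
  by apply/seq_module_row => k; apply/koszul_seqP; apply: hg.
Qed.

(** In the spliced complex the class of [g] climbs to degree [d], which is [E (d - i)] or, for
    [i > d], a free module; there [a] kills torsion. Descending again puts [a * monomial x (t' - t)]
    times [g] in [m^[t']] modulo the rows of [D i]. Pair with [f] and cancel the monomial. *)
Lemma dual_torsion i a (f : 'cV[R]_(r i)) t (g : 'rV[R]_(r i)) : D i *m f = 0 ->
  (forall j, (j + i)%N = d -> kills_torsion a E j) -> row_condition t g ->
  param_ideal x t (a * (g *m f) 0 0).
Proof.
move=> Df hkill hg; have [_ hp hn _] := hx.
have [C e C_exact e_diff e_surj e_ker C_koszul C_kills C_kills0 C_top] := splice a i.
(* For [d = 0 < i] the ideal is zero, so [g] is itself a relation, hence a combination of the rows
   of [D i]. *)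
case: (EM (i = 0%N \/ (0 < d)%N)) => [hid|]; last first.
  case: i f g Df hkill hg {e e_diff e_surj e_ker C_kills C_kills0 C_top} => [|i] f g Df _ hg hid.
    by case: hid; left.
  have -> : g *m f = 0; last by rewrite mxE mulr0; apply: ideal0; apply: param_ideal_ideal.
  have [|v ->] := D_exact (u := g); last by rewrite -mulmxA Df mulmx0.
  apply/rowP => k; rewrite [RHS]mxE; have [c ->] := hg k.
  by rewrite big1 // => j _; case: hid; right; case: (j) => /= m; case: (d).
have QC : kills_torsion a C d.
  case: (leqP i d) => [id|di].
    by rewrite -(subnKC id); apply: C_kills; apply: hkill; rewrite subnK.
  by apply: C_kills0 => //; case: hid => // i0; rewrite i0 in di.
have [|||z [hz1 hz2 hz3]] := @koszul_ascend R C d (koszul_seq t) (e g) (size_koszul_seq t).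
- exact: e_diff.
- by move=> l; apply: C_koszul.
- exact: C_top.
have [t' [tt hb]] := QC t z hz1 (fun j => hz2 _ (map_f _ (mem_index_enum j))).
rewrite -(koszul_pairs_prods tt) in hb.
have [|v [hv ev]] := @koszul_descend R _ C e d e_surj C_exact (koszul_seq t)
    (koszul_pairs t t') (e g) a z (koszul_pairs1 t t') _ hz3 hb.
  by rewrite size_map size_en.
have [v' ev'] : exists v', (a * monomial x (t' - t)) *: g - v = v' *m D i.
  by apply/e_ker; rewrite linearB linearZ /= -ev koszul_pairs_prod subrr.
rewrite (koszul_pairs_prods tt) in hv.
apply: (param_ideal_monomial hp hn (s := t' - t)); rewrite subnK //.
have -> : monomial x (t' - t) * (a * (g *m f) 0 0) = (v *m f) 0 0.
  have -> : v = (a * monomial x (t' - t)) *: g - v' *m D i by rewrite -ev' subKr.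
  by rewrite mulmxBl -mulmxA Df mulmx0 subr0 -scalemxAl !mxE; ring.
rewrite mxE; apply: ideal_sum => [|k _]; first exact: param_ideal_ideal.
rewrite mulrC; apply: idealM; first exact: param_ideal_ideal.
by apply/koszul_seqP; apply: (seq_module_row _ _).1.
Qed.

Lemma dual_annihilated0 a (f : 'cV[R]_(r 0%N)) : D 0%N *m f = 0 ->
  kills_torsion a E d -> a *: f = 0.
Proof.
move=> Df hkill; have [hN _ _ _] := hx.
apply/colP => k; rewrite !mxE.
apply: (@krull_intersection _ _ _ hx R^o (fun y => y = 0)) => //.
  by split=> // b u v -> ->; rewrite scaler0 addr0.
move=> t; exists 0, (a * f k 0); rewrite add0r; split=> //.
have := @dual_torsion 0 a f t (delta_mx 0 k) Df _ I; rewrite -rowE mxE.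
move=> /(_ _)/wrap[j|[c ->]]; first by rewrite addn0 => ->.
exists c; apply: eq_big => [j|j _]; first by rewrite inE.
exact: mulrC.
Qed.

(** By [dual_torsion] the functional [g D -> a g f] is well defined modulo every [m^[t]].
    Self-injectivity solves [a f = D w] modulo [m^[t]], and Krull's theorem, applied modulo the
    image of [D i], removes the error. *)
Lemma dual_annihilatedS i a (f : 'cV[R]_(r i.+1)) : D i.+1 *m f = 0 ->
  (forall j, (j + i.+1)%N = d -> kills_torsion a E j) ->
  exists w, a *: f = D i *m w.
Proof.
move=> Df hkill; have [hN _ _ _] := hx.
suff [w ew] : exists w, (a *: f)^T = (D i *m w)^T by exists w; apply: trmx_inj.
apply: (@krull_intersection _ _ _ hx 'rV[R]_(r i.+1) (fun y => exists w, y = (D i *m w)^T)).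
- exact: noetherian_row.
- split=> [|b u v [w ->] [w' ->]]; first by exists 0; rewrite mulmx0 trmx0.
  by exists (b *: w + w'); rewrite mulmxDr -scalemxAr linearP.
move=> t; have [|w hw] := @self_injective _ _ _ hx t.+1 (r i) isT (r i.+1) (D i) (a *: f).
  by move=> g hg; rewrite -scalemxAr mxE; apply: dual_torsion.
exists (D i *m w)^T, (a *: f - D i *m w)^T; split; first by exists w.
  have [c hc] := choice (fun k => param_ideal_le (leqnSn t) (hw k)).
  exists (fun j => \row_k c k j); apply/rowP => k; rewrite mxE hc summxE.
  by apply: eq_big => [j|j _]; rewrite ?inE // !mxE mulrC.
by rewrite linearB addrC subrK.
Qed.

End Duality.

(** * Free resolutions by matrices *)

Section FreeResolution.
Variable R : comNzRingType.
Hypothesis hR : noetherian_module R^o.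

Lemma syzygies n k (A : 'M[R]_(n, k)) : exists B : {l : nat & 'M[R]_(l, n)},
  projT2 B *m A = 0 /\ forall u : 'rV_n, u *m A = 0 -> exists v, u = v *m projT2 B.
Proof.
have hP : submodule (fun u : 'rV[R]_n => u *m A = 0).
  split=> [|a u v hu hv]; first by rewrite mul0mx.
  by rewrite mulmxDl -scalemxAl hu hv scaler0 addr0.
have [l [g eg]] := noetherian_row hR hP.
exists (existT _ l (\matrix_i g i)) => /=; split.
  apply/row_matrixP => i; rewrite row_mul rowK row0.
  by have := spanned_gen g i; rewrite -eg.
move=> u hu; have : spanned g u by rewrite -eg.
move=> [c ->]; exists (\row_i c i); rewrite mulmx_sum_row.
by apply: eq_bigr => i _; rewrite rowK mxE.
Qed.

Record some_matrix := SomeMatrix { sm_rows : nat; sm_cols : nat; sm_mx : 'M[R]_(sm_rows, sm_cols) }.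

Lemma free_resolution n (A : 'M[R]_(n, 1)) :
  exists (r : nat -> nat) (D0 : 'M[R]_(r 0%N, 1)) (D : forall k, 'M[R]_(r k.+1, r k)),
  [/\ forall y, entry_ideal D0 y <-> entry_ideal A y,
      D 0%N *m D0 = 0, forall u : 'rV_(r 0%N), u *m D0 = 0 -> exists v, u = v *m D 0%N,
      forall k, D k.+1 *m D k = 0
    & forall k (u : 'rV_(r k.+1)), u *m D k = 0 -> exists v, u = v *m D k.+1].
Proof.
pose syz (M : some_matrix) := sval (cid (syzygies (sm_mx M))).
have hsyz M := svalP (cid (syzygies (sm_mx M))).
pose next M := SomeMatrix (projT2 (syz M)).
pose M k := iter k next (SomeMatrix A).
exists (fun k => sm_rows (M k)), A, (fun k => sm_mx (M k.+1)); split=> //.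
- exact: (hsyz (M 0%N)).1.
- exact: (hsyz (M 0%N)).2.
- by move=> k; apply: (hsyz (M k.+1)).1.
- by move=> k; apply: (hsyz (M k.+1)).2.
Qed.

End FreeResolution.

(** * The double complex of maps from a free to an injective resolution *)

Section HomComplex.
Variables (R : comNzRingType) (r : nat -> nat) (D : forall n, 'M[R]_(r n.+1, r n)).
Hypothesis DD : forall n, D n.+1 *m D n = 0.
Variable F : complex R.

Definition hom_post k l (h : {ffun 'I_(r k) -> F l}) : {ffun 'I_(r k) -> F l.+1} :=
  [ffun a => cdiff F l (h a)].

Lemma hom_post_linear k l : linear (@hom_post k l).
Proof. by move=> a u v; apply/ffunP => i; rewrite !ffunE linearP. Qed.

Definition hom_pre k l (h : {ffun 'I_(r k) -> F l}) : {ffun 'I_(r k.+1) -> F l} :=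
  [ffun a => \sum_b D k a b *: h b].

Lemma hom_pre_linear k l : linear (@hom_pre k l).
Proof.
move=> a u v; apply/ffunP => i; rewrite !ffunE scaler_sumr -big_split /=.
by apply: eq_bigr => b _; rewrite !ffunE scalerDr !scalerA (mulrC a).
Qed.

Lemma hom_postK k l (h : {ffun 'I_(r k) -> F l}) : hom_post (hom_post h) = 0.
Proof. by apply/ffunP => i; rewrite !ffunE cdiffK. Qed.

Lemma matrix_sum_scale (X : lmodType R) m n q (A : 'M[R]_(m, n)) (B : 'M[R]_(n, q))
    (h : 'I_q -> X) i :
  \sum_b A i b *: (\sum_c B b c *: h c) = \sum_c (A *m B) i c *: h c.
Proof.
under eq_bigr => b _ do rewrite scaler_sumr.
rewrite exchange_big /=; apply: eq_bigr => c _; rewrite mxE scaler_suml.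
by apply: eq_bigr => b _; rewrite scalerA.
Qed.

Lemma hom_preK k l (h : {ffun 'I_(r k) -> F l}) : hom_pre (hom_pre h) = 0.
Proof.
apply/ffunP => i; rewrite !ffunE; under eq_bigr => b _ do rewrite ffunE.
by rewrite matrix_sum_scale DD big1 // => c _; rewrite mxE scale0r.
Qed.

Lemma hom_post_pre k l (h : {ffun 'I_(r k) -> F l}) :
  hom_post (hom_pre h) = hom_pre (hom_post h).
Proof.
apply/ffunP => i; rewrite !ffunE linear_sum; apply: eq_bigr => b _.
by rewrite ffunE linearZ.
Qed.

Definition hom_dcx : dcx R :=
  @Dcx R (fun k l => {ffun 'I_(r k) -> F l})
    (fun k l => linear_of (@hom_post_linear k l)) (fun k l => linear_of (@hom_pre_linear k l))
    hom_postK hom_preK hom_post_pre.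

Lemma hom_rows_exact : complex_exact F -> rows_exact hom_dcx.
Proof.
move=> hF k l z hz.
have h a : exists w, z a = cdiff F l w.
  by apply: hF; have /ffunP/(_ a) := hz; rewrite !ffunE.
have [w hw] := choice h; exists [ffun a => w a].
by apply/ffunP => a; rewrite !ffunE hw.
Qed.

Lemma hom_columns_exact :
  (forall n (u : 'rV_(r n.+1)), u *m D n = 0 -> exists v, u = v *m D n.+1) ->
  (forall l, injective_module (F l)) -> columns_exact hom_dcx.
Proof.
move=> hD hF k l z hz.
have lf : linear (fun u : 'rV[R]_(r k.+1) => u *m D k).
  by move=> a u v; rewrite mulmxDl scalemxAl.
have lh : linear (fun u : 'rV[R]_(r k.+1) => \sum_b u 0 b *: z b).
  move=> a u v; rewrite scaler_sumr -big_split /=; apply: eq_bigr => b _.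
  by rewrite !mxE scalerDl scalerA.
have [|g hg] := @injective_factor _ _ _ (F l) (linear_of lf) (linear_of lh) (hF l).
  move=> u /hD[v ->] /=; rewrite -matrix_sum_scale big1 // => a _.
  by have /ffunP/(_ a) := hz; rewrite !ffunE => ->; rewrite scaler0.
exists [ffun c => g (delta_mx 0 c)]; apply/ffunP => b; rewrite !ffunE.
have := hg (delta_mx 0 b); rewrite /= -rowE (bigD1 b) //= [X in _ = _ + X]big1 ?addr0 => [|b' hb].
  rewrite mxE !eqxx scale1r => <-; rewrite [X in g X]row_sum_delta linear_sum.
  by apply: eq_bigr => c _; rewrite linearZ ffunE /= mxE.
by rewrite mxE (negPf hb) andbF scale0r.
Qed.

End HomComplex.

(** * Two computations of Ext *)

Section Comparison.
Variables (R : comNzRingType) (r : nat -> nat) (D0 : 'M[R]_(r 0%N, 1)).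
Variable D : forall n, 'M[R]_(r n.+1, r n).
Hypothesis DD0 : D 0%N *m D0 = 0.
Hypothesis D_exact0 : forall u : 'rV_(r 0%N), u *m D0 = 0 -> exists v, u = v *m D 0%N.
Hypothesis DD : forall n, D n.+1 *m D n = 0.
Hypothesis D_exact : forall n (u : 'rV_(r n.+1)), u *m D n = 0 -> exists v, u = v *m D n.+1.
Variable F : injective_resolution R^o.

(** The [D n] resolve the ideal generated by [D0]; prefixing [D0] resolves the quotient ring, with
    [R] in degree 0. Row 0 of the double complex is then [F], and its vertical kernel the part of
    [F] annihilated by the ideal. *)
Definition aug_rank n := if n is n'.+1 then r n' else 1%N.

Definition aug_mx n : 'M[R]_(aug_rank n.+1, aug_rank n) :=
  match n with 0 => D0 | n'.+1 => D n' end.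

Lemma aug_mxK n : aug_mx n.+1 *m aug_mx n = 0.
Proof. by case: n. Qed.

Lemma aug_mx_exact n (u : 'rV_(aug_rank n.+1)) : u *m aug_mx n = 0 ->
  exists v, u = v *m aug_mx n.+1.
Proof. by case: n u. Qed.

Lemma resolution_exact : complex_exact F.
Proof. by move=> l z /res_exactS. Qed.

Let A := hom_dcx aug_mxK F.

Lemma A_rows : rows_exact A.
Proof. exact: hom_rows_exact resolution_exact. Qed.

Lemma A_columns : columns_exact A.
Proof. by apply: hom_columns_exact; [exact: aug_mx_exact | exact: res_injective]. Qed.

Definition hom_of_elt l (z : F l) : A 0%N l := [ffun=> z].

Definition hom_of_col k (f : 'cV[R]_(aug_rank k)) : A k 0%N := [ffun a => res_aug F (f a 0)].

(** On cocycles modulo boundaries, the graph of the isomorphism between Ext computed from [F] and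
    Ext computed from [D]. *)
Definition ext_class i (z : F i) (f : 'cV[R]_(aug_rank i)) : Prop :=
  zigzag (hom_of_elt z) (hom_of_col f).

Definition killed_by_D0 l (z : F l) : Prop := forall a, D0 a 0 *: z = 0.

Definition elt_boundary i : F i -> Prop :=
  match i return F i -> Prop with
  | 0 => fun z => z = 0
  | i'.+1 => fun z => exists y : F i', killed_by_D0 y /\ z = cdiff F i' y
  end.

Definition col_boundary i : 'cV[R]_(aug_rank i) -> Prop :=
  match i return 'cV[R]_(aug_rank i) -> Prop with
  | 0 => fun f => f = 0
  | i'.+1 => fun f => exists w, f = aug_mx i' *m w
  end.

Lemma hom_of_elt_ver l (z : F l) : ver A 0 l (hom_of_elt z) = 0 <-> killed_by_D0 z.
Proof.
split=> [/ffunP h a|h].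
  by have := h a; rewrite !ffunE big_ord1 ffunE.
by apply/ffunP => a; rewrite !ffunE big_ord1 ffunE h.
Qed.

Lemma hom_of_elt_hor l (z : F l) : hor A 0 l (hom_of_elt z) = hom_of_elt (cdiff F l z).
Proof. by apply/ffunP => a; rewrite !ffunE. Qed.

Lemma hom_of_elt_inj l (z z' : F l) : hom_of_elt z = hom_of_elt z' -> z = z'.
Proof. by move=> /ffunP/(_ 0); rewrite !ffunE. Qed.

Lemma hom_of_elt_surj l (z : A 0%N l) : exists z', z = hom_of_elt z'.
Proof. by exists (z 0); apply/ffunP => a; rewrite ffunE (ord1 a). Qed.

Lemma hom_of_elt_linear l a (z z' : F l) :
  hom_of_elt (a *: z + z') = a *: hom_of_elt z + hom_of_elt z'.
Proof. by apply/ffunP => i; rewrite !ffunE. Qed.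

Lemma hom_of_col_linear k a (f f' : 'cV_(aug_rank k)) :
  hom_of_col (a *: f + f') = a *: hom_of_col f + hom_of_col f'.
Proof. by apply/ffunP => i; rewrite !ffunE !mxE linearP. Qed.

Lemma hom_of_col_inj k : injective (@hom_of_col k).
Proof.
move=> f f' /ffunP h; apply/colP => a; apply: (@res_aug_inj _ _ F).
by have := h a; rewrite !ffunE.
Qed.

Lemma hom_of_col0 k : hom_of_col (0 : 'cV_(aug_rank k)) = 0.
Proof. by apply/ffunP => a; rewrite !ffunE mxE linear0. Qed.

Lemma hom_of_elt0 l : hom_of_elt (0 : F l) = 0.
Proof. by apply/ffunP => a; rewrite !ffunE. Qed.

Lemma hom_of_col_ver k (f : 'cV_(aug_rank k)) :
  ver A k 0 (hom_of_col f) = hom_of_col (aug_mx k *m f).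
Proof.
apply/ffunP => a; rewrite !ffunE mxE linear_sum; apply: eq_bigr => b _.
by rewrite ffunE -linearZ.
Qed.

Lemma hom_of_col_hor k (f : A k 0%N) : hor A k 0 f = 0 <-> exists f', f = hom_of_col f'.
Proof.
split=> [/ffunP h|[f' ->]].
  have e a : exists u, f a = res_aug F u by apply/res_exact0; have := h a; rewrite !ffunE.
  have [u hu] := choice e; exists (\col_a u a).
  by apply/ffunP => a; rewrite ffunE mxE.
by apply/ffunP => a; rewrite !ffunE; apply/res_exact0; exists (f' a 0).
Qed.

Lemma ext_class_linear i a (z z' : F i) f f' :
  ext_class z f -> ext_class z' f' -> ext_class (a *: z + z') (a *: f + f').
Proof.
by move=> h h'; rewrite /ext_class hom_of_elt_linear hom_of_col_linear; apply: zigzag_linear.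
Qed.

Lemma ext_class_col i (z : F i) : cdiff F i z = 0 -> killed_by_D0 z ->
  exists f, aug_mx i *m f = 0 /\ ext_class z f.
Proof.
move=> dz kz; have [||f [h1 /hom_of_col_hor[f' ef] h3]] := zigzag_forward A_rows (z := hom_of_elt z).
- by rewrite hom_of_elt_hor dz hom_of_elt0.
- exact/hom_of_elt_ver.
exists f'; split; last by rewrite /ext_class -ef.
by apply: hom_of_col_inj; rewrite -hom_of_col_ver -ef h3 hom_of_col0.
Qed.

Lemma ext_class_elt i (f : 'cV_(aug_rank i)) : aug_mx i *m f = 0 ->
  exists z : F i, [/\ cdiff F i z = 0, killed_by_D0 z & ext_class z f].
Proof.
move=> hf.
have vf : ver A i 0 (hom_of_col f) = 0 by rewrite hom_of_col_ver hf hom_of_col0.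
have [||||z [h1 h2 h3]] := @zigzag_backward R i A (hom_of_col f).
- by move=> k l _; apply: A_columns.
- by case: i f hf vf => //= i f _; apply: A_columns.
- by apply/hom_of_col_hor; exists f.
- exact: vf.
have [z' ez] := hom_of_elt_surj z; exists z'; split.
- by apply: hom_of_elt_inj; rewrite -hom_of_elt_hor -ez h2 hom_of_elt0.
- by apply/hom_of_elt_ver; rewrite -ez.
- by rewrite /ext_class -ez.
Qed.

Lemma ext_class_elt_boundary i (z : F i) f : ext_class z f -> elt_boundary z -> col_boundary f.
Proof.
move=> hz hb; have : ver_boundary (hom_of_col f).
  apply: zigzag_hor_boundary A_rows hz _.
  case: i z {f} hb => [|i] z /=; first by move=> ->; apply: hom_of_elt0.
  move=> [y [ky ->]]; exists (hom_of_elt y); split.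
    exact: (hom_of_elt_ver y).2.
  exact: (esym (hom_of_elt_hor y)).
case: i f {z hz hb} => [|i] f /=.
  by move=> h; apply: (@hom_of_col_inj 0); apply: etrans h (esym (hom_of_col0 0)).
move=> [y [/hom_of_col_hor[w ->] ef]]; exists w; apply: (@hom_of_col_inj i.+1).
exact: etrans ef (hom_of_col_ver w).
Qed.

Lemma ext_class_col_boundary i (z : F i) f : ext_class z f -> col_boundary f -> elt_boundary z.
Proof.
move=> hz hb; have : hor_boundary (hom_of_elt z).
  apply: zigzag_ver_boundary A_columns hz _.
  case: i f {z} hb => [|i] f /=; first by move=> ->; exact: (hom_of_col0 0).
  move=> [w ->]; exists (@hom_of_col i w); split.
    by apply: (hom_of_col_hor _).2; exists w.
  exact: (esym (@hom_of_col_ver i w)).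
case: i z {f hz hb} => [|i] z /=.
  by move=> h; apply: hom_of_elt_inj; apply: etrans h (esym (hom_of_elt0 0)).
move=> [y [hy ez]]; have [w ew] := hom_of_elt_surj y; rewrite ew in hy ez.
exists w; split; first exact: (hom_of_elt_ver w).1.
by apply: hom_of_elt_inj; exact: etrans ez (hom_of_elt_hor w).
Qed.

End Comparison.

(** * Division in a Frobenius pullback *)

Section FrobeniusDivision.
Variables (R : comNzRingType) (d : nat) (x : 'I_d -> R).
Hypothesis hx : regular_system x.

Section OnePower.
Variables (phi : {rmorphism R -> R}) (q : nat).
Hypothesis q_gt0 : (0 < q)%N.
Hypothesis phiE : forall y, phi y = y ^+ q.

Local Notation "A ^phi" := (map_mx phi A) (at level 2, format "A ^phi").

Let flat n k (A : 'M[R]_(n, k)) (v : 'rV[R]_n) : v *m A^phi = 0 ->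
    exists l (W : 'M[R]_(l, n)) (c : 'rV_l), W *m A = 0 /\ v = c *m W^phi.
Proof. exact: (frobenius_flat hx q_gt0 (fun i => phiE (x i))). Qed.

Lemma phi_param a : param_ideal x 1 a -> param_ideal x q (phi a).
Proof.
apply: (@param_ideal_min _ _ _ _ (fun a => param_ideal x q (phi a))).
  split=> [|b y z hy hz]; first by rewrite rmorph0; apply: ideal0; apply: param_ideal_ideal.
  by rewrite rmorphD rmorphM; apply: (param_ideal_ideal x q).2.
by move=> i; rewrite expr1 phiE; apply: param_ideal_gen.
Qed.

(** The image in [R^n] of the Frobenius pullback of [P]. *)
Definition phi_span n (P : 'rV[R]_n -> Prop) (u : 'rV[R]_n) : Prop :=
  exists l (W : 'M[R]_(l, n)) (c : 'rV_l), (forall i, P (row i W)) /\ u = c *m W^phi.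

Lemma row_mul_submodule n l l' (P : 'rV[R]_n -> Prop) (V : 'M[R]_(l', l)) (W : 'M[R]_(l, n)) i :
  submodule P -> (forall j, P (row j W)) -> P (row i (V *m W)).
Proof.
move=> hP hW; rewrite row_mul mulmx_sum_row; apply: submodule_sum => // j _.
exact: submoduleZ.
Qed.

(** Flatness makes pullback commute with colons: a relation between [phi(a W)] and [phi(B)] comes
    from relations over [R], whose components give the required vectors. *)
Lemma phi_span_colon n k (P : 'rV[R]_n -> Prop) (B : 'M[R]_(k, n)) a u : submodule P ->
  phi_span P u -> (exists g, phi a *: u = g *m B^phi) ->
  phi_span (fun v => P v /\ exists g, a *: v = g *m B) u.
Proof.
move=> hP [l [W [c [hW eu]]]] [g eg].
have [|l' [V [c' [hV ec]]]] := @flat _ _ (col_mx (a *: W) (- B)) (row_mx c g).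
  rewrite map_col_mx mul_row_col map_mxZ map_mxN mulmxN -scalemxAr -eu eg.
  by rewrite subrr.
move: hV ec; rewrite -(hsubmxK V) mul_row_col map_row_mx mul_mx_row.
move=> /eqP; rewrite mulmxN subr_eq0 => /eqP hV /eq_row_mx[ec _].
exists l', (lsubmx V *m W), c'; split; last by rewrite eu ec map_mxM mulmxA.
move=> i; split; first exact: row_mul_submodule.
exists (row i (rsubmx V)); rewrite -row_mul -hV -scalemxAr.
by apply/rowP => j; rewrite !mxE.
Qed.

(** The kernel of [K] modulo the rows of [B] presents the module, and the vectors [v] represent its
    socle; the colons are imposed one variable at a time. *)
Lemma phi_span_socle n k l (K : 'M[R]_(n, l)) (B : 'M[R]_(k, n)) (u : 'rV[R]_n) :
  u *m K^phi = 0 -> (forall j, exists g, x j ^+ q *: u = g *m B^phi) ->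
  phi_span (fun v => v *m K = 0 /\ forall j, exists g, x j *: v = g *m B) u.
Proof.
move=> hu hB.
suff h (r : seq 'I_d) : phi_span (fun v => v *m K = 0 /\
    forall j, j \in r -> exists g, x j *: v = g *m B) u.
  have [m [W [c [hW ->]]]] := h (index_enum 'I_d).
  exists m, W, c; split=> // i; have [h1 h2] := hW i; split=> // j.
  by apply: h2; rewrite mem_index_enum.
elim: r => [|j r IH].
  have [m [W [c [hW ->]]]] := flat hu.
  by exists m, W, c; split=> // i; rewrite -row_mul hW row0.
have [||m [W [c [hW ->]]]] := @phi_span_colon _ _ _ B (x j) u _ IH.
- split=> [|a v w [hv hv'] [hw hw']].
    by rewrite mul0mx; split=> // i _; exists 0; rewrite scaler0 mul0mx.
  rewrite mulmxDl -scalemxAl hv hw scaler0 addr0; split=> // i ir.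
  have [g eg] := hv' i ir; have [g' eg'] := hw' i ir.
  exists (a *: g + g'); rewrite mulmxDl -scalemxAl -eg -eg' scalerDr !scalerA.
  by rewrite (mulrC a).
- by have [g eg] := hB j; exists g; rewrite phiE.
exists m, W, c; split=> // i; have [[h1 h2] h3] := hW i; split=> // i'.
by rewrite inE => /orP[/eqP ->|/h2].
Qed.

Lemma mulmx_row'_col' n l (c : 'rV[R]_l.+1) (W : 'M[R]_(l.+1, n)) k :
  c *m W = c 0 k *: row k W + col' k c *m row' k W.
Proof.
apply/rowP => j; rewrite !mxE (bigD1_ord k) //=; congr (_ + _).
by apply: eq_bigr => i _; rewrite !mxE.
Qed.

(* In a shortest expression the relations modulo [B] have coefficients in the
   maximal ideal. *)
Lemma shortest_expression n k (P : 'rV[R]_n -> Prop) (B : 'M[R]_(k, n)) (u : 'rV[R]_n) :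
  phi_span P u -> exists l (W : 'M[R]_(l, n)) (c : 'rV_l) (e : 'rV_k),
    [/\ forall i, P (row i W), u = c *m W^phi + e *m B^phi &
        forall v : 'rV_l, (exists g, v *m W = g *m B) -> forall i, param_ideal x 1 (v 0 i)].
Proof.
pose expr l := exists (W : 'M[R]_(l, n)) (c : 'rV_l) (e : 'rV_k),
  (forall i, P (row i W)) /\ u = c *m W^phi + e *m B^phi.
move=> [l [W [c [hW eu]]]]; have : expr l.
  by exists W, c, 0; rewrite mul0mx addr0.
move: l {W c hW eu} (n in expr n) => _ l0 h0.
have [l hl hmin] : exists2 l, expr l & forall l', expr l' -> (l <= l')%N.
  have hex : exists l, `[< expr l >] by exists l0; apply/asboolP.
  exists (ex_minn hex); first by case: ex_minnP => l /asboolP.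
  by move=> l' h; case: ex_minnP => l _; apply; apply/asboolP.
move: hl => [W [c [e [hW eu]]]]; exists l, W, c, e; split=> // v [g eg] i.
apply: contrapT => nv; have [_ _ _ hunit] := hx.
have [b eb] := hunit _ nv.
case: l W c hW eu v eg i nv eb hmin => [|l] W c hW eu v eg i nv eb hmin; first by case: i nv eb.
suff : (l.+1 <= l)%N by rewrite ltnn.
(* A unit coefficient [v 0 i] expresses row [i] of [W] through the other rows modulo [B]; under
   [phi] this eliminates it from [u]. *)
apply: hmin; exists (row' i W), (col' i c - (c 0 i * phi b) *: (col' i v)^phi), (e + (c 0 i * phi b) *: g^phi).
split=> [j|].
  have -> : row j (row' i W) = row (lift i j) W by apply/rowP => j'; rewrite !mxE.
  exact: hW.
have erow : (row i W)^phi = phi b *: (g^phi *m B^phi) - phi b *: ((col' i v)^phi *m (row' i W)^phi).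
  have e1 : v 0 i *: row i W = g *m B - col' i v *m row' i W.
    by rewrite -eg (mulmx_row'_col' v W i) addrK.
  have -> : row i W = b *: (g *m B - col' i v *m row' i W).
    by rewrite -e1 scalerA mulrC eb scale1r.
  by rewrite map_mxZ map_mxB !map_mxM scalerBr.
rewrite eu (mulmx_row'_col' c _ i) -map_row erow.
have -> : row' i W^phi = (row' i W)^phi by apply/matrixP => a j; rewrite !mxE.
rewrite mulmxBl mulmxDl -!scalemxAl scalerBr !scalerA.
rewrite -[LHS]addrA [LHS]addrACA (addrC (e *m _)) [RHS]addrACA; congr (_ + _).
exact: addrC.
Qed.

Lemma frobenius_divide n k l (K : 'M[R]_(n, l)) (B : 'M[R]_(k, n)) (u : 'rV[R]_n) q0 y :
  (q0 <= q)%N -> u *m K^phi = 0 -> (forall j, exists g, x j ^+ q0 *: u = g *m B^phi) ->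
  (exists h, param_ideal x q (monomial x (q - q0) - y * h)) ->
  exists u' g, u' *m K^phi = 0 /\ u = y *: u' + g *m B^phi.
Proof.
move=> q0q hu hB [h hh]; have [_ hp hn hunit] := hx.
have iq : ideal_pred (param_ideal x q) by apply: param_ideal_ideal.
have [|m [W [c [e [hW eu hv]]]]] := shortest_expression B (phi_span_socle hu (B := B) _).
  move=> j; have [g eg] := hB j; exists (x j ^+ (q - q0) *: g).
  by rewrite -scalemxAl -eg scalerA -exprD subnK.
(* By flatness [x_j^q0 c] is a combination of images under [phi] of relations modulo [B] between the
   rows of [W]. Their coefficients lie in the maximal ideal, which [phi] sends into [m^[q]]. *)
have hc j i : param_ideal x q (x j ^+ q0 * c 0 i).
  have [g eg] := hB j.
  have [|l' [V [c' [hV ec]]]] := @flat _ _ (col_mx W B) (row_mx (x j ^+ q0 *: c) (x j ^+ q0 *: e - g)).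
    rewrite map_col_mx mul_row_col mulmxBl -!scalemxAl -eg eu scalerDr.
    by rewrite addrA subrr.
  move: hV ec; rewrite -(hsubmxK V) mul_row_col map_row_mx mul_mx_row.
  move=> /eqP; rewrite addr_eq0 => /eqP hV /eq_row_mx[/rowP/(_ i) ec _].
  move: ec; rewrite [LHS]mxE => ->; rewrite mxE; apply: ideal_sum => // s _.
  rewrite mxE; apply: idealM => //; apply: phi_param.
  have := hv (row s (lsubmx V)) _ i; rewrite [row s _ 0 i]mxE; apply.
  exists (- row s (rsubmx V)); rewrite -row_mul hV mulNmx -row_mul.
  by apply/rowP => t; rewrite !mxE.
have hc2 i : exists s, param_ideal x q (c 0 i - s * monomial x (q - q0)).
  exact: (param_ideal_colon hp hn (a := fun=> q0) (fun _ => q0q) (fun j => hc j i)).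
have [s hs] := choice hc2.
have hc3 i : exists b : 'I_d -> R, c 0 i = y * (s i * h) + \sum_j b j * x j ^+ q.
  have [b eb] : param_ideal x q (c 0 i - y * (s i * h)).
    have -> : c 0 i - y * (s i * h) =
       (c 0 i - s i * monomial x (q - q0)) + s i * (monomial x (q - q0) - y * h) by ring.
    by apply: idealD => //; apply: idealM.
  exists b; apply/eqP; rewrite addrC -subr_eq eb; apply/eqP.
  by apply: eq_bigl => j; rewrite inE.
have [b hb] := choice hc3.
(* This absorbs the part of [c] in [m^[q]]: [x_j^q phi(W)] is [phi(x_j W)], which lies in the row
   space of [phi(B)]. *)
have hW2 j : exists g, x j *: W = g *m B.
  have [g hg] := choice (fun i => (hW i).2 j); exists (\matrix_i g i).
  by apply/row_matrixP => i; rewrite row_mul rowK -hg; apply/rowP => t; rewrite !mxE.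
have [G hG] := choice hW2.
exists ((\row_i (s i * h)) *m W^phi), (\sum_j (\row_i b i j) *m (G j)^phi + e); split.
  rewrite -mulmxA -map_mxM; have -> : W *m K = 0; last by rewrite map_mx0 mulmx0.
  by apply/row_matrixP => i; rewrite row_mul row0 (hW i).1.
rewrite eu mulmxDl addrA; congr (_ + _).
rewrite mulmx_suml.
under eq_bigr => j _ do rewrite -mulmxA -map_mxM -hG map_mxZ -scalemxAr scalemxAl phiE.
rewrite -mulmx_suml scalemxAl -mulmxDl; congr (_ *m _).
apply/rowP => i; rewrite !mxE hb summxE; congr (_ + _).
by apply: eq_bigr => j _; rewrite !mxE mulrC.
Qed.

(** As [phi y] is a multiple of [y], also [c * phi y] lies in [m^[q1 q]]. By flatness [c] is a
    combination of elements [phi b] with [b y] in [m^[q1]]; since [y] is not there, no such [b] is a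
    unit. *)
Lemma param_colon_small q1 y c : ~ param_ideal x q1 y -> param_ideal x (q1 * q) (c * y) ->
  param_ideal x q c.
Proof.
move=> ny hc; have iq := param_ideal_ideal x.
have [s es] : param_ideal x (q1 * q) (c * phi y).
  have -> : phi y = y * y ^+ q.-1 by rewrite phiE -exprS prednK.
  by rewrite mulrA mulrC; apply: idealM; [exact: iq | exact: hc].
have [|l [W [c' [hW ec]]]] := @flat _ _ (col_mx y%:M (\col_j x j ^+ q1)) (row_mx c%:M (- \row_j s j)).
  rewrite map_col_mx mul_row_col map_scalar_mx -scalar_mxM es mulNmx.
  apply/eqP; rewrite subr_eq0; apply/eqP/matrixP => i i'; rewrite (ord1 i) (ord1 i') !mxE mulr1n.
  by apply: eq_big => [j|j _]; rewrite ?inE // !mxE phiE exprM.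
move: hW ec; rewrite -(hsubmxK W) mul_row_col map_row_mx mul_mx_row.
move=> /eqP; rewrite addr_eq0 => /eqP hW /eq_row_mx[/rowP/(_ 0) ec _].
move: ec; rewrite [LHS]mxE mulr1n => ->; rewrite mxE; apply: ideal_sum => [|i _]; first exact: iq.
rewrite mxE; apply: idealM; first exact: iq.
apply: phi_param; apply: contrapT => nV; have [_ _ _ hunit] := hx; have [b eb] := hunit _ nV.
apply: ny; have -> : y = b * (lsubmx W i 0 * y) by rewrite mulrA (mulrC b) eb mul1r.
apply: idealM; first exact: iq.
have /colP/(_ i) := hW; rewrite mul_mx_scalar [LHS]mxE mulrC => ->.
rewrite !mxE; apply: idealN; first exact: iq.
apply: ideal_sum => [|j _]; first exact: iq.
by rewrite !mxE; apply: idealM; [exact: iq | exact: param_ideal_gen].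
Qed.

(** In a self-injective ring a principal ideal contains whatever its annihilator kills. Modulo
    [m^[N]] the annihilator of [y] lies in [m^[q]], which kills the monomial of exponent [N - q]. *)
Lemma monomial_mem_principal q1 y : (0 < q1)%N -> ~ param_ideal x q1 y ->
  exists h, param_ideal x (q1 * q) (monomial x (q1 * q - q) - y * h).
Proof.
move=> q1_gt0 ny; set N := (q1 * q)%N.
have N_gt0 : (0 < N)%N by rewrite muln_gt0 q1_gt0.
have qN : (q <= N)%N by rewrite leq_pmull.
have [|w hw] := @self_injective _ _ _ hx N 1 N_gt0 1 y%:M (monomial x (N - q))%:M.
  move=> g hg; have := hg 0; rewrite mul_mx_scalar mxE mulrC => /(param_colon_small ny) hq.
  rewrite mul_mx_scalar mxE mulrC.
  apply: (@param_ideal_min _ _ _ q (fun c => param_ideal x N (c * monomial x (N - q)))) hq.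
    by apply: colon_ideal; apply: param_ideal_ideal.
  move=> i; rewrite /monomial (bigD1 i) //= mulrA -exprD subnKC // mulrC.
  by apply: idealM; [exact: param_ideal_ideal | exact: param_ideal_gen].
exists (w 0 0); have := hw 0; rewrite mul_scalar_mx !mxE mulr1n //.
Qed.

End OnePower.
End FrobeniusDivision.

(** * Torsion, finite length and cohomology classes *)

Section IdealPowers.
Variables (R : comNzRingType) (I : ideal R) (n : nat) (g : 'I_n -> R).
Hypothesis I_gen : forall c, c \in I -> exists b : 'I_n -> R, c = \sum_i b i * g i.

(** Pigeonhole: expanding one factor in the generators lowers one exponent in each summand, and the
    exponents run out before the [N.+1] factors do. *)
Lemma prod_kills N (M : lmodType R) (z : M) (e : 'I_n -> nat) (f : 'I_N.+1 -> R) :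
  (\sum_i e i <= N)%N -> (forall i, g i ^+ e i *: z = 0) -> (forall k, f k \in I) ->
  (\prod_k f k) *: z = 0.
Proof.
elim: N z e f => [|N IH] z e f hN hz hf; have [b eb] := I_gen (hf ord_max);
  rewrite big_ord_recr /= -scalerA [in X in _ *: X]eb scaler_suml scaler_sumr big1 // => i _.
  have ei : e i = 0%N.
    by apply/eqP; rewrite -leqn0 (leq_trans _ hN) // (bigD1 i) //= leq_addr.
  by have := hz i; rewrite ei expr0 scale1r => ->; rewrite !scaler0.
case ei: (e i) => [|ei'].
  by have := hz i; rewrite ei expr0 scale1r => ->; rewrite !scaler0.
apply: (IH _ (fun j => if j == i then ei' else e j)) => //.
- rewrite -ltnS (leq_trans _ hN) // (bigD1 i) //= [X in (_ < X)%N](bigD1 i) //= eqxx ei.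
  rewrite addSn ltnS leq_add2l; apply: leq_sum => j /negPf -> //.
- move=> j; case: eqP => [->|_].
    by rewrite scalerA mulrCA -exprSr -ei -scalerA hz scaler0.
  by rewrite scalerA mulrC -scalerA hz scaler0.
Qed.

Lemma torsion_of_powers (M : lmodType R) (z : M) (e : 'I_n -> nat) :
  (forall i, g i ^+ e i *: z = 0) -> z \in @torsion R I M.
Proof.
move=> hz; apply/asboolP; exists (\sum_i e i).+1 => a [r [c [f [hf ->]]]].
rewrite scaler_suml big1 // => j _; rewrite -scalerA.
by rewrite (@prod_kills _ M z e) ?scaler0.
Qed.

End IdealPowers.

Lemma torsion_powers (R : comNzRingType) (I : ideal R) (M : lmodType R) (z : M) :
  z \in @torsion R I M -> exists n, forall y k, y \in I -> (n <= k)%N -> y ^+ k *: z = 0.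
Proof.
move=> /asboolP[n hn]; exists n => y k yI /subnK <-.
rewrite exprD -scalerA hn ?scaler0 //.
exists 1%N, (fun=> 1), (fun _ _ => y); split=> //.
by rewrite big_ord1 mul1r prodr_const card_ord.
Qed.

(** The kernels of the powers of [x] cannot grow strictly [b + 1] times, and once two consecutive
    ones agree all later ones do. *)
Lemma finite_length_kills (R : comNzRingType) (M : lmodType R) (x : R) :
  finite_length M -> (forall u : M, exists k, x ^+ k *: u = 0) ->
  exists b, forall u : M, x ^+ b *: u = 0.
Proof.
move=> [b hb] hu.
have hN k : submodule (fun u : M => x ^+ k *: u = 0).
  split=> [|a u v eu ev]; first by rewrite scaler0.
  by rewrite scalerDr ev addr0 scalerA mulrC -scalerA eu scaler0.
apply: contrapT => hno; suff : (b.+1 <= b)%N by rewrite ltnn.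
apply: (hb _ (fun k => mk_sub (hN k))) => k _; split.
  by move=> u /(mk_subE (hN k)) e; apply: (mk_subE (hN k.+1) u).2; rewrite exprS -scalerA e scaler0.
apply: contrapT => hk; apply: hno; exists k => u.
have stab (v : M) : x ^+ k.+1 *: v = 0 -> x ^+ k *: v = 0.
  move=> hv; apply: contrapT => nv; apply: hk; exists v.
    exact: (mk_subE (hN k.+1) v).2.
  by apply/negP => /(mk_subE (hN k)).
have [n en] := hu u; elim: n en => [|n IH] en.
  by rewrite expr0 scale1r in en; rewrite en scaler0.
case: (leqP n.+1 k) => [nk|kn]; first by rewrite -(subnK nk) exprD -scalerA en scaler0.
apply: IH; rewrite ltnS in kn; rewrite -(subnK kn) addnC exprD -scalerA.
by apply: stab; rewrite scalerA -exprD addSn subnKC.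
Qed.

Section CohomologyClasses.
Variables (R : comNzRingType) (C : complex R) (n : nat).

Lemma cohomology_class (z : C n) : cdiff C n z = 0 ->
  exists w : submod (@cocycle R C n), val w = z.
Proof. by move=> /eqP hz; exists (Sub z hz); rewrite SubK. Qed.

Lemma cohomology_surj (u : cohomology C n) :
  exists w, u = quot_proj (@boundary R C n) w /\ cdiff C n (val w) = 0.
Proof.
have [w ->] := quot_proj_surj u; exists w; split=> //.
by case: w => z /= hz; apply/eqP.
Qed.

Lemma cohomology_eq0 (w : submod (@cocycle R C n)) :
  quot_proj (@boundary R C n) w = 0 <-> is_boundary (val w).
Proof.
by split=> [/quot_proj_eq0/asboolP|h] //; apply: (quot_proj_eq0 _ _).2; apply/asboolP.
Qed.

Lemma cohomology_annihilated a (z : C n) : (forall u : cohomology C n, a *: u = 0) ->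
  cdiff C n z = 0 -> is_boundary (a *: z).
Proof.
move=> h /cohomology_class[w <-].
have := h (quot_proj (@boundary R C n) w).
by rewrite -linearZ => /cohomology_eq0.
Qed.

Lemma cohomology_torsion (x : R) : (forall z : C n, exists k, x ^+ k *: z = 0) ->
  forall u : cohomology C n, exists k, x ^+ k *: u = 0.
Proof.
move=> h u; have [w [-> _]] := cohomology_surj u; have [k hk] := h (val w).
exists k; rewrite -linearZ; apply/cohomology_eq0 => /=.
by rewrite hk; apply: is_boundary0.
Qed.

Lemma cohomology_divide y :
  (forall z : C n, cdiff C n z = 0 ->
     exists z', cdiff C n z' = 0 /\ is_boundary (z - y *: z')) ->
  forall u : cohomology C n, exists v, u = y *: v.
Proof.
move=> h u; have [w [-> hw]] := cohomology_surj u.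
have [z' [/cohomology_class[w' <-] hb]] := h _ hw.
exists (quot_proj (@boundary R C n) w'); apply/eqP; rewrite -subr_eq0 -linearZ -linearB.
by apply/eqP/cohomology_eq0.
Qed.

End CohomologyClasses.

Lemma frobenius_power (R : comNzRingType) p e : p \in [pchar R] ->
  exists phi : {rmorphism R -> R}, forall y, phi y = y ^+ (p ^ e).
Proof.
move=> hp; elim: e => [|e [phi hphi]].
  by exists (idfun : {rmorphism R -> R}) => y; rewrite expn0 expr1.
exists ((pFrobenius_aut hp \o phi) : {rmorphism R -> R}) => y /=.
by rewrite pFrobenius_autE hphi -exprM expnSr.
Qed.

(** * Frobenius twists and annihilation of torsion *)

Section Assembly.
Variable R : comNzRingType.

Lemma exact_rows n k l (A : 'M[R]_(n, k)) (B : 'M[R]_(l, n)) :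
  (forall u : 'rV_n, u *m A = 0 -> exists v, u = v *m B) ->
  forall s (W : 'M_(s, n)), W *m A = 0 -> exists V, W = V *m B.
Proof.
move=> h s W hW.
have hr i : row i W *m A = 0 by rewrite -row_mul hW row0.
have [v hv] := choice (fun i => h _ (hr i)).
exists (\matrix_i v i); apply/row_matrixP => i; by rewrite row_mul rowK.
Qed.

Section Twist.
Variables (d : nat) (x : 'I_d -> R).
Hypothesis hx : regular_system x.
Variables (phi : {rmorphism R -> R}) (q : nat).
Hypothesis q_gt0 : (0 < q)%N.
Hypothesis phiE : forall y, phi y = y ^+ q.

Lemma exact_twist n k l (A : 'M[R]_(n, k)) (B : 'M[R]_(l, n)) :
  (forall u : 'rV_n, u *m A = 0 -> exists v, u = v *m B) ->
  forall u : 'rV_n, u *m map_mx phi A = 0 -> exists v, u = v *m map_mx phi B.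
Proof.
move=> h u /(frobenius_flat hx q_gt0 (fun i => phiE (x i)))[s [W [c [/(exact_rows h)[V ->] ->]]]].
by exists (c *m map_mx phi V); rewrite map_mxM mulmxA.
Qed.

Lemma twist_kernel_col n k (A : 'M[R]_(k, n)) (f : 'cV[R]_n) : map_mx phi A *m f = 0 ->
  exists l (W : 'M[R]_(n, l)) (c : 'cV[R]_l), A *m W = 0 /\ f = map_mx phi W *m c.
Proof.
move=> hf; have [|l [W [c [hW ec]]]] := frobenius_flat hx q_gt0 (fun i => phiE (x i))
  (A := A^T) (v := f^T).
  by rewrite -map_trmx -trmx_mul hf trmx0.
exists l, W^T, c^T; split; first by rewrite -[A]trmxK -trmx_mul hW trmx0.
by rewrite -map_trmx -trmx_mul -ec trmxK.
Qed.

End Twist.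

Section Boundaries.
Variables (r : nat -> nat) (D0 : 'M[R]_(r 0%N, 1)) (D : forall n, 'M[R]_(r n.+1, r n)).

Definition boundary_rank i := if i is i'.+1 then aug_rank r i' else 0%N.

(** The matrix without columns in degree 0 gives one formula for boundaries in all degrees. *)
Definition boundary_mx i : 'M[R]_(aug_rank r i, boundary_rank i) :=
  match i with 0 => 0 | i'.+1 => aug_mx D0 D i' end.

Lemma col_boundaryP i (f : 'cV_(aug_rank r i)) :
  col_boundary D0 D f <-> exists w, f = boundary_mx i *m w.
Proof.
case: i f => [|i] f //=; split=> [->|[w ->]]; last exact: mul0mx.
by exists 0; rewrite mulmx0.
Qed.

Lemma elt_boundaryZ (F : injective_resolution R^o) i a (z : F i) :
  elt_boundary D0 z -> elt_boundary D0 (a *: z).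
Proof.
case: i z => [|i] z /=; first by move=> ->; rewrite scaler0.
move=> [y [ky ->]]; exists (a *: y); rewrite linearZ; split=> // b.
by rewrite scalerA mulrC -scalerA ky scaler0.
Qed.

End Boundaries.

Lemma elt_boundary_le (r : nat -> nat) (D0 D0' : 'M[R]_(r 0%N, 1))
    (F : injective_resolution R^o) i (z : F i) :
  (forall l (y : F l), killed_by_D0 D0 y -> killed_by_D0 D0' y) ->
  elt_boundary D0 z -> elt_boundary D0' z.
Proof.
move=> h; case: i z => [|i] z //= [y [ky ->]]; exists y; split=> //; exact: h.
Qed.

Lemma aug_mx_twist (r : nat -> nat) (D0 : 'M[R]_(r 0%N, 1)) D (phi : {rmorphism R -> R}) i :
  aug_mx (map_mx phi D0) (fun n => map_mx phi (D n)) i = map_mx phi (aug_mx D0 D i).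
Proof. by case: i. Qed.

Lemma boundary_mx_twist (r : nat -> nat) (D0 : 'M[R]_(r 0%N, 1)) D (phi : {rmorphism R -> R}) i :
  boundary_mx (map_mx phi D0) (fun n => map_mx phi (D n)) i = map_mx phi (boundary_mx D0 D i).
Proof. by case: i => [|i] /=; rewrite ?map_mx0 ?aug_mx_twist. Qed.

(** Trades [m]-torsion for annihilation by powers of the parameters: the cochain that bounds
    [x_k^b z] is [m]-torsion, so one exponent kills it for all parameters. *)
Lemma finite_length_kills_torsion (m : ideal R) (d : nat) (x : 'I_d -> R) (M : lmodType R)
    (E : injective_resolution M) j k :
  (forall y, y \in m <-> param_ideal x 1 y) -> finite_length (local_cohomology m E j) ->
  exists b, kills_torsion x (x k ^+ b) E j.
Proof.
move=> hm hfin.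
have xm l : x l \in m by apply/hm; have := param_ideal_gen x 1 l; rewrite expr1.
have [|b hb] := finite_length_kills (x := x k) hfin.
  apply: cohomology_torsion => z; have [n hn] := torsion_powers (valP z).
  by exists n; apply: val_inj; rewrite /= hn.
exists b => t z dz hz.
have zT : z \in @torsion R m (E j).
  apply: (@torsion_of_powers R m d x _ _ z (fun=> t)) => // c /hm[b' ->].
  by exists b'; apply: eq_big => [l|l _]; rewrite ?inE ?expr1.
pose zG : Gamma m (E j) := Sub z zT.
have /(cohomology_annihilated hb) : cdiff (Gamma_complex m E) j zG = 0.
  by apply: val_inj; rewrite /= dz.
rewrite /zG; clear hb zG hfin; case: j z dz hz zT => [|j] z dz hz zT /=.
  by move=> /(congr1 val) /= e; exists t.
move=> [y /(congr1 val) /= ey]; have [n hn] := torsion_powers (valP y).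
exists (maxn t n); split; first exact: leq_maxl.
exists (val y); split=> // _ /mapP[l _ ->]; apply: hn => //; exact: leq_maxr.
Qed.

End Assembly.

(** * Division in local cohomology *)

Section Main.
Variables (R : comNzRingType) (m I : ideal R) (d p i : nat).
Variables (E : injective_resolution {quot I}) (F : injective_resolution R^o).
Variable x : 'I_d -> R.
Hypothesis hx : regular_system x.
Hypothesis hm : forall y, y \in m <-> param_ideal x 1 y.
Hypothesis charR : p \in [pchar R].
Hypothesis Hfin : forall j : nat, (j + i = d)%N -> finite_length (local_cohomology m E j).

Variables (r : nat -> nat) (D0 : 'M[R]_(r 0%N, 1)) (D : forall n, 'M[R]_(r n.+1, r n)).
Hypothesis D0_I : forall y, entry_ideal D0 y <-> y \in I.
Hypothesis DD0 : D 0%N *m D0 = 0.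
Hypothesis D_exact0 : forall u : 'rV_(r 0%N), u *m D0 = 0 -> exists v, u = v *m D 0%N.
Hypothesis DD : forall n, D n.+1 *m D n = 0.
Hypothesis D_exact : forall n (u : 'rV_(r n.+1)), u *m D n = 0 -> exists v, u = v *m D n.+1.

Lemma dual_annihilated k : exists b, forall f : 'cV_(aug_rank r i),
  aug_mx D0 D i *m f = 0 -> col_boundary D0 D (x k ^+ b *: f).
Proof.
have [b hb] : exists b, forall j, (j + i)%N = d -> kills_torsion x (x k ^+ b) E j.
  (* For [i > d] no degree [j] is concerned, and any exponent will do. *)
  case: (leqP i d) => [id|di]; last by exists 0%N => j hj; exfalso; lia.
  have [b hb] := finite_length_kills_torsion k hm (Hfin (subnK id)).
  by exists b => j hj; have -> : j = (d - i)%N by lia.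
exists b => f hf.
have lin : linear (fun u : 'rV[R]_1 => res_aug E (quot_proj I (u 0 0 : R^o))).
  by move=> a u v; rewrite !mxE !linearP.
pose aug := linear_of lin.
have aug_diff u : cdiff E 0 (aug u) = 0 by apply/res_exact0; exists (quot_proj I (u 0 0 : R^o)).
have aug_surj z : cdiff E 0 z = 0 -> exists u, z = aug u.
  move=> /res_exact0[v ->]; have [w ->] := quot_proj_surj v.
  by exists (w%:M); rewrite /= mxE mulr1n.
have aug_ker u : aug u = 0 <-> exists v, u = v *m aug_mx D0 D 0.
  rewrite /aug /=; split=> [e|[v ->]].
    have : quot_proj I (u 0 0 : R^o) = 0 by apply: (@res_aug_inj _ _ E); rewrite e linear0.
    move=> /quot_proj_eq0/D0_I[c ec]; exists c.
    by apply/rowP => k'; rewrite (ord1 k').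
  have h : quot_proj I ((v *m D0) 0 0 : R^o) = 0 by apply/quot_proj_eq0/D0_I; exists v.
  exact: etrans (congr1 (res_aug E) h) (linear0 _).
have Eex : complex_exact E by move=> l z /res_exactS.
have dd n := aug_mxK DD0 DD n.
have de n := @aug_mx_exact R r D0 D D_exact0 D_exact n.
case: i hb f hf => [|i'] hb f hf.
  apply: (dual_annihilated0 hx dd de aug_diff aug_surj aug_ker Eex (@res_injective _ _ E) hf).
  by apply: hb; rewrite addn0.
exact: (dual_annihilatedS hx dd de aug_diff aug_surj aug_ker Eex (@res_injective _ _ E) hf).
Qed.

Lemma prime_p : prime p.
Proof. exact: pcharf_prime charR. Qed.

Lemma powp_gt0 e : (0 < p ^ e)%N.
Proof. by rewrite expn_gt0 prime_gt0 // prime_p. Qed.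

Lemma leq_powp e : (e <= p ^ e)%N.
Proof. by apply/ltnW/ltn_expl/prime_gt1/prime_p. Qed.

(* [z] is killed by the Frobenius power [I^[p ^ e]]. *)
Definition frobenius_killed e l (z : F l) : Prop := forall a, D0 a 0 ^+ (p ^ e) *: z = 0.

Lemma frobenius_killed_le e e' l (z : F l) : (e <= e')%N ->
  frobenius_killed e z -> frobenius_killed e' z.
Proof.
move=> ee hz a; have h : (p ^ e <= p ^ e')%N by apply: leq_pexp2l => //; apply/prime_gt0/prime_p.
by rewrite -(subnK h) exprD -scalerA hz scaler0.
Qed.

Lemma frobenius_killed_torsion e l (z : F l) : frobenius_killed e z -> z \in @torsion R I (F l).
Proof.
move=> hz; apply: (@torsion_of_powers R I _ (fun a => D0 a 0) _ _ z (fun=> p ^ e)%N) => //.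
move=> c /D0_I[b ->]; exists (fun a => b 0 a); rewrite mxE.
by apply: eq_bigr => a _.
Qed.

Lemma torsion_boundary j (z : Gamma I (F j)) (D0' : 'M[R]_(r 0%N, 1)) :
  (forall l (y : F l), killed_by_D0 D0' y -> y \in @torsion R I (F l)) ->
  elt_boundary D0' (val z) -> is_boundary (C := Gamma_complex I F) (k := j) z.
Proof.
move=> h; case: j z => [|j] z /=; first by move=> e; apply: val_inj.
move=> [y [/h yT ey]]; exists (Sub y yT : Gamma I (F j)).
exact: val_inj.
Qed.

Section Level.
Variables (e : nat) (phi : {rmorphism R -> R}).
Hypothesis phiE : forall y, phi y = y ^+ (p ^ e).

Let D0' := map_mx phi D0.
Let D' n := map_mx phi (D n).

Lemma killed_by_twist l (z : F l) : killed_by_D0 D0' z <-> frobenius_killed e z.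
Proof.
by split=> h a; have := h a; rewrite mxE phiE.
Qed.

Lemma twist_DD0 : D' 0%N *m D0' = 0.
Proof. by rewrite -map_mxM DD0 map_mx0. Qed.

Lemma twist_DD n : D' n.+1 *m D' n = 0.
Proof. by rewrite -map_mxM DD map_mx0. Qed.

Lemma twist_exact0 (u : 'rV_(r 0%N)) : u *m D0' = 0 -> exists v, u = v *m D' 0%N.
Proof. exact: (exact_twist hx (powp_gt0 e) phiE D_exact0). Qed.

Lemma twist_exact n (u : 'rV_(r n.+1)) : u *m D' n = 0 -> exists v, u = v *m D' n.+1.
Proof. exact: (exact_twist hx (powp_gt0 e) phiE (@D_exact n)). Qed.

Definition twist_class := @ext_class R r D0' D' twist_DD0 twist_DD F i.

Lemma twist_class_linear a z z' f f' : twist_class z f -> twist_class z' f' ->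
  twist_class (a *: z + z') (a *: f + f').
Proof. exact: ext_class_linear. Qed.

Lemma twist_classZ a z f : twist_class z f -> twist_class (a *: z) (a *: f).
Proof.
move=> h; have h0 := twist_class_linear (-1) h h.
rewrite !scaleN1r !addNr in h0.
by have := twist_class_linear a h h0; rewrite !addr0.
Qed.

Lemma twist_class_col z : cdiff F i z = 0 -> frobenius_killed e z ->
  exists f, map_mx phi (aug_mx D0 D i) *m f = 0 /\ twist_class z f.
Proof.
move=> dz /killed_by_twist kz; rewrite -aug_mx_twist.
exact: (ext_class_col twist_DD0 twist_DD dz kz).
Qed.

Lemma twist_class_elt f : map_mx phi (aug_mx D0 D i) *m f = 0 ->
  exists z, [/\ cdiff F i z = 0, frobenius_killed e z & twist_class z f].
Proof.
rewrite -aug_mx_twist => hf.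
have [z [h1 /killed_by_twist h2 h3]] :=
  ext_class_elt twist_DD0 twist_exact0 twist_DD twist_exact F hf.
by exists z.
Qed.

Lemma twist_class_boundary z f : twist_class z f ->
  elt_boundary D0' z <-> exists w, f = map_mx phi (boundary_mx D0 D i) *m w.
Proof.
move=> h; rewrite -boundary_mx_twist -col_boundaryP; split.
  exact: (ext_class_elt_boundary h).
exact: (ext_class_col_boundary twist_exact0 twist_exact h).
Qed.

End Level.

(** By flatness the cocycle of [z] on the free side is a combination of columns [phi(W)] with [W]
    made of cocycles for [D], so annihilation passes to the pullback. *)
Lemma dual_torsion_level e (phi : {rmorphism R -> R}) (z : F i) :
  (forall y, phi y = y ^+ (p ^ e)) -> cdiff F i z = 0 -> frobenius_killed e z ->
  exists N, forall k, elt_boundary (map_mx phi D0) (x k ^+ N *: z).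
Proof.
move=> phiE dz kz.
have [b hb] := choice dual_annihilated.
have [f [hf hzf]] := twist_class_col phiE dz kz.
have [l [W [c [hW ef]]]] := twist_kernel_col hx (powp_gt0 e) phiE hf.
(* What [x_k ^ b] kills before the twist is killed by [phi(x_k ^ b)] after it, hence the factor
   [p ^ e]. *)
exists ((\max_k b k) * p ^ e)%N => k.
have le : (b k <= \max_k b k)%N by apply: leq_bigmax.
apply/(twist_class_boundary phiE (twist_classZ _ hzf)).
have hcol s : exists w, x k ^+ b k *: col s W = boundary_mx D0 D i *m w.
  by apply/col_boundaryP/hb; rewrite colE mulmxA hW mul0mx.
have [w hw] := choice hcol.
exists (map_mx phi (x k ^+ (\max_k b k - b k) *: \matrix_(a, s) w s a 0) *m c).
rewrite ef exprM -phiE scalemxAl -map_mxZ mulmxA -map_mxM; congr (map_mx phi _ *m c).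
rewrite -{1}(subnK le) exprD -scalerA -scalemxAr; congr (_ *: _).
apply/matrixP => a s; have /colP/(_ a) := hw s; rewrite !mxE => ->.
by apply: eq_bigr => t _; rewrite mxE.
Qed.

Lemma local_cohomology_divide y : y != 0 ->
  forall u : local_cohomology I F i, exists v, u = y *: v.
Proof.
move=> y0; apply: cohomology_divide => zG dzG.
pose z : F i := val zG.
have dz : cdiff F i z = 0 by have := congr1 val dzG.
have [n0 hn0] := torsion_powers (valP zG).
have D0I a : D0 a 0 \in I by apply/D0_I; apply: entry_ideal_gen.
have kz e : (n0 <= e)%N -> frobenius_killed e z.
  by move=> ne a; apply: hn0 => //; apply: leq_trans (leq_powp e).
have [phi' phi'E] := frobenius_power n0 charR.
have [N hN] := dual_torsion_level phi'E dz (kz n0 (leqnn _)).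
have [hN' _ _ _] := hx.
have [e1 he1] : exists e1, ~ param_ideal x e1 y.
  apply/existsNP => hall; move/eqP: y0; apply.
  apply: (@krull_intersection _ _ _ hx R^o (fun y => y = 0)) => //.
    by split=> // b u v -> ->; rewrite scaler0 addr0.
  move=> t; exists 0, y; rewrite add0r; split=> //.
  have [c ec] := hall t; exists c; rewrite ec.
  by apply: eq_big => [j|j _]; [rewrite inE | rewrite mulrC].
have hq1 : ~ param_ideal x (p ^ e1) y by move=> /(param_ideal_le (leq_powp e1)).
(* [N] was obtained at level [n0] and [e1] depends on [y] alone, so both are known before [e] is
   chosen; [p ^ e0] bounds [N], and [e] is at least [n0]. *)
pose e0 := maxn N n0; pose e := (e1 + e0)%N.
have [phi0 phi0E] := frobenius_power e0 charR.
have [phi phiE] := frobenius_power e charR.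
have hmon := monomial_mem_principal hx (powp_gt0 e0) phi0E (powp_gt0 e1) hq1.
rewrite -expnD -/e in hmon.
have ne : (n0 <= e)%N by rewrite /e /e0; lia.
have [f [hf hzf]] := twist_class_col phiE dz (kz e ne).
(* The boundary found at level [n0] is transported to level [e] on the injective side, and only then
   translated to the free side. *)
have hbd k : exists w, x k ^+ (p ^ e0) *: f = map_mx phi (boundary_mx D0 D i) *m w.
  apply/(twist_class_boundary phiE (twist_classZ _ hzf)).
  have hNe : (N <= p ^ e0)%N by apply: leq_trans (leq_powp e0); rewrite leq_maxl.
  rewrite -(subnK hNe) exprD -scalerA; apply: elt_boundaryZ.
  apply: elt_boundary_le (hN k) => l v /(killed_by_twist phi'E) hv.
  by apply/(killed_by_twist phiE); apply: frobenius_killed_le hv.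
have [||||u' [g [hu' eu]]] := @frobenius_divide R d x hx phi (p ^ e) (powp_gt0 e) phiE
    _ _ _ (aug_mx D0 D i)^T (boundary_mx D0 D i)^T f^T (p ^ e0) y.
- by apply: leq_pexp2l; [apply/prime_gt0/prime_p | rewrite leq_addl].
- by rewrite -map_trmx -trmx_mul hf trmx0.
- move=> k; have [w ew] := hbd k; exists w^T.
  by rewrite -map_trmx -trmx_mul -ew linearZ.
- exact: hmon.
have hf' : map_mx phi (aug_mx D0 D i) *m u'^T = 0.
  by apply: trmx_inj; rewrite trmx_mul trmxK trmx0 map_trmx.
have [z' [dz' kz' hz']] := twist_class_elt phiE hf'.
(* [z - y z'] corresponds to [f - y u'], a boundary on the free side; hence it bounds a cochain
   killed by a Frobenius power of [I], which is [I]-torsion. *)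
have := twist_class_linear (- y) hz' hzf.
have ef : f - y *: u'^T = map_mx phi (boundary_mx D0 D i) *m g^T.
  apply: trmx_inj; rewrite linearB linearZ /= trmxK eu addrC addKr.
  by rewrite trmx_mul trmxK map_trmx.
rewrite !scaleNr addrC [- (y *: u'^T) + f]addrC ef => hcl.
have /(twist_class_boundary phiE hcl) hb : exists w, map_mx phi (boundary_mx D0 D i) *m g^T
   = map_mx phi (boundary_mx D0 D i) *m w by exists g^T.
exists (Sub z' (frobenius_killed_torsion kz')); split; first by apply: val_inj; rewrite /= dz'.
apply: (torsion_boundary (D0' := map_mx phi D0)) => [l v /(killed_by_twist phiE)|].
  exact: frobenius_killed_torsion.
exact: hb.
Qed.

End Main.

(* The local cohomology of R/I is zero in negative degrees, so the hypothesis
   only concerns j = d - i when i <= d. *)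
Theorem theorem3p4 (R : comNzRingType) (m I : ideal R) (d p i : nat)
    (E : injective_resolution {quot I}) (F : injective_resolution R^o)
    (Rreg : regular_local_ring m d) (charR : p \in [pchar R])
    (Im : {subset I <= m})
    (Hfin : forall j : nat, (j + i = d)%N ->
              finite_length (local_cohomology m E j)) :
  divisible (local_cohomology I F i) /\
  (forall x : R, x != 0 ->
     forall u : local_cohomology I F i,
       exists v : local_cohomology I F i, x *: v = u).
Proof.
have [x [hx hm]] := regular_local_system Rreg.
have hN := regular_noetherian Rreg.
have [n [g eg]] := hN _ (submodClosed_submodule I).
have [r [D0 [D [eD0 DD0 De0 DD De]]]] := free_resolution hN (\col_k g k).
have D0_I y : entry_ideal D0 y <-> y \in I.
  have eI : y \in I <-> spanned g y by rewrite -eg.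
  rewrite eD0 eI; split=> [[c ->]|[c ->]].
    by exists (fun k => c 0 k); rewrite mxE; apply: eq_bigr => k _; rewrite mxE.
  by exists (\row_k c k); rewrite mxE; apply: eq_bigr => k _; rewrite !mxE.
have main := local_cohomology_divide (F := F) hx hm charR Hfin D0_I DD0 De0 DD De.
split=> [y ry u|y y0 u]; last by have [v ->] := main y y0 u; exists v.
apply: main; apply/eqP => y0.
by have := oner_neq0 R; rewrite -(ry 1 0) ?eqxx // y0 !mul0r.
Qed.
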